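(* Let $\mathcal G$ be an étale groupoid. The $*$-isomorphism $\Lambda'(f)\mapsto T(\Theta(f))$, defined on $\Lambda'(C_c(\beta_r\mathcal G\rtimes\mathcal G))$, extends to an isomorphism from $C^*_r(\beta_r\mathcal G\rtimes\mathcal G)$ onto the uniform $C^*$-algebra $C^*_u(\mathcal G)$, which is the identity on $C^*_r(\mathcal G)$ (i.e. it is compatible with the canonical embeddings of $C^*_r(\mathcal G)$ into these two $C^*$-algebras).
   Context: Conventions. Locally compact spaces are Hausdorff and second countable (except Stone–Čech type compactifications such as $\beta_r\mathcal G$). A locally compact groupoid $\mathcal G$ is a groupoid with a locally compact (Hausdorff, second countable) topology, continuous structure maps, and open range and source maps $r,s:\mathcal G\to\mathcal G^{(0)}=X$; $\mathcal G^x=r^{-1}(x)$. It is étale if $r$ is a local homeomorphism; it then carries the Haar system of counting measures $\lambda^x$ on $\mathcal G^x$. The space $\beta_r\mathcal G$. Let $C_0(\mathcal G,r)$ be the norm closure in $C_b(\mathcal G)$ of the functions whose support is contained in $r^{-1}(K)$ for some compact $K\subset X$. $\beta_r\mathcal G$ is the Gelfand spectrum of $C_0(\mathcal G,r)$; it contains $\mathcal G$ as a dense open subset, the embedding $f\mapsto f\circ r$ of $C_0(X)$ gives a proper continuous map $q=r_\beta:\beta_r\mathcal G\to X$ extending $r$, and the left translation action of $\mathcal G$ on itself extends uniquely to a continuous left action of $\mathcal G$ on $(\beta_r\mathcal G,q)$. The groupoid $\beta_r\mathcal G\rtimes\mathcal G=\{(z,\gamma):q(z)=r(\gamma)\}$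 has unit space $\beta_r\mathcal G$, $r(z,\gamma)=z$, $s(z,\gamma)=\gamma^{-1}z$, $(z,\gamma)(\gamma^{-1}z,\gamma_1)=(z,\gamma\gamma_1)$, and is étale. Reduced algebras. $C_c(\mathcal G)$ is a $*$-algebra for $(f*g)(\gamma)=\int f(\gamma_1)g(\gamma_1^{-1}\gamma)\,d\lambda^{r(\gamma)}(\gamma_1)$, $f^*(\gamma)=\overline{f(\gamma^{-1})}$. Let $\mathcal E=\ell^2_{C_0(X)}(\mathcal G)$ be the Hilbert $C_0(X)$-module completion of $C_c(\mathcal G)$ for $\langle\xi,\eta\rangle(x)=\int_{\mathcal G^x}\overline{\xi}\eta\,d\lambda^x$, $(\xi f)(\gamma)=\xi(\gamma)f(r(\gamma))$. The regular representation is $(\Lambda(f)\xi)(\gamma)=\int f(\gamma^{-1}\gamma_1)\xi(\gamma_1)\,d\lambda^{r(\gamma)}(\gamma_1)$, and $C^*_r(\mathcal G)$ is the norm closure of $\Lambda(C_c(\mathcal G))$ in the adjointable operators $\mathcal B_{C_0(X)}(\mathcal E)$. $\Lambda'$ denotes the regular representation of the groupoid $\beta_r\mathcal G\rtimes\mathcal G$, on the analogous Hilbert $C_0(\beta_r\mathcal G)$-module: $(\Lambda'(f)\xi)(z,\gamma)=\int f(\gamma^{-1}z,\gamma^{-1}\gamma_1)\xi(z,\gamma_1)\,d\lambda^{r(\gamma)}(\gamma_1)$; $C^*_r(\beta_r\mathcal G\rtimes\mathcal G)$ is the closure of its range. Uniform algebra. $\mathcal G*_r\mathcal G=\{(\gamma,\gamma_1):r(\gamma)=r(\gamma_1)\}$;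 a tube is a subset whose image under $(\gamma,\gamma_1)\mapsto\gamma^{-1}\gamma_1$ is relatively compact. $C_t(\mathcal G*_r\mathcal G)$ is the $*$-algebra of continuous bounded functions on $\mathcal G*_r\mathcal G$ supported in a tube, with $(f*g)(\gamma,\gamma')=\int f(\gamma,\gamma_1)g(\gamma_1,\gamma')\,d\lambda^{r(\gamma)}(\gamma_1)$, $f^*(\gamma,\gamma')=\overline{f(\gamma',\gamma)}$. It acts on $\mathcal E$ by $(T(f)\xi)(\gamma)=\int f(\gamma,\gamma_1)\xi(\gamma_1)\,d\lambda^{r(\gamma)}(\gamma_1)$, and $C^*_u(\mathcal G)$ is the $C^*$-subalgebra of $\mathcal B_{C_0(X)}(\mathcal E)$ generated by the operators $T(f)$, $f\in C_t(\mathcal G*_r\mathcal G)$. The map $\Theta:C_c(\beta_r\mathcal G\rtimes\mathcal G)\to C_t(\mathcal G*_r\mathcal G)$ is $\Theta(f)(\gamma,\gamma_1)=f(\gamma^{-1},\gamma^{-1}\gamma_1)$; it is an isomorphism of $*$-algebras. The canonical embeddings of $C^*_r(\mathcal G)$ extend, for $f\in C_c(\mathcal G)$: $f\mapsto\big((z,\gamma)\mapsto f(\gamma)\big)\in C_c(\beta_r\mathcal G\rtimes\mathcal G)$ into $C^*_r(\beta_r\mathcal G\rtimes\mathcal G)$, and $f\mapsto\tilde f\in C_t(\mathcal G*_r\mathcal G)$, $\tilde f(\gamma,\gamma_1)=f(\gamma^{-1}\gamma_1)$, into $C^*_u(\mathcal G)$. *)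

(* Defs.v *)
From HB Require Import structures.
From mathcomp Require Import all_boot all_order all_algebra.
From mathcomp Require Import complex.
From mathcomp Require Import all_classical all_reals all_analysis.

Set Implicit Arguments.
Unset Strict Implicit.
Unset Printing Implicit Defensive.

Import Order.TTheory GRing.Theory Num.Theory.
Import numFieldNormedType.Exports.

Local Open Scope classical_set_scope.
Local Open Scope ring_scope.

(* The complex numbers.  The detour through [numClosedFieldType] is what makes
   the norm topology of MathComp-Analysis available on them. *)
Definition cplx (R : realType) : numClosedFieldType := R[i].

Definition cnorm {R : realType} (z : cplx R) : R := complex.Re `|z|.

Section FunctionSpaces.
Context {R : realType} {T : topologicalType}.
Implicit Types f h : T -> cplx R.

Definition supp f : set T := closure [set x | f x != 0].

Definition Cb : set (T -> cplx R) :=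
  [set f | continuous f /\ exists M : R, forall x, cnorm (f x) <= M].

Definition Cc : set (T -> cplx R) :=
  [set f | continuous f /\ compact (supp f)].

Definition C0 : set (T -> cplx R) :=
  [set f | continuous f /\ forall e : R, 0 < e ->
     exists2 K : set T, compact K & forall x, ~ K x -> cnorm (f x) <= e].

End FunctionSpaces.

Section Sums.
Context {R : realType} {T : choiceType}.

(* The integral over [A] of a summable function for the counting measure. *)
Definition rsum (A : set T) (f : T -> R) : R :=
  fine (\esum_(x in A) ((EFin \o f)^\+ x)%E)
  - fine (\esum_(x in A) ((EFin \o f)^\- x)%E).

Definition csum (A : set T) (f : T -> cplx R) : cplx R :=
  Complex (rsum A (fun x => complex.Re (f x)))
          (rsum A (fun x => complex.Im (f x))).

End Sums.

(* The data of a groupoid with topologies on the arrows and on the units.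
   [gmul g h] is meaningful only when [gsrc g = grng h]. *)
Record groupoid_data := GroupoidData {
  arrows :> topologicalType;
  units : topologicalType;
  grng : arrows -> units;
  gsrc : arrows -> units;
  gunit : units -> arrows;
  ginv : arrows -> arrows;
  gmul : arrows -> arrows -> arrows }.

Arguments grng {_}.
Arguments gsrc {_}.
Arguments gunit {_}.
Arguments ginv {_}.
Arguments gmul {_}.

Definition composable (G : groupoid_data) : set (G * G) :=
  [set p | gsrc p.1 = grng p.2].

Arguments composable : clear implicits.

Record is_groupoid (G : groupoid_data) : Prop := IsGroupoid {
  grng_unit : forall x : units G, grng (gunit x) = x;
  gsrc_unit : forall x : units G, gsrc (gunit x) = x;
  grng_mul : forall g h : G, gsrc g = grng h -> grng (gmul g h) = grng g;
  gsrc_mul : forall g h : G, gsrc g = grng h -> gsrc (gmul g h) = gsrc h;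
  gmulA : forall g h k : G, gsrc g = grng h -> gsrc h = grng k ->
    gmul g (gmul h k) = gmul (gmul g h) k;
  gmul1g : forall g : G, gmul (gunit (grng g)) g = g;
  gmulg1 : forall g : G, gmul g (gunit (gsrc g)) = g;
  grng_inv : forall g : G, grng (ginv g) = gsrc g;
  gsrc_inv : forall g : G, gsrc (ginv g) = grng g;
  gmulVg : forall g : G, gmul (ginv g) g = gunit (gsrc g);
  gmulgV : forall g : G, gmul g (ginv g) = gunit (grng g) }.

Definition lc_space (T : topologicalType) : Prop :=
  [/\ locally_compact [set: T], hausdorff_space T & @second_countable T].

Definition open_map (S T : topologicalType) (f : S -> T) : Prop :=
  forall U : set S, open U -> open (f @` U).

Record is_lc_groupoid (G : groupoid_data) : Prop := IsLcGroupoid {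
  lc_groupoidP : is_groupoid G;
  lc_arrows : lc_space G;
  lc_units : lc_space (units G);
  grng_continuous : continuous (@grng G);
  gsrc_continuous : continuous (@gsrc G);
  gunit_continuous : continuous (@gunit G);
  ginv_continuous : continuous (@ginv G);
  gmul_continuous :
    {within composable G, continuous (fun p : G * G => gmul p.1 p.2)};
  grng_open : open_map (@grng G);
  gsrc_open : open_map (@gsrc G) }.

Definition local_homeomorphism (S T : topologicalType) (f : S -> T) : Prop :=
  continuous f /\
  forall x : S, exists U : set S,
    [/\ open U, U x, open (f @` U), set_inj U f &
        forall V : set S, open V -> V `<=` U -> open (f @` V)].

Record etale_groupoid := EtaleGroupoid {
  etale_data :> groupoid_data;
  etale_lc : is_lc_groupoid etale_data;
  etale_local_homeo : local_homeomorphism (@grng etale_data) }.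

Section Operators.
Context (R : realType) (G : groupoid_data).
Local Notation C := (cplx R).

Definition fibre (x : units G) : set G := [set g | grng g = x].

Definition fibre_int (x : units G) (f : G -> C) : C := csum (fibre x) f.

Definition sqnorm_at (xi : G -> C) (x : units G) : \bar R :=
  (\esum_(g in fibre x) ((cnorm (xi g) ^+ 2)%:E))%E.

Definition hnorm (xi : G -> C) : \bar R :=
  sqrte (ereal_sup (range (sqnorm_at xi))).

(* The Hilbert module completion of [Cc] is realised as the closure of [Cc]
   in the complete space of all functions [xi] with [hnorm xi] finite. *)
Definition hmod : set (G -> C) :=
  [set xi | forall e : R, 0 < e ->
     exists2 eta, Cc eta & (hnorm (xi - eta)%R <= e%:E)%E].

Definition inner (xi eta : G -> C) (x : units G) : C :=
  fibre_int x (fun g => Num.conj (xi g) * eta g).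

(* An operator on [hmod] is a total function; it takes the value 0 outside
   [hmod], so that operators which agree on [hmod] are equal. *)
Definition op := (G -> C) -> (G -> C).

Definition on_hmod (A : op) : op := fun xi => if xi \in hmod then A xi else 0.

Definition is_op (A : op) : Prop :=
  (forall xi, hmod xi -> hmod (A xi)) /\ (forall xi, ~ hmod xi -> A xi = 0).

Definition adjoint_of (A B : op) : Prop :=
  forall xi eta, hmod xi -> hmod eta ->
    forall x, inner (A xi) eta x = inner xi (B eta) x.

Definition adjointable : set op :=
  [set A | is_op A /\ exists2 B, is_op B & adjoint_of A B].

Definition scale_op (c : C) (A : op) : op := fun xi g => c * A xi g.

Definition opnorm (A : op) : \bar R :=
  ereal_sup [set hnorm (A xi) | xi in [set xi | hmod xi /\ (hnorm xi <= 1)%E]].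

Definition opclosure (S : set op) : set op :=
  [set A | adjointable A /\ forall e : R, 0 < e ->
     exists2 B, S B & (opnorm (A - B)%R <= e%:E)%E].

Record is_cstar_subalgebra (S : set op) : Prop := IsCstarSubalgebra {
  cstar_sub_adjointable : S `<=` adjointable;
  cstar_sub0 : S 0;
  cstar_subD : forall A B, S A -> S B -> S (A + B);
  cstar_subZ : forall c A, S A -> S (scale_op c A);
  cstar_subM : forall A B, S A -> S B -> S (A \o B);
  cstar_sub_star : forall A B, S A -> adjointable B -> adjoint_of A B -> S B;
  cstar_sub_closed : opclosure S `<=` S }.

Definition cstar_generated (S : set op) : set op :=
  [set A | adjointable A /\
     forall S', is_cstar_subalgebra S' -> S `<=` S' -> S' A].

Definition Lambda (f : G -> C) : op :=
  on_hmod (fun xi g =>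
    fibre_int (grng g) (fun g1 => f (gmul (ginv g) g1) * xi g1)).

Definition Cstar_r : set op := opclosure (Lambda @` Cc).

Definition fibre_product : set (G * G) := [set p | grng p.1 = grng p.2].

Definition tube (D : set (G * G)) : Prop :=
  D `<=` fibre_product /\
  precompact ((fun p : G * G => gmul (ginv p.1) p.2) @` D).

(* Functions on the fibre product are represented by functions on [G * G];
   their values outside the fibre product are never used. *)
Definition Ct : set (G * G -> C) :=
  [set f | [/\ {within fibre_product, continuous f},
     exists M : R, forall p, fibre_product p -> cnorm (f p) <= M &
     exists2 D, tube D &
       fibre_product `&` closure [set p | fibre_product p /\ f p != 0] `<=` D]].

Definition Top (f : G * G -> C) : op :=
  on_hmod (fun xi g => fibre_int (grng g) (fun g1 => f (g, g1) * xi g1)).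

Definition Cstar_u : set op := cstar_generated (Top @` Ct).

End Operators.

Arguments Cstar_r : clear implicits.
Arguments Cstar_u : clear implicits.
Arguments Lambda {R G}.
Arguments Top {R G}.
Arguments adjoint_of {R G}.
Arguments opnorm {R G}.
Arguments scale_op {R G}.
Arguments adjointable {R G}.

Section Morphisms.
Context {R : realType} {G H : groupoid_data}.
Implicit Types (S : set (op R G)) (Q : set (op R H)).

Definition cstar_hom S Q (phi : op R G -> op R H) : Prop :=
  [/\ forall A, S A -> Q (phi A),
      forall A B, S A -> S B -> phi (A + B) = phi A + phi B,
      forall c A, S A -> phi (scale_op c A) = scale_op c (phi A),
      forall A B, S A -> S B -> phi (A \o B) = phi A \o phi B &
      forall A B, S A -> S B -> adjoint_of A B -> adjoint_of (phi A) (phi B)].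

Definition cstar_iso S Q (phi : op R G -> op R H) : Prop :=
  cstar_hom S Q phi /\ set_bij S Q phi.

(* Injective *-homomorphisms of C*-algebras are isometric. *)
Definition cstar_embedding S Q (phi : op R G -> op R H) : Prop :=
  cstar_hom S Q phi /\ forall A, S A -> opnorm (phi A) = opnorm A.

End Morphisms.

Section Characters.
Context (R : realType) (G : groupoid_data).
Local Notation C := (cplx R).

Definition C0r : set (G -> C) :=
  [set f | Cb f /\ forall e : R, 0 < e ->
     exists h, exists K : set (units G),
       [/\ Cb h, compact K, supp h `<=` grng @^-1` K &
           forall g, cnorm (f g - h g) <= e]].

(* A character of [C0r] is a total function; it takes the value 0 outside
   [C0r], so that characters which agree on [C0r] are equal. *)
Record is_character (z : (G -> C) -> C) : Prop := IsCharacter {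
  character_out : forall f, ~ C0r f -> z f = 0;
  characterD : forall f h, C0r f -> C0r h -> z (f + h) = z f + z h;
  characterZ : forall (c : C) f, C0r f -> z (fun g => c * f g) = c * z f;
  characterM : forall f h, C0r f -> C0r h -> z (f * h) = z f * z h;
  character_conj : forall f, C0r f ->
    z (fun g => Num.conj (f g)) = Num.conj (z f);
  character_neq0 : exists2 f, C0r f & z f != 0 }.

Definition characters : set (prod_topology (fun _ : G -> C => C)) :=
  [set z | is_character z].

(* The Gelfand spectrum, with the topology of pointwise convergence. *)
Definition beta : topologicalType := set_type characters.

Definition beta_eval (z : beta) : (G -> C) -> C := set_val z.

Lemma beta_character (z : beta) : is_character (beta_eval z).
Proof. exact: set_valP. Qed.

Lemma beta_units_inhabited (z : beta) : exists x : units G, True.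
Proof.
have [f Cf zf] := character_neq0 (beta_character z).
have [[x _]|X0] := pselect (exists x : units G, True); first by exists x.
case/eqP: zf.
have -> : f = fun g => 0 * f g.
  by apply/funext => g; case: X0; exists (grng g).
by rewrite (characterZ (beta_character z)) // mul0r.
Qed.

Definition beta_q (z : beta) : units G :=
  xget (projT1 (cid (beta_units_inhabited z)))
       [set x | forall h : units G -> C, C0 h -> beta_eval z (h \o grng) = h x].

End Characters.

Arguments C0r {R G}.
Arguments beta_q {R G}.
Arguments beta_eval {R G}.
Section ModulusFacts.
Context {R : realType}.
Implicit Types z w : cplx R.

Lemma cnormE z : `|z| = Complex (cnorm z) 0.
Proof. by rewrite /cnorm normc_def. Qed.

Lemma cnorm_le z (M : R) : (cnorm z <= M) = (`|z| <= Complex M 0).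
Proof. by rewrite cnormE lecR. Qed.

Lemma cnorm_ge0 z : 0 <= cnorm z.
Proof. by rewrite -lecR -[X in _ <= X]cnormE normr_ge0. Qed.

Lemma cnormM z w : cnorm (z * w) = cnorm z * cnorm w.
Proof.
apply: (@complexI R); rewrite rmorphM /=.
by rewrite -[LHS]cnormE normrM !cnormE.
Qed.

Lemma cnorm_triangle z w : cnorm (z + w) <= cnorm z + cnorm w.
Proof.
rewrite -lecR rmorphD /= -[X in X <= _]cnormE.
by apply: le_trans (ler_normD _ _) _; rewrite !cnormE.
Qed.

Lemma cnorm_conj z : cnorm (Num.conj z) = cnorm z.
Proof. by rewrite /cnorm norm_conjC. Qed.

Lemma conj_continuous : continuous (fun z => Num.conj z).
Proof.
move=> z; apply/(@cvgrPdist_lt _ (cplx R) _ (nbhs z)) => e e0.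
apply/nbhs_ballP; exists e => // w.
by rewrite -ball_normE /= -rmorphB norm_conjC.
Qed.

Lemma real_cplx_continuous : continuous (fun x : R => Complex x 0 : cplx R).
Proof.
move=> x; apply/cvgrPdist_lt => -[e e'] /=.
rewrite ltcE /= => /andP[/eqP -> e0].
apply/nbhs_ballP; exists e => // y; rewrite /ball /= => xy.
have -> : (Complex x 0 - Complex y 0 : cplx R) = Complex (x - y) 0.
  by rewrite -[RHS]/((x - y)%:C)%C rmorphB.
by rewrite normc_def /= expr0n addr0 sqrtr_sqr ltcR.
Qed.

End ModulusFacts.

Section C0rFacts.
Context {R : realType}.
Implicit Type G : groupoid_data.

Lemma Cb_add (T : topologicalType) (f h : T -> cplx R) :
  Cb f -> Cb h -> Cb (f + h).
Proof.
move=> [cf [M fM]] [ch [N hN]]; split.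
  by move=> x; apply: continuousD; [exact: cf|exact: ch].
by exists (M + N) => x; apply: le_trans (cnorm_triangle _ _) (lerD _ _).
Qed.

Lemma Cb_mul (T : topologicalType) (f h : T -> cplx R) :
  Cb f -> Cb h -> Cb (f * h).
Proof.
move=> [cf [M fM]] [ch [N hN]]; split.
  by move=> x; apply: continuousM; [exact: cf|exact: ch].
exists (M * N) => x; rewrite [cnorm _]cnormM.
by apply: ler_pM; rewrite ?cnorm_ge0.
Qed.

Lemma Cb_conj (T : topologicalType) (f : T -> cplx R) :
  Cb f -> Cb (fun x => Num.conj (f x)).
Proof.
move=> [cf [M fM]]; split; last by exists M => x; rewrite cnorm_conj.
by move=> x; apply: continuous_comp; [exact: cf|exact: conj_continuous].
Qed.

Lemma supp_sub (T : topologicalType) (f h : T -> cplx R) :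
  (forall x, f x = 0 -> h x = 0) -> supp h `<=` supp f.
Proof.
by move=> fh; apply: closureS => x /=; apply: contra_neq => /fh.
Qed.

Lemma C0r_add G (f h : G -> cplx R) : C0r f -> C0r h -> C0r (f + h).
Proof.
move=> [bf af] [bh ah]; split; first exact: Cb_add.
move=> e e0; have e2 : 0 < e / 2 by rewrite divr_gt0.
have [f' [K [bf' cK fK ff']]] := af _ e2.
have [h' [L [bh' cL hL hh']]] := ah _ e2.
exists (f' + h'), (K `|` L); split.
- exact: Cb_add.
- exact: compactU.
- apply: (@subset_trans _ (supp f' `|` supp h')).
    rewrite /supp -closureU; apply: closureS => x /=.
    rewrite -[_ x]/(f' x + h' x) => fhx.
    have [f0|?] := eqVneq (f' x) 0; last by left.
    by right; move: fhx; rewrite f0 add0r.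
  by move=> x [/fK|/hL] ?; [left|right].
- move=> g; rewrite -[_ g - _]/(f g + h g - (f' g + h' g)) opprD addrACA.
  by apply: le_trans (cnorm_triangle _ _) _; rewrite [leRHS]splitr lerD.
Qed.

Lemma C0r_mulr G (f h : G -> cplx R) : C0r f -> Cb h -> C0r (f * h).
Proof.
move=> [bf af] bh; split; first exact: Cb_mul.
move=> e e0; have [_ [N hN]] := bh.
have N0 : 0 < `|N| + 1 by rewrite ltr_wpDl.
have [f' [K [bf' cK fK ff']]] := af _ (divr_gt0 e0 N0).
exists (f' * h), K; split => //.
- exact: Cb_mul.
- by apply: subset_trans fK; apply: supp_sub => x /= f0;
    rewrite -[_ x]/(f' x * h x) f0 mul0r.
- move=> g; rewrite -[_ g - _]/(f g * h g - f' g * h g) -mulrBl cnormM.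
  rewrite -[leRHS](divfK (lt0r_neq0 N0)).
  apply: ler_pM; rewrite ?cnorm_ge0 ?ff' //.
  by apply: le_trans (hN g) _; apply: le_trans (ler_norm _) _; rewrite lerDl.
Qed.

Lemma C0r_conj G (f : G -> cplx R) :
  C0r f -> C0r (fun g => Num.conj (f g)).
Proof.
move=> [bf af]; split; first exact: Cb_conj.
move=> e /af[f' [K [bf' cK fK ff']]].
exists (fun g => Num.conj (f' g)), K; split => //.
- exact: Cb_conj.
- by apply: subset_trans fK; apply: supp_sub => x ->; rewrite conjC0.
- by move=> g; rewrite -rmorphB cnorm_conj.
Qed.

Lemma C0r_scale G (c : cplx R) (f : G -> cplx R) :
  C0r f -> C0r (fun g => c * f g).
Proof.
move=> Cf; have -> : (fun g => c * f g) = f * cst c.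
  by apply/funext => g; rewrite -[RHS]/(f g * c) mulrC.
apply: C0r_mulr => //; split; first exact: cst_continuous.
by exists (cnorm c).
Qed.

Lemma C0r_neq0 (G : etale_groupoid) (g : G) :
  exists2 f : G -> cplx R, C0r f & f g != 0.
Proof.
have [[lcX hX _] lcG] := (lc_units (etale_lc G), etale_lc G).
set x := grng g.
have [K nK [cK clK]] : compact_near (nbhs x).
  by have := lcX x I; rewrite withinET.
have clB : closed (~` K°) by rewrite closedC; exact: open_interior.
have Bx : ~ (~` K°) x by apply; exact: nK.
have /(@uniform_separatorP _ R)[k [ck k01 kx kB]] :
    uniform_separator [set x] (~` K°).
  exact: (@locally_compact_completely_regular _ R lcX hX).
pose h y : cplx R := Complex (1 - k y) 0.
have ch : continuous h.
  move=> y; apply: (@continuous_comp _ _ _ (fun y => 1 - k y)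
    (fun t : R => Complex t 0 : cplx R)); last exact: real_cplx_continuous.
  by apply: continuousB; [exact: cst_continuous|exact: ck].
have hK y : ~ K y -> h y = 0.
  move=> Ky; rewrite /h; have -> : k y = 1; last by rewrite subrr.
  by apply: kB; exists y => // /interior_subset.
have bh : Cb (h \o @grng G).
  split.
    move=> y; apply: continuous_comp; last exact: ch.
    exact: grng_continuous.
  exists 1 => y; rewrite cnorm_le normc_def /= expr0n addr0 sqrtr_sqr lecR.
  have : range k (k (grng y)) by exists (grng y).
  by move=> /k01; rewrite /= in_itv /= => /andP[k0 k1]; rewrite ger0_norm;
    rewrite ?subr_ge0 // lerBlDr lerDl.
exists (h \o @grng G); last first.
  rewrite /= -/x /h; have -> : k x = 0 by apply: kx; exists x.
  by rewrite subr0 oner_neq0.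
split=> // e e0; exists (h \o @grng G), K; split => //.
  have clrK : closed (@grng G @^-1` K).
    by apply: preimage_closed => // y _; exact: grng_continuous.
  rewrite [X in _ `<=` X](closure_id _).1 //.
  by apply: closureS => y /=; apply: contra_neqP => /hK.
by move=> y; rewrite subrr /cnorm normr0 ltW.
Qed.

End C0rFacts.

Section StoneCech.
Context (R : realType) (G : etale_groupoid).
Local Notation C := (cplx R).

Definition evaluation (g : G) : (G -> C) -> C :=
  fun f => if f \in C0r then f g else 0.

Lemma evaluationE (g : G) (f : G -> C) : C0r f -> evaluation g f = f g.
Proof. by move=> Cf; rewrite /evaluation mem_set. Qed.

Lemma evaluation_character (g : G) : is_character (evaluation g).
Proof.
split.
- by move=> f Cf; rewrite /evaluation memNset.
- by move=> f h Cf Ch; rewrite !evaluationE //; exact: C0r_add.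
- by move=> c f Cf; rewrite !evaluationE //; exact: C0r_scale.
- by move=> f h Cf Ch; rewrite !evaluationE //; apply: C0r_mulr Cf Ch.1.
- by move=> f Cf; rewrite !evaluationE //; exact: C0r_conj.
- by have [f Cf fg] := C0r_neq0 (R := R) g; exists f; rewrite ?evaluationE.
Qed.

Definition beta_emb (g : G) : beta R G :=
  exist _ (evaluation g) (mem_set (evaluation_character g)).

(* [a g z] is meaningful only when [gsrc g = beta_q z]. *)
Record is_translation_action (a : G -> beta R G -> beta R G) : Prop :=
  IsTranslationAction {
  act_q : forall g z, gsrc g = beta_q z -> beta_q (a g z) = grng g;
  act_unit : forall z, a (gunit (beta_q z)) z = z;
  act_mul : forall g h z, gsrc g = grng h -> gsrc h = beta_q z ->
    a (gmul g h) z = a g (a h z);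
  act_continuous :
    {within [set p : G * beta R G | gsrc p.1 = beta_q p.2],
      continuous (fun p : G * beta R G => a p.1 p.2)};
  act_translation : forall g h, gsrc g = grng h ->
    a g (beta_emb h) = beta_emb (gmul g h) }.

(* Left translation extends uniquely to a continuous action on [beta];
   [beta_act] is this extension. *)
Definition beta_act : G -> beta R G -> beta R G :=
  xget (fun (_ : G) (z : beta R G) => z) [set a | is_translation_action a].

Definition sd_arrows : set (beta R G * G) :=
  [set p | beta_q p.1 = grng p.2].

Lemma sd_unit_subproof (z : beta R G) :
  (z, gunit (beta_q z)) \in sd_arrows.
Proof.
by apply/mem_set; rewrite /sd_arrows /= (grng_unit (lc_groupoidP (etale_lc G))).
Qed.

Definition sd_unit (z : beta R G) : set_type sd_arrows :=
  exist _ (z, gunit (beta_q z)) (sd_unit_subproof z).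

(* In [ginv] the pair always lies in [sd_arrows] for the translation action,
   and in [gmul] it does so when the product is meaningful; the first argument
   of [insubd] is a default value. *)
Definition semidirect : groupoid_data := {|
  arrows := set_type sd_arrows;
  units := beta R G;
  grng := fun p => (set_val p).1;
  gsrc := fun p => beta_act (ginv (set_val p).2) (set_val p).1;
  gunit := sd_unit;
  ginv := fun p => insubd p
    (beta_act (ginv (set_val p).2) (set_val p).1, ginv (set_val p).2);
  gmul := fun p p' => insubd p
    ((set_val p).1, gmul (set_val p).2 (set_val p').2) |}.

(* [(beta_emb (ginv g), gmul (ginv g) g1)] is an arrow of [semidirect]
   when [grng g = grng g1]. *)
Definition Theta (f : semidirect -> C) : G * G -> C := fun p =>
  oapp f 0 (insub (beta_emb (ginv p.1), gmul (ginv p.1) p.2)).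

Definition lift_semidirect (f : G -> C) : semidirect -> C :=
  fun p => f (set_val p).2.

Definition lift_uniform (f : G -> C) : G * G -> C :=
  fun p => f (gmul (ginv p.1) p.2).

End StoneCech.

Arguments semidirect : clear implicits.

(* Main.v *)
Require Import Defs.
From mathcomp Require Import all_boot all_order all_algebra.
From mathcomp Require Import complex finmap.
From mathcomp Require Import all_classical all_reals all_analysis.
From mathcomp Require Import ring lra.

Set Implicit Arguments.
Unset Strict Implicit.
Unset Printing Implicit Defensive.

Import Order.TTheory GRing.Theory Num.Theory.
Import numFieldNormedType.Exports.

Local Open Scope classical_set_scope.
Local Open Scope ring_scope.

(* The unit space of [G] sits inside [beta], and the fibre of the semidirect
   product over the unit at [x] is the fibre of [G] over [x].  Restricting an
   operator to these fibres is a contractive *-homomorphism, because adjointable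
   operators act fibrewise, and it sends [Lambda f] to [Top (Theta f)].

   It is isometric on the regular representation: right translation by [g]
   identifies [Lambda f] over the point [g] of [beta] with its restriction over
   the source of [g], the arrows are dense in [beta], and the fibre norms are
   lower semicontinuous.  A vector over one fibre extends to a compactly
   supported section without increase of norm, the range map being a local
   homeomorphism.

   Bounded continuous functions on the fibre product extend continuously to the
   semidirect product, which gives the action on [beta] and the surjectivity of
   [Theta].  Since restriction to the units is compatible with the regular
   representation of [G], the embedding into [Cstar_u] is an inclusion, and the
   other one is its composition with the inverse isomorphism. *)

(** * Sums over discrete fibres *)

(** The points of [beta] that are not arrows have no concrete description. Anything at such a point
    [z], or at a pair [(z, g)], is obtained as a limit along the traces on [G] of the neighbourhoods
    of [z], with [g] replaced by a moving arrow on a local section through [g]. This is why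
    continuity is mostly stated with arbitrary filters and functions of pairs. Vectors are plain
    functions, and norms are handled as inequalities between real numbers over finite lists; the
    extended reals of the definitions appear only at the interface. No *-algebra identity is checked
    for tubes: the operators [Top F] are the image of the operators [Lambda f] under restriction,
    hence form a *-algebra, and its closure is the generated algebra. The isometry on the operators
    [Lambda f] passes to the closure. It gives injectivity there, and surjectivity because preimages
    of a Cauchy sequence are again Cauchy; as the limit must be adjointable, the adjoints are made
    to converge along with the operators. *)

Section Modulus.
Context {R : realType}.
Implicit Types z w : cplx R.

Lemma cnorm0 : cnorm (0 : cplx R) = 0.
Proof. by rewrite /cnorm normr0. Qed.

Lemma cnorm1 : cnorm (1 : cplx R) = 1.
Proof. by rewrite /cnorm normr1. Qed.

Lemma cnormN z : cnorm (- z) = cnorm z.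
Proof. by rewrite /cnorm normrN. Qed.

Lemma cnorm_dist z w : cnorm (z - w) = cnorm (w - z).
Proof. by rewrite -cnormN opprB. Qed.

Lemma cnorm_eq0 z : cnorm z = 0 -> z = 0.
Proof. by move=> z0; apply/eqP; rewrite -normr_eq0 cnormE z0. Qed.

Lemma cnorm_gt0 z : z != 0 -> 0 < cnorm z.
Proof.
by move=> z0; rewrite lt_neqAle cnorm_ge0 andbT; apply: contra_neq z0 => /esym/cnorm_eq0.
Qed.

Lemma cnormV z : cnorm z^-1 = (cnorm z)^-1.
Proof.
have [->|z0] := eqVneq z 0; first by rewrite invr0 cnorm0 invr0.
have n0 : cnorm z != 0 by rewrite gt_eqF ?cnorm_gt0.
by apply: (mulfI n0); rewrite -cnormM !mulfV// cnorm1.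
Qed.

Lemma ltc_cnorm z (e : R) : (`|z| < Complex e 0) = (cnorm z < e).
Proof. by rewrite cnormE ltcR. Qed.

Lemma Re_le_cnorm z : `|complex.Re z| <= cnorm z.
Proof.
case: z => a b; rewrite /cnorm normc_def /=.
by rewrite -sqrtr_sqr ler_wsqrtr// lerDl sqr_ge0.
Qed.

Lemma Im_le_cnorm z : `|complex.Im z| <= cnorm z.
Proof.
case: z => a b; rewrite /cnorm normc_def /=.
by rewrite -sqrtr_sqr ler_wsqrtr// lerDr sqr_ge0.
Qed.

Lemma cnorm_real (x : R) : cnorm (Complex x 0 : cplx R) = `|x|.
Proof. by rewrite /cnorm normc_def /= expr0n addr0 sqrtr_sqr. Qed.

Lemma cnorm_le_ReIm z : cnorm z <= `|complex.Re z| + `|complex.Im z|.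
Proof.
case: z => a b; rewrite /cnorm normc_def /=.
rewrite -[leRHS]ger0_norm ?addr_ge0// -sqrtr_sqr ler_wsqrtr//.
by rewrite sqrrD !real_normK ?num_real// lerD2r lerDl mulrn_wge0// mulr_ge0.
Qed.

Lemma cnorm_sum (I : Type) (s : seq I) (F : I -> cplx R) :
  cnorm (\sum_(i <- s) F i) <= \sum_(i <- s) cnorm (F i).
Proof.
elim/big_ind2 : _ => [|x1 x2 y1 y2 h1 h2|//]; first by rewrite cnorm0.
by apply: le_trans (cnorm_triangle _ _) (lerD _ _).
Qed.

Lemma ReIm_sum (I : Type) (s : seq I) (F : I -> cplx R) :
  complex.Re (\sum_(i <- s) F i) = \sum_(i <- s) complex.Re (F i) /\
  complex.Im (\sum_(i <- s) F i) = \sum_(i <- s) complex.Im (F i).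
Proof.
elim: s => [|i s [ih1 ih2]]; first by rewrite !big_nil.
by rewrite !big_cons -ih1 -ih2; case: (F i) => a b; case: (\sum_(_ <- s) _).
Qed.

Lemma sqr_cnorm z : Complex (cnorm z ^+ 2) 0 = Num.conj z * z :> cplx R.
Proof.
rewrite mulrC -normCK cnormE -[RHS]/((cnorm z)%:C%C ^+ 2) -rmorphXn//.
Qed.

Lemma cnorm_sub_triangle (y z w : cplx R) :
  cnorm (z - w) <= cnorm (z - y) + cnorm (y - w).
Proof. by have := cnorm_triangle (z - y) (y - w); rewrite addrA subrK. Qed.

Lemma cvg_cnormP (T : Type) (F : set_system T) {FF : Filter F}
    (f : T -> cplx R) (l : cplx R) :
  f @ F --> l <-> forall e : R, 0 < e -> \forall x \near F, cnorm (f x - l) < e.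
Proof.
split=> [/cvgrPdist_lt fl e e0|fl].
  have := fl (Complex e 0 : cplx R); rewrite ltcR => /(_ e0).
  by apply: filterS => x; rewrite ltc_cnorm cnorm_dist.
(* A positive complex radius is real, because the order on the complex numbers compares only numbers
   with the same imaginary part. *)
apply/cvgrPdist_lt => -[e e'] /=; rewrite ltcE /= => /andP[/eqP -> e0].
have := fl _ e0; apply: filterS => x; rewrite cnorm_dist -ltc_cnorm//.
Qed.

Lemma cplx_hausdorff : hausdorff_space (cplx R).
Proof. exact: (@norm_hausdorff _ (cplx R)). Qed.

Lemma cvg_cnorm (T : Type) (F : set_system T) {FF : Filter F}
    (f : T -> cplx R) (l : cplx R) :
  f @ F --> l -> (fun x => cnorm (f x)) @ F --> cnorm l.
Proof.
move=> /cvg_cnormP fl; apply/cvgrPdist_lt => e /fl.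
apply: filterS => x fx; apply: le_lt_trans fx.
have h1 := cnorm_triangle (f x - l) l; have h2 := cnorm_triangle (l - f x) (f x).
move: h1 h2; rewrite !subrK (cnorm_dist l) ler_norml => h1 h2.
by apply/andP; split; lra.
Qed.

Lemma cvg_ReIm (T : Type) (F : set_system T) {FF : Filter F}
    (f : T -> cplx R) (a b : R) :
  (fun x => complex.Re (f x)) @ F --> a -> (fun x => complex.Im (f x)) @ F --> b ->
  f @ F --> (Complex a b : cplx R).
Proof.
move=> /cvgrPdist_lt fa /cvgrPdist_lt fb; apply/cvg_cnormP => e e0.
have e2 : 0 < e / 2 by rewrite divr_gt0.
have := fa _ e2; have := fb _ e2; apply: filterS2 => x hb ha.
apply: le_lt_trans (cnorm_le_ReIm _) _.
by rewrite [ltRHS]splitr; case: (f x) ha hb => u v /= ha hb; rewrite distrC (distrC v) ltrD.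
Qed.

Lemma cnorm_lt_near (T : Type) (F : set_system T) {FF : Filter F}
    (f : T -> cplx R) (l : cplx R) (M : R) :
  f @ F --> l -> M < cnorm l -> \forall x \near F, M < cnorm (f x).
Proof. by move=> /cvg_cnorm fl Ml; apply: (cvgr_gt _ fl). Qed.

End Modulus.

Lemma le_epsilon (R : realType) (x y : R) :
  (forall e : R, 0 < e -> x <= y + e) -> x <= y.
Proof. by move=> h; apply/ler_addgt0Pr. Qed.

Lemma cnorm_small (R : realType) (z : cplx R) :
  (forall e : R, 0 < e -> cnorm z <= e) -> z = 0.
Proof.
move=> h; apply: cnorm_eq0; apply: le_anti; rewrite cnorm_ge0 andbT.
by apply: le_epsilon => e /h; rewrite add0r.
Qed.

(** Finite subsets as duplicate-free lists: they can be moved by translations and local sections and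
    summed over directly. *)
Definition fin_in (T : choiceType) (A : set T) (s : seq T) : Prop :=
  uniq s /\ forall x, x \in s -> A x.

Section FiniteLists.
Context {T : choiceType}.
Implicit Types (A : set T) (s : seq T).

Lemma fin_in_nil A : fin_in A [::].
Proof. by split. Qed.

Lemma fin_in_cat A s t : fin_in A s -> fin_in A t -> fin_in A (undup (s ++ t)).
Proof.
move=> [_ As] [_ At]; split; first exact: undup_uniq.
by move=> x; rewrite mem_undup mem_cat => /orP[/As|/At].
Qed.

(** The list [t] may have repetitions; passing to [undup t] only lowers a sum of nonnegative
    terms. *)
Lemma sum_sub_le (R : realType) s t (f : T -> R) :
  uniq s -> {subset s <= t} -> (forall x, 0 <= f x) ->
  \sum_(x <- s) f x <= \sum_(x <- t) f x.
Proof.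
move=> us st f0.
have -> : \sum_(x <- s) f x = \sum_(x <- undup t | x \in s) f x.
  rewrite -[RHS]big_filter; apply: perm_big; apply: uniq_perm => //.
    by rewrite filter_uniq// undup_uniq.
  by move=> x; rewrite mem_filter mem_undup; case xs : (x \in s) => //=; rewrite st.
apply: le_trans (_ : \sum_(x <- undup t) f x <= _).
  rewrite big_mkcond/=; apply: ler_sum => x _; case: ifP => // _; exact: f0.
elim: t {st} => //= x t ih; case: ifP => xt; rewrite !big_cons ?lerD2l//.
by apply: le_trans ih _; rewrite lerDr.
Qed.

Lemma sum_supp (V : nmodType) s t (f : T -> V) :
  uniq s -> uniq t -> {subset s <= t} ->
  (forall x, x \in t -> x \notin s -> f x = 0) ->
  \sum_(x <- t) f x = \sum_(x <- s) f x.
Proof.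
move=> us ut st f0; rewrite (bigID (mem s))/= [X in _ + X]big1_seq ?addr0.
  rewrite -big_filter; apply: perm_big; apply: uniq_perm; rewrite ?filter_uniq//.
  by move=> x; rewrite mem_filter; case xs : (x \in s) => //=; rewrite st.
by move=> x /andP[xs xt]; exact: f0.
Qed.

End FiniteLists.

Section CountingSums.
Context {R : realType} {T : choiceType}.
Implicit Types (A : set T) (f h : T -> cplx R) (s : seq T).

Definition bounded_sums A f (M : R) : Prop :=
  forall s, fin_in A s -> \sum_(x <- s) cnorm (f x) <= M.

Definition csummable A f : Prop := exists M, bounded_sums A f M.

Lemma esum_bounded A (u : T -> R) (M : R) :
  (forall s, fin_in A s -> \sum_(x <- s) u x <= M) ->
  (\esum_(x in A) (u x)%:E <= M%:E)%E.
Proof.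
move=> uM; apply: ge_ereal_sup => _ [X [finX XA] <-].
rewrite fsbig_finite// sumEFin lee_fin; apply: uM; split; first exact: fset_uniq.
by move=> x; rewrite in_fset_set// inE => /XA.
Qed.

Lemma esum_geq A (u : T -> R) s :
  fin_in A s -> ((\sum_(x <- s) u x)%:E <= \esum_(x in A) (u x)%:E)%E.
Proof.
move=> [us sA]; rewrite -sumEFin; apply: esum_ge; exists [set` s].
  by split; [exact: finite_seq|move=> x /= /sA].
by rewrite -fsbig_seq.
Qed.

(** The extended sum is finite, so some finite set comes within [e] of it; the sums over larger
    finite sets lie between that one and the supremum. *)
Lemma esum_approx A (u : T -> R) (M : R) : (forall x, 0 <= u x) ->
  (forall s, fin_in A s -> \sum_(x <- s) u x <= M) ->
  forall e : R, 0 < e -> exists2 s0, fin_in A s0 &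
    forall s, fin_in A s -> {subset s0 <= s} ->
      `|fine (\esum_(x in A) (u x)%:E)%E - \sum_(x <- s) u x| <= e.
Proof.
move=> u0 uM e e0; set P := (\esum_(x in A) (u x)%:E)%E.
have P0 : (0 <= P)%E by apply: esum_ge0 => x _; rewrite lee_fin.
have PM : (P <= M%:E)%E by exact: esum_bounded.
have fP : P \is a fin_num.
  by rewrite ge0_fin_numE//; apply: le_lt_trans PM _; rewrite ltry.
have [_ [X [finX XA] <-] hX] := ub_ereal_sup_adherent e0 fP.
exists (fset_set X).
  by split; [exact: fset_uniq|move=> x; rewrite in_fset_set// inE => /XA].
move=> s As Xs.
have := esum_geq u As; rewrite -/P -{1}(fineK fP) lee_fin => h1.
rewrite ger0_norm ?subr_ge0//.
move: hX; rewrite -[ereal_sup _]/P -(fineK fP).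
rewrite fsbig_finite// sumEFin -EFinB lte_fin => h2.
have := sum_sub_le (fset_uniq (fset_set X)) Xs u0 => h3.
lra.
Qed.

Let pos (u : T -> R) x := Num.max (u x) 0.
Let neg (u : T -> R) x := Num.max (- u x) 0.

Let rsumE A (u : T -> R) :
  rsum A u = fine (\esum_(x in A) (pos u x)%:E)%E - fine (\esum_(x in A) (neg u x)%:E)%E.
Proof.
by rewrite /rsum; congr (fine _ - fine _); apply: eq_esum => x _;
  rewrite ?funeposE ?funenegE /= EFin_max.
Qed.

Let rsum_approx A (u : T -> R) (M : R) :
  (forall s, fin_in A s -> \sum_(x <- s) `|u x| <= M) ->
  forall e : R, 0 < e -> exists2 s0, fin_in A s0 &
    forall s, fin_in A s -> {subset s0 <= s} ->
      `|rsum A u - \sum_(x <- s) u x| <= e.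
Proof.
move=> uM e e0; have e2 : 0 < e / 2 by rewrite divr_gt0.
have p0 x : 0 <= pos u x by rewrite le_max lexx orbT.
have n0 x : 0 <= neg u x by rewrite le_max lexx orbT.
have [||s1 As1 h1] := @esum_approx A (pos u) M _ _ _ e2 => //.
  move=> s As; apply: le_trans (uM s As); apply: ler_sum => x _.
  by rewrite ge_max normr_ge0 ler_norm.
have [||s2 As2 h2] := @esum_approx A (neg u) M _ _ _ e2 => //.
  move=> s As; apply: le_trans (uM s As); apply: ler_sum => x _.
  by rewrite ge_max normr_ge0 -normrN ler_norm.
exists (undup (s1 ++ s2)); first exact: fin_in_cat.
move=> s As sub.
have /(h1 s As) {}h1 : {subset s1 <= s}.
  by move=> x xs; apply: sub; rewrite mem_undup mem_cat xs.
have /(h2 s As) {}h2 : {subset s2 <= s}.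
  by move=> x xs; apply: sub; rewrite mem_undup mem_cat xs orbT.
have -> : \sum_(x <- s) u x = \sum_(x <- s) pos u x - \sum_(x <- s) neg u x.
  rewrite -sumrB; apply: eq_bigr => x _; rewrite /pos /neg.
  by case: (leP 0 (u x)) => ux; rewrite ?(max_l ux) ?(max_r (ltW ux));
    [rewrite max_r ?subr0// oppr_le0|rewrite max_l ?sub0r ?opprK// oppr_ge0 ltW].
rewrite rsumE opprD addrACA [leRHS]splitr -opprD.
by apply: le_trans (ler_normB _ _) (lerD _ _).
Qed.

(* Every property of [csum] on summable functions is read off finite partial
   sums through this approximation. *)
Lemma csum_approx A f : csummable A f ->
  forall e : R, 0 < e -> exists2 s0, fin_in A s0 &
    forall s, fin_in A s -> {subset s0 <= s} ->
      cnorm (csum A f - \sum_(x <- s) f x) <= e.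
Proof.
move=> [M fM] e e0; have e2 : 0 < e / 2 by rewrite divr_gt0.
have [|s1 As1 h1] := @rsum_approx A (fun x => complex.Re (f x)) M _ _ e2.
  move=> s As; apply: le_trans (fM s As); apply: ler_sum => x _; exact: Re_le_cnorm.
have [|s2 As2 h2] := @rsum_approx A (fun x => complex.Im (f x)) M _ _ e2.
  move=> s As; apply: le_trans (fM s As); apply: ler_sum => x _; exact: Im_le_cnorm.
exists (undup (s1 ++ s2)); first exact: fin_in_cat.
move=> s As sub.
have /(h1 s As) {}h1 : {subset s1 <= s}.
  by move=> x xs; apply: sub; rewrite mem_undup mem_cat xs.
have /(h2 s As) {}h2 : {subset s2 <= s}.
  by move=> x xs; apply: sub; rewrite mem_undup mem_cat xs orbT.
apply: le_trans (cnorm_le_ReIm _) _.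
rewrite [leRHS]splitr; apply: lerD.
  by move: h1; rewrite -(ReIm_sum _ _).1 /csum; case: (\sum_(x <- s) f x).
by move: h2; rewrite -(ReIm_sum _ _).2 /csum; case: (\sum_(x <- s) f x).
Qed.

Lemma csum_eq A f h : (forall x, A x -> f x = h x) -> csum A f = csum A h.
Proof.
move=> fh; rewrite /csum /rsum; congr (Complex (fine _ - fine _) (fine _ - fine _));
by apply: eq_esum => x Ax; rewrite ?funeposE ?funenegE /= fh.
Qed.

Lemma csum_bound A f M : bounded_sums A f M -> cnorm (csum A f) <= M.
Proof.
move=> fM; apply: le_epsilon => e e0.
have [|s As h] := @csum_approx A f _ e e0; first by exists M.
have := h s As (fun x => id) => hs.
apply: le_trans (_ : cnorm (\sum_(x <- s) f x) + e <= _).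
  have := cnorm_triangle (csum A f - \sum_(x <- s) f x) (\sum_(x <- s) f x).
  by rewrite subrK addrC => /le_trans; apply; rewrite lerD2l.
by rewrite lerD2r; apply: le_trans (cnorm_sum _ _) (fM _ As).
Qed.

Lemma csummableD A f h : csummable A f -> csummable A h ->
  csummable A (fun x => f x + h x).
Proof.
move=> [M fM] [N hN]; exists (M + N) => s As.
apply: le_trans (lerD (fM s As) (hN s As)); rewrite -big_split/=.
by apply: ler_sum => x _; exact: cnorm_triangle.
Qed.

Lemma csummableZ A c f : csummable A f -> csummable A (fun x => c * f x).
Proof.
move=> [M fM]; exists (cnorm c * M) => s As.
under eq_bigr do rewrite cnormM.
by rewrite -mulr_sumr ler_wpM2l ?cnorm_ge0// fM.
Qed.

Lemma csumD A f h : csummable A f -> csummable A h ->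
  csum A (fun x => f x + h x) = csum A f + csum A h.
Proof.
move=> sf sh; apply/eqP; rewrite -subr_eq0; apply/eqP/cnorm_small => e e0.
have e3 : 0 < e / 3 by rewrite divr_gt0.
have [s1 A1 h1] := csum_approx sf e3; have [s2 A2 h2] := csum_approx sh e3.
have [s3 A3 h3] := csum_approx (csummableD sf sh) e3.
(* One list serves the three approximations, and on it the identity is that of finite sums. *)
set s := undup (s1 ++ undup (s2 ++ s3)).
have As : fin_in A s by do 2 apply: fin_in_cat => //.
have {}h1 := h1 s As _; have {}h2 := h2 s As _; have {}h3 := h3 s As _.
have {}h1 : cnorm (csum A f - \sum_(x <- s) f x) <= e / 3.
  by apply: h1 => x xs; rewrite mem_undup mem_cat xs.
have {}h2 : cnorm (csum A h - \sum_(x <- s) h x) <= e / 3.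
  by apply: h2 => x xs; rewrite mem_undup mem_cat mem_undup mem_cat xs /= orbT.
have {}h3 : cnorm (csum A (fun x => f x + h x) - \sum_(x <- s) (f x + h x)) <= e / 3.
  by apply: h3 => x xs; rewrite mem_undup mem_cat mem_undup mem_cat xs !orbT.
rewrite big_split/= in h3.
move: (csum A _) (csum A f) (csum A h) (\sum_(x <- s) f x) (\sum_(x <- s) h x) h1 h2 h3.
move=> a b c u v h1 h2 h3.
have -> : a - (b + c) = (a - (u + v)) + ((u - b) + (v - c)) by ring.
apply: le_trans (cnorm_triangle _ _) _.
have := cnorm_triangle (u - b) (v - c); rewrite (cnorm_dist u) (cnorm_dist v).
lra.
Qed.

Lemma csumZ A c f : csummable A f -> csum A (fun x => c * f x) = c * csum A f.
Proof.
move=> sf; apply/eqP; rewrite -subr_eq0; apply/eqP/cnorm_small => e e0.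
have e2 : 0 < e / 2 by rewrite divr_gt0.
have e3 : 0 < e / 2 / (cnorm c + 1) by rewrite divr_gt0// ltr_wpDl ?cnorm_ge0.
have [s1 A1 h1] := csum_approx sf e3.
have [s2 A2 h2] := csum_approx (csummableZ c sf) e2.
set s := undup (s1 ++ s2); have As : fin_in A s by exact: fin_in_cat.
have {}h1 : cnorm (csum A f - \sum_(x <- s) f x) <= e / 2 / (cnorm c + 1).
  by apply: h1 => // x xs; rewrite mem_undup mem_cat xs.
have {}h2 : cnorm (csum A (fun x => c * f x) - \sum_(x <- s) (c * f x)) <= e / 2.
  by apply: h2 => // x xs; rewrite mem_undup mem_cat xs orbT.
rewrite -mulr_sumr in h2.
apply: le_trans (cnorm_sub_triangle (c * \sum_(x <- s) f x) _ _) _.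
rewrite [leRHS]splitr lerD// -mulrBr cnormM cnorm_dist.
apply: le_trans (_ : (cnorm c + 1) * (e / 2 / (cnorm c + 1)) <= _).
  by apply: ler_pM => //; rewrite ?cnorm_ge0// lerDl.
by rewrite mulrC divfK// gt_eqF// ltr_wpDl ?cnorm_ge0.
Qed.

Lemma csum_conj A f : csummable A f ->
  csum A (fun x => Num.conj (f x)) = Num.conj (csum A f).
Proof.
move=> sf; have sf' : csummable A (fun x => Num.conj (f x)).
  by case: sf => M fM; exists M => s /fM; under eq_bigr do rewrite -cnorm_conj.
apply/eqP; rewrite -subr_eq0; apply/eqP/cnorm_small => e e0.
have e2 : 0 < e / 2 by rewrite divr_gt0.
have [s1 A1 h1] := csum_approx sf e2; have [s2 A2 h2] := csum_approx sf' e2.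
set s := undup (s1 ++ s2); have As : fin_in A s by exact: fin_in_cat.
have {}h1 : cnorm (csum A f - \sum_(x <- s) f x) <= e / 2.
  by apply: h1 => // x xs; rewrite mem_undup mem_cat xs.
have {}h2 : cnorm (csum A (fun x => Num.conj (f x)) - \sum_(x <- s) Num.conj (f x)) <= e / 2.
  by apply: h2 => // x xs; rewrite mem_undup mem_cat xs orbT.
rewrite -rmorph_sum/= in h2.
apply: le_trans (cnorm_sub_triangle (Num.conj (\sum_(x <- s) f x)) _ _) _.
by rewrite [leRHS]splitr lerD// -rmorphB cnorm_conj cnorm_dist.
Qed.

Lemma fin_supp_bound A f s : uniq s ->
  (forall x, A x -> x \notin s -> f x = 0) ->
  bounded_sums A f (\sum_(x <- s) cnorm (f x)).
Proof.
move=> us f0 t At; rewrite (bigID (mem s))/= [X in _ + X]big1_seq ?addr0.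
  rewrite -big_filter; apply: sum_sub_le.
  - by rewrite filter_uniq//; case: At.
  - by move=> x; rewrite mem_filter => /andP[].
  - by move=> x; exact: cnorm_ge0.
by move=> x /andP[xs xt]; rewrite f0 ?cnorm0//; exact: At.2.
Qed.

(** Adding points to [s] does not change the partial sum, so the approximations are constant from
    [s] on. *)
Lemma csum_fin A f s : fin_in A s ->
  (forall x, A x -> x \notin s -> f x = 0) ->
  csum A f = \sum_(x <- s) f x.
Proof.
move=> As f0; have sf : csummable A f.
  by exists (\sum_(x <- s) cnorm (f x)); apply: fin_supp_bound => //; case: As.
apply/eqP; rewrite -subr_eq0; apply/eqP/cnorm_small => e e0.
have [s1 A1 h1] := csum_approx sf e0.
have := h1 (undup (s ++ s1)) (fin_in_cat As A1) _.
rewrite (@sum_supp _ _ s); rewrite ?undup_uniq//; last first.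
- by move=> x; rewrite mem_undup mem_cat => /orP[-> //|/A1.2 Ax]; exact: f0.
- by move=> x xs; rewrite mem_undup mem_cat xs.
- by case: As.
by apply => x xs; rewrite mem_undup mem_cat xs orbT.
Qed.

Lemma csum0 A : csum A (fun=> 0 : cplx R) = 0.
Proof. by rewrite (csum_fin (fin_in_nil A)) ?big_nil. Qed.

Lemma csum_nonneg A (u : T -> R) : (forall x, 0 <= u x) ->
  csum A (fun x => Complex (u x) 0) =
  Complex (fine (\esum_(x in A) (u x)%:E)%E) 0.
Proof.
move=> u0; rewrite /csum /= !rsumE; congr Complex.
  rewrite [X in _ - fine X]esum1 ?subr0; last first.
    by move=> x _; rewrite /neg max_r// oppr_le0.
  by congr fine; apply: eq_esum => x _; rewrite /pos max_l.
by rewrite !esum1 ?subrr// => x _; rewrite /pos /neg ?oppr0 maxxx.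
Qed.

End CountingSums.

Lemma csum_reindex (R : realType) (T T' : choiceType) (P : set T) (Q : set T')
    (e : T -> T') (f : T' -> cplx R) : set_bij P Q e ->
  csum Q f = csum P (f \o e).
Proof.
move=> PQ; rewrite /csum /rsum; congr (Complex (fine _ - fine _) (fine _ - fine _));
by rewrite (reindex_esum _ _ _ _ PQ)//; apply: eq_esum => x _; rewrite ?funeposE ?funenegE.
Qed.

(** * Square-summable functions: Minkowski and Cauchy-Schwarz *)

Section SquareSums.
Context {R : realType} {T : choiceType}.
Implicit Types (A : set T) (xi eta : T -> cplx R) (r t : R).

(** A bound on the l2 norm, tested on finite sums so that it passes to pointwise limits. *)
Definition l2le A xi r : Prop :=
  forall s, fin_in A s -> \sum_(x <- s) cnorm (xi x) ^+ 2 <= r ^+ 2.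

Lemma l2leP A xi r :
  (\esum_(g in A) (cnorm (xi g) ^+ 2)%:E <= (r ^+ 2)%:E)%E <-> l2le A xi r.
Proof.
split=> [h s As|h]; last exact: esum_bounded.
by rewrite -lee_fin; apply: le_trans h; exact: esum_geq.
Qed.

Lemma l2le_point A xi r x : 0 <= r -> l2le A xi r -> A x -> cnorm (xi x) <= r.
Proof.
move=> r0 h Ax; have := h [:: x]; rewrite big_seq1 => hx.
rewrite -ler_sqr ?nnegrE ?cnorm_ge0//; apply: hx; split=> // y.
by rewrite inE => /eqP ->.
Qed.

Lemma l2le_eq A xi eta r : (forall x, A x -> xi x = eta x) ->
  l2le A xi r -> l2le A eta r.
Proof.
move=> e h s As; apply: le_trans (h s As); rewrite le_eqVlt; apply/orP; left.
by apply/eqP/eq_big_seq => x /As.2 /e ->.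
Qed.

Lemma l2leW A xi r t : 0 <= r -> r <= t -> l2le A xi r -> l2le A xi t.
Proof.
move=> r0 rt h s /h /le_trans; apply; rewrite ler_sqr ?nnegrE//.
exact: le_trans rt.
Qed.

Lemma l2le0 A r : l2le A (fun=> 0) r.
Proof. by move=> s _; rewrite cnorm0 expr0n/= big1// sqr_ge0. Qed.

Lemma l2leZ A xi r c : l2le A xi r -> l2le A (fun x => c * xi x) (cnorm c * r).
Proof.
move=> h s /h hs; under eq_bigr do rewrite cnormM exprMn.
by rewrite -mulr_sumr exprMn ler_wpM2l// sqr_ge0.
Qed.

(** Minkowski's inequality, from (a + b)^2 <= (1 + t/r) a^2 + (1 + r/t) b^2. The weights are such
    that the bounds r^2 and t^2 combine to (r + t)^2. If [r] or [t] is zero, the corresponding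
    function vanishes on [A]. *)
Lemma l2leD A xi eta r t : 0 <= r -> 0 <= t ->
  l2le A xi r -> l2le A eta t -> l2le A (fun x => xi x + eta x) (r + t).
Proof.
move=> r0 t0 hr ht.
have [r1|rn] := eqVneq r 0.
  rewrite r1 add0r; apply: l2le_eq ht => x Ax.
  have := l2le_point r0 hr Ax; rewrite r1 => h.
  by rewrite (@cnorm_eq0 _ (xi x)) ?add0r//; apply: le_anti; rewrite h cnorm_ge0.
have [t1|tn] := eqVneq t 0.
  rewrite t1 addr0; apply: l2le_eq hr => x Ax.
  have := l2le_point t0 ht Ax; rewrite t1 => h.
  by rewrite (@cnorm_eq0 _ (eta x)) ?addr0//; apply: le_anti; rewrite h cnorm_ge0.
have rp : 0 < r by rewrite lt_neqAle eq_sym rn.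
have tp : 0 < t by rewrite lt_neqAle eq_sym tn.
move=> s As; have := hr s As; have := ht s As.
set X := \sum_(x <- s) _ ^+ 2; set Y := \sum_(x <- s) _ ^+ 2 => hX hY.
apply: le_trans (_ : (1 + t / r) * Y + (1 + r / t) * X <= _).
  rewrite !mulr_sumr -big_split/=; apply: ler_sum => x _.
  apply: le_trans (_ : (cnorm (xi x) + cnorm (eta x)) ^+ 2 <= _).
    by rewrite ler_sqr ?nnegrE ?addr_ge0 ?cnorm_ge0// cnorm_triangle.
  move: (cnorm (xi x)) (cnorm (eta x)) => a b.
  have : 0 <= (t * a - r * b) ^+ 2 / (r * t).
    by rewrite divr_ge0 ?sqr_ge0// mulr_ge0.
  suff -> : (t * a - r * b) ^+ 2 / (r * t) =
    ((1 + t / r) * a ^+ 2 + (1 + r / t) * b ^+ 2) - (a + b) ^+ 2 by rewrite subr_ge0; apply.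
  by field; apply/andP; split.
apply: le_trans (_ : (1 + t / r) * r ^+ 2 + (1 + r / t) * t ^+ 2 <= _).
  by apply: lerD; apply: ler_wpM2l => //; rewrite addr_ge0// divr_ge0.
suff -> : (r + t) ^+ 2 = (1 + t / r) * r ^+ 2 + (1 + r / t) * t ^+ 2 by [].
by field; apply/andP; split.
Qed.

(** Cauchy-Schwarz for given bounds, from a b <= (t/r) a^2 / 2 + (r/t) b^2 / 2, whose right side
    sums to at most r t. *)
Lemma l2le_prod A xi eta r t : 0 <= r -> 0 <= t -> l2le A xi r -> l2le A eta t ->
  bounded_sums A (fun x => Num.conj (xi x) * eta x) (r * t).
Proof.
move=> r0 t0 hr ht s As.
under eq_bigr do rewrite cnormM cnorm_conj.
have [r1|rn] := eqVneq r 0.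
  rewrite big1_seq ?mulr_ge0// => x /andP[_ /As.2 Ax].
  have := l2le_point r0 hr Ax; rewrite r1 => h.
  by rewrite (@cnorm_eq0 _ (xi x)) ?cnorm0 ?mul0r//; apply: le_anti; rewrite h cnorm_ge0.
have [t1|tn] := eqVneq t 0.
  rewrite big1_seq ?mulr_ge0// => x /andP[_ /As.2 Ax].
  have := l2le_point t0 ht Ax; rewrite t1 => h.
  by rewrite (@cnorm_eq0 _ (eta x)) ?cnorm0 ?mulr0//; apply: le_anti; rewrite h cnorm_ge0.
have rp : 0 < r by rewrite lt_neqAle eq_sym rn.
have tp : 0 < t by rewrite lt_neqAle eq_sym tn.
have := hr s As; have := ht s As.
set X := \sum_(x <- s) _ ^+ 2; set Y := \sum_(x <- s) _ ^+ 2 => hX hY.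
apply: le_trans (_ : t / r / 2 * Y + r / t / 2 * X <= _).
  rewrite !mulr_sumr -big_split/=; apply: ler_sum => x _.
  move: (cnorm (xi x)) (cnorm (eta x)) => a b.
  have : 0 <= (t * a - r * b) ^+ 2 / (r * t) / 2.
    by rewrite divr_ge0// divr_ge0 ?sqr_ge0// mulr_ge0.
  suff -> : (t * a - r * b) ^+ 2 / (r * t) / 2 =
    (t / r / 2 * a ^+ 2 + r / t / 2 * b ^+ 2) - a * b by rewrite subr_ge0; apply.
  by field; apply/andP; split.
apply: le_trans (_ : t / r / 2 * r ^+ 2 + r / t / 2 * t ^+ 2 <= _).
  by apply: lerD; apply: ler_wpM2l => //; rewrite !divr_ge0.
suff -> : r * t = t / r / 2 * r ^+ 2 + r / t / 2 * t ^+ 2 by [].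
by field; apply/andP; split.
Qed.

End SquareSums.

Lemma l2le_reindex (R : realType) (T T' : choiceType) (P : set T) (Q : set T')
    (e : T -> T') (f : T' -> cplx R) (r : R) : set_bij P Q e ->
  l2le Q f r <-> l2le P (f \o e) r.
Proof.
by move=> PQ; rewrite -!l2leP (reindex_esum _ _ _ _ PQ).
Qed.

(** * Hilbert modules and adjointable operators *)

Lemma cplx_complete (R : realType) (u : nat -> cplx R) :
  (forall e : R, 0 < e -> exists N, forall n m, (N <= n)%N -> (N <= m)%N ->
     cnorm (u n - u m) <= e) ->
  exists l : cplx R, u @ \oo --> l.
Proof.
move=> cu.
have cv (v : nat -> R) : (forall n m, `|v n - v m| <= cnorm (u n - u m)) ->
    cvg (v @ \oo).
  move=> vu; apply: cauchy_cvg; apply: cauchy_exP => e e0.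
  have e2 : 0 < e / 2 by rewrite divr_gt0.
  have [N hN] := cu _ e2; exists (v N), N => // n /= Nn.
  rewrite /ball /=; apply: le_lt_trans (vu N n) _.
  apply: le_lt_trans (hN N n _ Nn) _ => //.
  by rewrite [ltRHS]splitr ltrDl.
have c1 : cvg ((fun n => complex.Re (u n)) @ \oo).
  apply: cv => n m; have := Re_le_cnorm (u n - u m).
  by case: (u n) => a b; case: (u m).
have c2 : cvg ((fun n => complex.Im (u n)) @ \oo).
  apply: cv => n m; have := Im_le_cnorm (u n - u m).
  by case: (u n) => a b; case: (u m).
by exists (Complex (lim ((fun n => complex.Re (u n)) @ \oo))
  (lim ((fun n => complex.Im (u n)) @ \oo))); exact: cvg_ReIm.
Qed.

(** An error linear in [e] is enough, and [e <= 1] allows higher powers of [e] to be absorbed into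
    [K]. *)
Lemma cnorm_small1 (R : realType) (z : cplx R) (K : R) :
  (forall e : R, 0 < e -> e <= 1 -> cnorm z <= K * e) -> z = 0.
Proof.
move=> h; apply: cnorm_small => e e0.
have K0 : 0 < `|K| + 1 by rewrite ltr_wpDl.
set d := Num.min 1 (e / (`|K| + 1)).
have d0 : 0 < d by rewrite lt_min ltr01 divr_gt0.
apply: le_trans (h d d0 _) _; first by rewrite ge_min lexx.
apply: le_trans (_ : (`|K| + 1) * d <= _).
  by rewrite ler_pM2r// (le_trans (ler_norm K))// lerDl.
rewrite -[leRHS](divfK (lt0r_neq0 K0)) mulrC ler_pM2r//.
by rewrite ge_min lexx orbT.
Qed.

(** A Fatou property: only finite sums are tested, and these are continuous for pointwise
    convergence. *)
Lemma l2le_lim (R : realType) (T : choiceType) (A : set T) (I : Type)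
    (F : set_system I) {FF : ProperFilter F} (u : I -> T -> cplx R)
    (l : T -> cplx R) (r : R) :
  (forall x, A x -> u^~ x @ F --> l x) -> (\forall i \near F, l2le A (u i) r) ->
  l2le A l r.
Proof.
move=> ul ur s As.
have cs : (fun i => \sum_(x <- s) cnorm (u i x) ^+ 2) @ F -->
    \sum_(x <- s) cnorm (l x) ^+ 2.
  elim: s As => [|x s ih] [us As].
    by under eq_fun do rewrite big_nil; rewrite big_nil; exact: cvg_cst.
  under eq_fun do rewrite big_cons.
  rewrite big_cons; apply: cvgD; last first.
    apply: ih; split; first by case/andP: us.
    by move=> y ys; apply: As; rewrite inE ys orbT.
  by rewrite expr2; apply: cvgM; apply: cvg_cnorm; apply: ul;
    apply: As; rewrite inE eqxx.
rewrite leNgt; apply/negP => lt.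
have [i [/= /(_ s As) ri lti]] := filter_ex (filterI ur (cvgr_gt _ cs _ lt)).
by move: lti; rewrite ltNge ri.
Qed.

Section HilbertModule.
Context {R : realType} {H : groupoid_data}.
Local Notation C := (cplx R).
Implicit Types (xi eta zeta : H -> C) (A B : op R H) (r s t M : R).

(** The real-valued counterpart of [hnorm xi <= r], see [hnormP]. *)
Definition hbd xi r : Prop := 0 <= r /\ forall x, l2le (@fibre H x) xi r.

Lemma hnormP xi r : 0 <= r -> (hnorm xi <= r%:E)%E <-> hbd xi r.
Proof.
move=> r0; have -> : r%:E = sqrte ((r ^+ 2)%:E) :> \bar R.
  by rewrite /= sqrtr_sqr ger0_norm.
rewrite /hnorm lee_sqrt ?lee_fin ?sqr_ge0//; split => [h|[_ h]].
  by split=> // x; apply/l2leP; apply: le_trans h; apply: ereal_sup_ubound; exists x.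
by apply: ge_ereal_sup => _ [x _ <-]; apply/l2leP.
Qed.

Lemma hbd_eq xi eta r : (forall g, xi g = eta g) -> hbd xi r -> hbd eta r.
Proof. by move=> e [r0 h]; split=> // x; apply: l2le_eq (h x) => g _. Qed.

Lemma hbdW xi r s : r <= s -> hbd xi r -> hbd xi s.
Proof.
move=> rs [r0 h]; split; first exact: le_trans rs.
by move=> x; apply: l2leW (h x).
Qed.

Lemma hbd_point xi r g : hbd xi r -> cnorm (xi g) <= r.
Proof. by move=> [r0 /(_ (grng g)) h]; exact: (l2le_point r0 h). Qed.

Lemma hbd0 r : 0 <= r -> hbd 0 r.
Proof. by move=> r0; split=> // x; exact: l2le0. Qed.

Lemma hbdD xi eta r s : hbd xi r -> hbd eta s -> hbd (xi + eta) (r + s).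
Proof.
by move=> [r0 h] [s0 k]; split; [exact: addr_ge0|move=> x; exact: l2leD].
Qed.

Lemma hbdZ c xi r : hbd xi r -> hbd (fun g => c * xi g) (cnorm c * r).
Proof.
by move=> [r0 h]; split; [rewrite mulr_ge0 ?cnorm_ge0|move=> x; exact: l2leZ].
Qed.

Lemma hbdN xi r : hbd xi r -> hbd (- xi) r.
Proof.
move=> /(hbdZ (-1)); rewrite cnormN cnorm1 mul1r; apply: hbd_eq => g.
by rewrite mulN1r.
Qed.

Lemma hbdB xi eta r s : hbd xi r -> hbd eta s -> hbd (xi - eta) (r + s).
Proof. by move=> h k; apply: hbdD => //; exact: hbdN. Qed.

Lemma hbd_subC xi eta r : hbd (xi - eta) r -> hbd (eta - xi) r.
Proof. by move=> /hbdN; rewrite opprB. Qed.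

Lemma hbd_zero xi : hbd xi 0 -> xi = 0.
Proof.
move=> h; apply/funext => g; apply: cnorm_eq0; apply: le_anti.
by rewrite (hbd_point _ h) cnorm_ge0.
Qed.

Lemma Cc_add (T : topologicalType) (f h : T -> C) : Cc f -> Cc h -> Cc (f + h).
Proof.
move=> [cf sf] [ch sh]; split.
  by move=> x; apply: continuousD; [exact: cf|exact: ch].
apply: (subclosed_compact (@closed_closure _ _) (compactU sf sh)).
rewrite -closureU; apply: closureS => x /=; rewrite -[_ x]/(f x + h x) => fhx.
have [f0|?] := eqVneq (f x) 0; last by left.
by right; move: fhx; rewrite f0 add0r.
Qed.

Lemma Cc_scale (T : topologicalType) (c : C) (f : T -> C) :
  Cc f -> Cc (fun x => c * f x).
Proof.
move=> [cf sf]; split.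
  by move=> x; apply: continuousM; [exact: cst_continuous|exact: cf].
apply: (subclosed_compact (@closed_closure _ _) sf).
by apply: supp_sub => x ->; rewrite mulr0.
Qed.

Lemma Cc_zero (T : topologicalType) : Cc (0 : T -> C).
Proof.
split; first exact: cst_continuous.
have -> : supp (0 : T -> C) = set0; last exact: compact0.
rewrite /supp; have -> : [set x | (0 : T -> C) x != 0] = set0.
  by apply/seteqP; split => x //=; rewrite eqxx.
by rewrite closure0.
Qed.

Lemma hmodP xi :
  hmod xi <-> forall e : R, 0 < e -> exists2 eta, Cc eta & hbd (xi - eta) e.
Proof.
by split=> h e e0; have [eta Ce he] := h e e0; exists eta => //;
  apply/hnormP => //; exact: ltW.
Qed.

Lemma Cc_hmod xi : Cc xi -> hmod xi.
Proof.
move=> Cx; apply/hmodP => e e0; exists xi => //.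
by rewrite subrr; apply: hbd0; exact: ltW.
Qed.

Lemma hmod0 : hmod (0 : H -> C).
Proof. exact/Cc_hmod/Cc_zero. Qed.

Lemma hmodD xi eta : hmod xi -> hmod eta -> hmod (xi + eta).
Proof.
move=> /hmodP hx /hmodP he; apply/hmodP => e e0.
have e2 : 0 < e / 2 by rewrite divr_gt0.
have [a Ca ha] := hx _ e2; have [b Cb hb] := he _ e2.
exists (a + b); first exact: Cc_add.
by rewrite opprD addrACA [e]splitr; exact: hbdD.
Qed.

Lemma hmodZ c xi : hmod xi -> hmod (fun g => c * xi g).
Proof.
move=> /hmodP hx; apply/hmodP => e e0.
have c0 : 0 < cnorm c + 1 by rewrite ltr_wpDl ?cnorm_ge0.
have [a Ca ha] := hx _ (divr_gt0 e0 c0).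
exists (fun g => c * a g); first exact: Cc_scale.
have := hbdZ c ha => /hbdW h.
apply: (@hbd_eq (fun g => c * (xi - a) g)) => [g|].
  by rewrite -[(xi - a) g]/(xi g - a g) mulrBr.
apply: h; rewrite -[leRHS](divfK (lt0r_neq0 c0)) mulrC ler_wpM2l ?lerDl//.
by rewrite divr_ge0 ?ltW.
Qed.

Lemma hmodN xi : hmod xi -> hmod (- xi).
Proof.
move=> /(hmodZ (-1)); congr hmod; apply/funext => g; exact: mulN1r.
Qed.

Lemma hmodB xi eta : hmod xi -> hmod eta -> hmod (xi - eta).
Proof. by move=> h k; apply: hmodD => //; exact: hmodN. Qed.

Lemma hmod_closed xi :
  (forall e : R, 0 < e -> exists2 eta, hmod eta & hbd (xi - eta) e) -> hmod xi.
Proof.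
move=> h; apply/hmodP => e e0; have e2 : 0 < e / 2 by rewrite divr_gt0.
have [a /hmodP ha xa] := h _ e2; have [b Cb ab] := ha _ e2.
exists b => //; rewrite [e]splitr.
have -> : xi - b = (xi - a) + (a - b) by rewrite addrA subrK.
exact: hbdD.
Qed.

Definition oplin A : Prop :=
  (forall xi eta, hmod xi -> hmod eta -> A (xi + eta) = A xi + A eta) /\
  (forall c xi, hmod xi -> A (fun g => c * xi g) = fun g => c * A xi g).

(** Quantifying over all bounds [r], instead of the unit ball, makes composition and transport
    immediate; [opnormP] relates this to [opnorm]. *)
Definition opbd A M : Prop :=
  0 <= M /\ forall xi r, hmod xi -> hbd xi r -> hbd (A xi) (M * r).

Definition bounded_op A : Prop := [/\ is_op A, oplin A & exists M, opbd A M].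

Lemma opD_E A B xi : (A + B) xi = A xi + B xi. Proof. by []. Qed.

Lemma opB_E A B xi : (A - B) xi = A xi - B xi. Proof. by []. Qed.

Lemma oplin0 A : oplin A -> A 0 = 0.
Proof.
move=> [_ /(_ 0 0 hmod0) h].
have e : (fun g : H => 0 * (0 : H -> C) g) = 0 by apply/funext => g; rewrite mul0r.
by rewrite e in h; rewrite h; apply/funext => g; rewrite mul0r.
Qed.

Lemma oplinB A xi eta : oplin A -> hmod xi -> hmod eta ->
  A (xi - eta) = A xi - A eta.
Proof.
move=> [lD lZ] hx he; rewrite lD//; last exact: hmodN.
congr (_ + _); have := lZ (-1) eta he.
have -> : (fun g => -1 * eta g) = - eta by apply/funext => g; exact: mulN1r.
by move=> ->; apply/funext => g; exact: mulN1r.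
Qed.

Lemma oplin_add A B : oplin A -> oplin B -> oplin (A + B).
Proof.
move=> [aD aZ] [bD bZ]; split=> [xi eta hx he|c xi hx]; rewrite !opD_E.
  by rewrite aD// bD// addrACA.
by rewrite aZ// bZ//; apply/funext => g; rewrite -[RHS]/(_ * (_ + _)) mulrDr.
Qed.

Lemma oplin_scale c A : oplin A -> oplin (scale_op c A).
Proof.
move=> [aD aZ]; split=> [xi eta hx he|d xi hx]; apply/funext => g; rewrite /scale_op.
  by rewrite aD// -[(_ + _) g]/(_ + _) mulrDr.
by rewrite aZ// mulrCA.
Qed.

Lemma scale_opN1 A : scale_op (-1) A = - A.
Proof. by apply/funext => xi; apply/funext => g; exact: mulN1r. Qed.

Lemma oplin_sub A B : oplin A -> oplin B -> oplin (A - B).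
Proof.
by move=> lA lB; apply: oplin_add => //; rewrite -scale_opN1; exact: oplin_scale.
Qed.

Lemma is_op_add A B : is_op A -> is_op B -> is_op (A + B).
Proof.
move=> [a1 a2] [b1 b2]; split=> xi hx; rewrite opD_E.
  by apply: hmodD; [exact: a1|exact: b1].
by rewrite a2// b2// addr0.
Qed.

Lemma is_op_scale c A : is_op A -> is_op (scale_op c A).
Proof.
move=> [a1 a2]; split=> xi hx; first by apply: hmodZ; exact: a1.
by apply/funext => g; rewrite /scale_op a2// mulr0.
Qed.

Lemma is_op_sub A B : is_op A -> is_op B -> is_op (A - B).
Proof.
by move=> lA lB; apply: is_op_add => //; rewrite -scale_opN1; exact: is_op_scale.
Qed.

Lemma is_op_comp A B : is_op A -> oplin A -> is_op B -> is_op (A \o B).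
Proof.
move=> [a1 a2] lA [b1 b2]; split=> xi hx /=; first by apply: a1; exact: b1.
by rewrite b2//; exact: oplin0.
Qed.

Lemma opbdW A M N : M <= N -> opbd A M -> opbd A N.
Proof.
move=> MN [M0 h]; split; first exact: le_trans MN.
move=> xi r hx hr; apply: hbdW (h _ _ hx hr).
by rewrite ler_wpM2r//; case: hr.
Qed.

Lemma opbd_add A B M N : opbd A M -> opbd B N -> opbd (A + B) (M + N).
Proof.
move=> [M0 hA] [N0 hB]; split; first exact: addr_ge0.
by move=> xi r hx hr; rewrite mulrDl; apply: hbdD; [exact: hA|exact: hB].
Qed.

Lemma opbd_scale c A M : opbd A M -> opbd (scale_op c A) (cnorm c * M).
Proof.
move=> [M0 hA]; split; first by rewrite mulr_ge0 ?cnorm_ge0.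
by move=> xi r hx hr; rewrite -mulrA; apply: hbdZ; exact: hA.
Qed.

Lemma opbd_opp A M : opbd A M -> opbd (- A) M.
Proof. by move=> /(opbd_scale (-1)); rewrite scale_opN1 cnormN cnorm1 mul1r. Qed.

Lemma opbd_sub A B M N : opbd A M -> opbd B N -> opbd (A - B) (M + N).
Proof. by move=> h k; apply: opbd_add => //; exact: opbd_opp. Qed.

Lemma opbd_subC A B M : opbd (A - B) M -> opbd (B - A) M.
Proof. by move=> /opbd_opp; rewrite opprB. Qed.

Lemma opbd_triangle A B D M N : opbd (A - B) M -> opbd (B - D) N ->
  opbd (A - D) (M + N).
Proof.
by move=> h k; have := opbd_add h k; rewrite addrA subrK.
Qed.

(** The one property of the groupoid on which the rest of the section depends. It is established for
    [G] and for the semidirect product by counting the points of a compact set in each fibre. *)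
Context (Cc_bounded : forall xi : H -> C, Cc xi -> exists r, hbd xi r).

Lemma hmod_hbd xi : hmod xi -> exists r, hbd xi r.
Proof.
move=> /hmodP /(_ 1 ltr01)[eta Ce h]; have [r hr] := Cc_bounded Ce.
by exists (1 + r); have := hbdD h hr; rewrite subrK.
Qed.

Lemma hmod_l2 xi x : hmod xi -> exists2 r, 0 <= r & l2le (@fibre H x) xi r.
Proof. by move=> /hmod_hbd[r [r0 h]]; exists r. Qed.

Lemma inner_summable xi eta x : hmod xi -> hmod eta ->
  csummable (@fibre H x) (fun g => Num.conj (xi g) * eta g).
Proof.
move=> /(@hmod_l2 _ x)[r r0 h] /(@hmod_l2 _ x)[s s0 k].
by exists (r * s); exact: l2le_prod.
Qed.

Lemma inner_bound xi eta x r s : hbd xi r -> hbd eta s ->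
  cnorm (inner xi eta x) <= r * s.
Proof. by move=> [r0 h] [s0 k]; apply: csum_bound; exact: l2le_prod. Qed.

Lemma inner_conj xi eta x : hmod xi -> hmod eta ->
  inner eta xi x = Num.conj (inner xi eta x).
Proof.
move=> hx he; rewrite /inner /fibre_int -csum_conj; last exact: inner_summable.
by apply: csum_eq => g _; rewrite rmorphM /= conjCK mulrC.
Qed.

Lemma innerDr xi eta zeta x : hmod xi -> hmod eta -> hmod zeta ->
  inner xi (eta + zeta) x = inner xi eta x + inner xi zeta x.
Proof.
move=> hx he hz; rewrite /inner /fibre_int -csumD; [|exact: inner_summable..].
by apply: csum_eq => g _; rewrite -mulrDr.
Qed.

Lemma innerZr xi eta c x : hmod xi -> hmod eta ->
  inner xi (fun g => c * eta g) x = c * inner xi eta x.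
Proof.
move=> hx he; rewrite /inner /fibre_int -csumZ; last exact: inner_summable.
by apply: csum_eq => g _; rewrite mulrCA.
Qed.

Lemma innerDl xi eta zeta x : hmod xi -> hmod eta -> hmod zeta ->
  inner (xi + eta) zeta x = inner xi zeta x + inner eta zeta x.
Proof.
move=> hx he hz; rewrite inner_conj; [|by []|exact: hmodD].
by rewrite innerDr// rmorphD /= -!inner_conj.
Qed.

Lemma innerZl xi eta c x : hmod xi -> hmod eta ->
  inner (fun g => c * xi g) eta x = Num.conj c * inner xi eta x.
Proof.
move=> hx he; rewrite inner_conj; [|by []|exact: hmodZ].
by rewrite innerZr// rmorphM /= -!inner_conj.
Qed.

Lemma innerNr xi eta x : hmod xi -> hmod eta ->
  inner xi (- eta) x = - inner xi eta x.
Proof.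
move=> hx he; rewrite -[RHS]mulN1r -innerZr//; congr inner.
by apply/funext => g; rewrite mulN1r.
Qed.

Lemma innerBr xi eta zeta x : hmod xi -> hmod eta -> hmod zeta ->
  inner xi (eta - zeta) x = inner xi eta x - inner xi zeta x.
Proof.
by move=> hx he hz; rewrite innerDr ?innerNr//; exact: hmodN.
Qed.

Lemma innerBl xi eta zeta x : hmod xi -> hmod eta -> hmod zeta ->
  inner (xi - eta) zeta x = inner xi zeta x - inner eta zeta x.
Proof.
move=> hx he hz; rewrite inner_conj; [|by []|exact: hmodB].
by rewrite innerBr// rmorphB /= -!inner_conj.
Qed.

Lemma inner_self xi x : hmod xi ->
  l2le (@fibre H x) xi (Num.sqrt (cnorm (inner xi xi x))).
Proof.
move=> /(@hmod_l2 _ x)[r r0 /l2leP h]; apply/l2leP; rewrite sqr_sqrtr ?cnorm_ge0//.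
have E : inner xi xi x =
    csum (@fibre H x) (fun g => Complex (cnorm (xi g) ^+ 2) 0).
  by apply: csum_eq => g _; rewrite sqr_cnorm.
rewrite E csum_nonneg => [|g]; last exact: sqr_ge0.
rewrite cnorm_real ger0_norm ?fine_ge0 ?fineK//; last first.
  by apply: esum_ge0 => g _; rewrite lee_fin sqr_ge0.
rewrite ge0_fin_numE; first by apply: le_lt_trans h _; rewrite ltry.
by apply: esum_ge0 => g _; rewrite lee_fin sqr_ge0.
Qed.

Lemma inner_self0 xi x g : hmod xi -> inner xi xi x = 0 -> grng g = x -> xi g = 0.
Proof.
move=> hx h gx; have := @inner_self _ x hx; rewrite h cnorm0 sqrtr0 => k.
by apply: cnorm_eq0; apply: le_anti; rewrite (l2le_point _ k)//= cnorm_ge0.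
Qed.

Lemma inner_separates xi eta : hmod xi -> hmod eta ->
  (forall zeta x, hmod zeta -> inner xi zeta x = inner eta zeta x) -> xi = eta.
Proof.
move=> hx he h; apply/funext => g; apply/eqP; rewrite -subr_eq0; apply/eqP.
have hd := hmodB hx he.
apply: (@inner_self0 (xi - eta) (grng g)) => //.
by rewrite innerBl// h// subrr.
Qed.

(** Inner products separate vectors, so linearity can be read off on the other side of the adjoint
    relation. *)
Lemma adjoint_oplin A B : is_op A -> is_op B -> adjoint_of A B -> oplin A.
Proof.
move=> [oA _] [oB _] adj; split=> [xi eta hx he|c xi hx].
  apply: inner_separates; first exact/oA/hmodD.
    by apply: hmodD; exact: oA.
  move=> zeta x hz; rewrite adj//; last exact: hmodD.
  by rewrite !innerDl ?adj//; [exact: oA|exact: oA|exact: oB].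
apply: inner_separates; first exact/oA/hmodZ.
  exact/hmodZ/oA.
move=> zeta x hz; rewrite adj//; last exact: hmodZ.
by rewrite !innerZl ?adj//; [exact: oA|exact: oB].
Qed.

Lemma adjoint_sym A B : is_op A -> is_op B -> adjoint_of A B -> adjoint_of B A.
Proof.
move=> [oA _] [oB _] adj xi eta hx he x.
by rewrite inner_conj; [|exact: he|exact: oB]; rewrite -adj// -inner_conj//; exact: oA.
Qed.

Lemma adjointable_oplin A : adjointable A -> oplin A.
Proof. by move=> [oA [B oB adj]]; exact: adjoint_oplin adj. Qed.

Lemma op_ext A B : is_op A -> is_op B -> (forall xi, hmod xi -> A xi = B xi) -> A = B.
Proof.
move=> [_ a0] [_ b0] h; apply/funext => xi.
by have [hx|hx] := pselect (hmod xi); [exact: h|rewrite a0// b0].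
Qed.

Lemma adjoint_unique A B B' : is_op A -> is_op B -> is_op B' ->
  adjoint_of A B -> adjoint_of A B' -> B = B'.
Proof.
move=> oA oB oB' h h'; apply: op_ext => // xi hx.
apply: inner_separates; [exact: oB.1|exact: oB'.1|].
move=> zeta x hz; rewrite inner_conj; [|by []|exact: oB.1].
by rewrite -h// h'// -inner_conj//; exact: oB'.1.
Qed.

(** With d = xi - eta and B an adjoint of A, the square norm of A d over [x] is the inner product of
    d with B (A d) over [x], which involves d on that fibre only. *)
Lemma adjointable_local A xi eta x : adjointable A -> hmod xi -> hmod eta ->
  (forall g, grng g = x -> xi g = eta g) ->
  forall g, grng g = x -> A xi g = A eta g.
Proof.
move=> aA hx he e g gx; have lA := adjointable_oplin aA.
have [[oA _] [B [oB _] adj]] := aA.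
apply/eqP; rewrite -subr_eq0; apply/eqP.
rewrite -[LHS]/((A xi - A eta) g) -oplinB//.
have hd := hmodB hx he.
apply: (@inner_self0 _ x) => //; first exact: oA.
rewrite adj//; last exact: oA.
rewrite /inner /fibre_int -[RHS](csum0 (@fibre H x)); apply: csum_eq => k kx.
by rewrite -[(xi - eta) k]/(xi k - eta k) e// subrr conjC0 mul0r.
Qed.

Lemma opnormP A M : oplin A -> 0 <= M -> (opnorm A <= M%:E)%E <-> opbd A M.
Proof.
move=> [_ lZ] M0; split=> [h|[_ h]]; last first.
  apply: ge_ereal_sup => _ [xi [hx /(hnormP xi (@ler01 R)) h1] <-].
  by apply/hnormP => //; have := h _ _ hx h1; rewrite mulr1.
have h1 xi : hmod xi -> hbd xi 1 -> hbd (A xi) M.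
  move=> hx /(hnormP xi (@ler01 R)) h1; apply/hnormP => //; apply: le_trans h.
  by apply: ereal_sup_ubound; exists xi.
split=> // xi r hx hr.
(* Since [r] may be zero, the vector is normalised by any positive [s] above [r], and [s] then
   decreases to [r]. *)
have key s : 0 < s -> r <= s -> hbd (A xi) (M * s).
  move=> s0 rs; pose c : C := Complex s^-1 0.
  have hc : hbd (fun g => c * xi g) 1.
    have := hbdZ c hr; apply: hbdW; rewrite cnorm_real gtr0_norm ?invr_gt0//.
    by rewrite mulrC ler_pdivrMr// mul1r.
  have := hbdZ (Complex s 0) (h1 _ (hmodZ c hx) hc).
  rewrite lZ// cnorm_real (gtr0_norm s0) mulrC; apply: hbd_eq => g.
  rewrite mulrA; suff -> : Complex s 0 * c = 1 by rewrite mul1r.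
  rewrite -[LHS]/((s%:C * (s^-1)%:C)%C) -rmorphM /= divff ?gt_eqF//.
have [r0 _] := hr; split; first exact: mulr_ge0.
move=> x s fs; apply: le_epsilon => e e0.
(* For [d <= 1] the left side exceeds (M r)^2 by at most d M^2 (2 r + 1), which dictates the
   quotient. *)
have [d d0 hd] : exists2 d : R, 0 < d & (M * (r + d)) ^+ 2 <= (M * r) ^+ 2 + e.
  have K0 : 0 < M ^+ 2 * (2 * r + 1) + 1.
    by rewrite ltr_wpDl// mulr_ge0 ?sqr_ge0// addr_ge0// mulr_ge0.
  pose d := Num.min 1 (e / (M ^+ 2 * (2 * r + 1) + 1)).
  have d0 : 0 < d by rewrite lt_min ltr01 divr_gt0.
  have d1 : d <= 1 by rewrite ge_min lexx.
  have d2 : d * (M ^+ 2 * (2 * r + 1) + 1) <= e by rewrite -ler_pdivlMr// ge_min lexx orbT.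
  exists d => //.
  have : 0 <= M ^+ 2 * d * (1 - d) by rewrite !mulr_ge0 ?sqr_ge0 ?subr_ge0// ltW.
  move: d2; nra.
apply: le_trans hd; apply: (key (r + d) _ _).2 => //.
- by rewrite ltr_wpDl.
- by rewrite lerDl ltW.
- exact: fs.
Qed.

Lemma opnorm_ge0 A : (0 <= opnorm A)%E.
Proof.
apply: (@le_trans _ _ (hnorm (A 0))); first exact: sqrte_ge0.
apply: ereal_sup_ubound; exists 0 => //; split; first exact: hmod0.
by apply/hnormP => //; exact: hbd0.
Qed.

(** If s is the norm of B xi, then s^2 is the supremum of the inner products of A (B xi) with xi,
    hence at most M s r; dividing by s gives the bound. *)
Lemma opbd_adjoint A B M : is_op A -> is_op B -> adjoint_of A B -> opbd A M ->
  opbd B M.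
Proof.
move=> oA oB adj [M0 hA]; split=> // xi r hx hr.
have hB := oB.1 _ hx; have [t ht] := hmod_hbd hB; have [r0 _] := hr.
have hn : hnorm (B xi) \is a fin_num.
  rewrite ge0_fin_numE ?sqrte_ge0//; apply: le_lt_trans (_ : t%:E < +oo)%E.
    by apply/hnormP => //; case: ht.
  exact: ltry.
pose s := fine (hnorm (B xi)).
have s0 : 0 <= s by rewrite fine_ge0// sqrte_ge0.
have hs : hbd (B xi) s by apply/hnormP => //; rewrite fineK.
have hs' u : hbd (B xi) u -> s <= u.
  by move=> hu; rewrite -lee_fin fineK//; apply/hnormP => //; case: hu.
have key : hbd (B xi) (Num.sqrt (M * s * r)).
  split; first exact: sqrtr_ge0.
  move=> x; apply: l2leW (@inner_self _ x hB); first exact: sqrtr_ge0.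
  apply: ler_wsqrtr; rewrite -adj//; apply: inner_bound => //; exact: hA.
have : s ^+ 2 <= M * s * r.
  by rewrite -[leRHS]sqr_sqrtr ?mulr_ge0// ler_sqr ?nnegrE ?sqrtr_ge0// hs'.
have [s00|sn] := eqVneq s 0.
  move=> _; move: hs; rewrite s00; apply: hbdW; exact: mulr_ge0.
rewrite expr2 mulrAC ler_pM2r; last by rewrite lt_neqAle eq_sym sn.
by move=> sM; exact: hbdW sM hs.
Qed.

Lemma adjoint_add A A' B B' : is_op A -> is_op A' -> is_op B -> is_op B' ->
  adjoint_of A A' -> adjoint_of B B' -> adjoint_of (A + B) (A' + B').
Proof.
move=> oA oA' oB oB' h k xi eta hx he x; rewrite !opD_E.
by rewrite innerDl ?innerDr ?h ?k//;
  [exact: oA'.1|exact: oB'.1|exact: oA.1|exact: oB.1].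
Qed.

Lemma adjoint_scale c A A' : is_op A -> is_op A' ->
  adjoint_of A A' -> adjoint_of (scale_op c A) (scale_op (Num.conj c) A').
Proof.
move=> oA oA' h xi eta hx he x; rewrite /scale_op.
by rewrite innerZl ?innerZr ?h//; [exact: oA'.1|exact: oA.1].
Qed.

Lemma adjoint_comp A A' B B' : is_op A' -> is_op B ->
  adjoint_of A A' -> adjoint_of B B' -> adjoint_of (A \o B) (B' \o A').
Proof.
by move=> oA' oB h k xi eta hx he x /=; rewrite h ?k//; [exact: oA'.1|exact: oB.1].
Qed.

Lemma adjointable_add A B : adjointable A -> adjointable B -> adjointable (A + B).
Proof.
move=> [oA [A' oA' hA]] [oB [B' oB' hB]]; split; first exact: is_op_add.
by exists (A' + B'); [exact: is_op_add|exact: adjoint_add].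
Qed.

Lemma adjointable_scale c A : adjointable A -> adjointable (scale_op c A).
Proof.
move=> [oA [A' oA' hA]]; split; first exact: is_op_scale.
by exists (scale_op (Num.conj c) A'); [exact: is_op_scale|exact: adjoint_scale].
Qed.

Lemma adjointable_comp A B : adjointable A -> adjointable B -> adjointable (A \o B).
Proof.
move=> aA aB; have lA := adjointable_oplin aA.
have [oA [A' oA' hA]] := aA; have [oB [B' oB' hB]] := aB.
have lB' : oplin B' by apply: adjoint_oplin (adjoint_sym _ _ hB).
by split; [exact: is_op_comp|exists (B' \o A'); [exact: is_op_comp|exact: adjoint_comp]].
Qed.

Lemma adjointable_adjoint A B : is_op A -> is_op B -> adjoint_of A B -> adjointable B.
Proof. by move=> oA oB h; split=> //; exists A => //; exact: adjoint_sym. Qed.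

Lemma opbd_dense A M : is_op A -> oplin A -> (exists N, opbd A N) -> 0 <= M ->
  (forall xi r, Cc xi -> hbd xi r -> hbd (A xi) (M * r)) -> opbd A M.
Proof.
move=> oA lA [N [N0 hN]] M0 h; split=> // xi r hx hr; have [r0 _] := hr.
split; first exact: mulr_ge0.
move=> x s fs; apply: le_epsilon => e e0.
(* An approximant in [Cc] is bounded by [r + d], and the remainder contributes [N * d]. For [d <= 1]
   the excess over (M r)^2 is at most d (M + N) (2 M r + M + N). *)
have [d d0 hd] : exists2 d : R, 0 < d &
    (M * (r + d) + N * d) ^+ 2 <= (M * r) ^+ 2 + e.
  have K0 : 0 < (M + N) * (2 * M * r + (M + N)) + 1.
    by rewrite ltr_wpDl// mulr_ge0 ?addr_ge0// mulr_ge0// mulr_ge0.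
  pose d := Num.min 1 (e / ((M + N) * (2 * M * r + (M + N)) + 1)).
  have d0 : 0 < d by rewrite lt_min ltr01 divr_gt0.
  have d1 : d <= 1 by rewrite ge_min lexx.
  have d2 : d * ((M + N) * (2 * M * r + (M + N)) + 1) <= e.
    by rewrite -ler_pdivlMr// ge_min lexx orbT.
  exists d => //.
  have : 0 <= (M + N) ^+ 2 * d * (1 - d).
    by rewrite !mulr_ge0 ?sqr_ge0 ?subr_ge0 ?(ltW d0)// addr_ge0.
  move: d2; nra.
have [eta Ce he] := (hmodP xi).1 hx _ d0.
have hh : hbd eta (r + d).
  by have := hbdB hr he; rewrite opprB addrC subrK.
have h1 := hbdD (hN _ _ (hmodB hx (Cc_hmod Ce)) he) (h _ _ Ce hh).
rewrite (oplinB lA hx (Cc_hmod Ce)) subrK in h1.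
by apply: le_trans hd; rewrite (addrC (M * _)); exact: (h1.2 x s fs).
Qed.

Lemma adjoint_dense A B : bounded_op A -> bounded_op B ->
  (forall xi eta x, Cc xi -> Cc eta -> inner (A xi) eta x = inner xi (B eta) x) ->
  adjoint_of A B.
Proof.
move=> [oA lA [M hM]] [oB lB [N hN]] h xi eta hx he x.
apply/eqP; rewrite -subr_eq0; apply/eqP.
have [r hr] := hmod_hbd hx; have [s hs] := hmod_hbd he.
have [r0 _] := hr; have [s0 _] := hs; have [M0 _] := hM; have [N0 _] := hN.
apply: (@cnorm_small1 _ _ (M * s + M * (r + 1) + (s * N + (r + 1) * N))) => e e0 e1.
have [xi' Cx hx'] := (hmodP xi).1 hx _ e0; have [eta' Ce he'] := (hmodP eta).1 he _ e0.
have mx := Cc_hmod Cx; have me := Cc_hmod Ce.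
have br : hbd xi' (r + 1).
  by have := hbdB hr hx'; rewrite opprB addrC subrK; apply: hbdW; rewrite lerD2l.
(* Telescoping through the approximants [xi'] and [eta'], for which the two inner products agree by
   [h]; the four terms left are linear in [e]. *)
have -> : inner (A xi) eta x - inner xi (B eta) x =
   (inner (A (xi - xi')) eta x + inner (A xi') (eta - eta') x) -
   (inner (xi - xi') (B eta) x + inner xi' (B (eta - eta')) x).
  have [h1 h1'] := (oA.1 _ hx, oA.1 _ mx); have [h2 h2'] := (oB.1 _ he, oB.1 _ me).
  rewrite (oplinB lA hx mx) (oplinB lB he me).
  rewrite (innerBl x h1 h1' he) (innerBr x h1' he me).
  rewrite (innerBl x hx mx h2) (innerBr x mx h2 h2') (h xi' eta')//.
  by move: (inner _ _ x) (inner _ _ x) (inner _ _ x) => a b c; ring.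
apply: le_trans (cnorm_triangle _ _) _; rewrite cnormN mulrDl lerD//.
  apply: le_trans (cnorm_triangle _ _) _; rewrite mulrDl lerD//.
    by rewrite mulrAC; apply: inner_bound => //; apply: hM.2 => //; exact: hmodB.
  by apply: inner_bound => //; apply: hM.2.
apply: le_trans (cnorm_triangle _ _) _; rewrite mulrDl lerD//.
  by rewrite mulrC mulrA -mulrA (mulrC s); apply: inner_bound => //; apply: hN.2.
rewrite -mulrA; apply: inner_bound => //; apply: hN.2 => //; exact: hmodB.
Qed.

Lemma opclosureP (S : set (op R H)) A : S `<=` adjointable ->
  opclosure S A <-> adjointable A /\
    forall e : R, 0 < e -> exists2 B, S B & opbd (A - B) e.
Proof.
move=> Sa; split=> -[aA h]; split=> // e e0; have [B SB hB] := h e e0; exists B => //.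
  by apply/(opnormP _ (ltW e0)) => //; apply: oplin_sub; apply: adjointable_oplin => //; exact: Sa.
by apply/(opnormP _ (ltW e0)) => //; apply: oplin_sub; apply: adjointable_oplin => //; exact: Sa.
Qed.

Lemma sub_opclosure (S : set (op R H)) : S `<=` adjointable -> S `<=` opclosure S.
Proof.
move=> Sa A SA; apply/opclosureP => //; split; first exact: Sa.
move=> e e0; exists A => //; rewrite subrr; split; first exact: ltW.
by move=> xi r _ [r0 _]; apply: hbd0; rewrite mulr_ge0// ltW.
Qed.

(** Boundedness is a field of its own: it is what makes composition jointly continuous when passing
    to the closure. *)
Record star_algebra (S : set (op R H)) : Prop := StarAlgebra {
  sa_adjointable : S `<=` adjointable;
  sa_bounded : forall A, S A -> exists M, opbd A M;
  sa_nonempty : exists A, S A;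
  sa_add : forall A B, S A -> S B -> S (A + B);
  sa_scale : forall c A, S A -> S (scale_op c A);
  sa_comp : forall A B, S A -> S B -> S (A \o B);
  sa_star : forall A B, S A -> adjointable B -> adjoint_of A B -> S B }.

Lemma opclosure_bounded (S : set (op R H)) A : star_algebra S -> opclosure S A ->
  exists M, opbd A M.
Proof.
move=> sS /(opclosureP _ (sa_adjointable sS))[_ /(_ 1 ltr01)[B SB h]].
have [M hM] := sa_bounded sS SB.
by exists (1 + M); have := opbd_add h hM; rewrite subrK.
Qed.

Lemma opclosure_cstar (S : set (op R H)) : star_algebra S ->
  is_cstar_subalgebra (opclosure S).
Proof.
move=> sS; have Sa := sa_adjointable sS; split.
- by move=> A [].
- have [A SA] := sa_nonempty sS; apply: sub_opclosure => //.
  have -> : (0 : op R H) = scale_op 0 A.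
    by apply/funext => xi; apply/funext => g; rewrite /scale_op mul0r.
  exact: sa_scale.
- move=> A B /opclosureP[//|aA hA] /opclosureP[//|aB hB]; apply/opclosureP => //.
  split; first exact: adjointable_add.
  move=> e e0; have e2 : 0 < e / 2 by rewrite divr_gt0.
  have [A' SA' kA] := hA _ e2; have [B' SB' kB] := hB _ e2.
  exists (A' + B'); first exact: sa_add.
  by rewrite opprD addrACA [e]splitr; exact: opbd_add.
- move=> c A /opclosureP[//|aA hA]; apply/opclosureP => //.
  split; first exact: adjointable_scale.
  move=> e e0; have c0 : 0 < cnorm c + 1 by rewrite ltr_wpDl ?cnorm_ge0.
  have [A' SA' kA] := hA _ (divr_gt0 e0 c0).
  exists (scale_op c A'); first exact: sa_scale.
  have -> : scale_op c A - scale_op c A' = scale_op c (A - A').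
    by apply/funext => xi; apply/funext => g; rewrite /scale_op -[LHS]/(_ - _) -mulrBr.
  have := opbd_scale c kA; apply: opbdW.
  rewrite -[leRHS](divfK (lt0r_neq0 c0)) mulrC ler_wpM2l ?lerDl//.
  by rewrite divr_ge0 ?ltW.
- move=> A B oA oB; have [M hM] := opclosure_bounded sS oA.
  have [N hN] := opclosure_bounded sS oB; have [M0 _] := hM; have [N0 _] := hN.
  have /opclosureP[//|aA hA] := oA; have /opclosureP[//|aB hB] := oB.
  apply/opclosureP => //; split; first exact: adjointable_comp.
  move=> e e0; have K0 : 0 < N + M + 1 + 1 by rewrite ltr_wpDl// addr_ge0// addr_ge0.
  pose d := Num.min 1 (e / (N + M + 1 + 1)).
  have d0 : 0 < d by rewrite lt_min ltr01 divr_gt0.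
  have d1 : d <= 1 by rewrite ge_min lexx.
  have d2 : d * (N + M + 1 + 1) <= e by rewrite -ler_pdivlMr// ge_min lexx orbT.
  have [A' SA' kA] := hA _ d0; have [B' SB' kB] := hB _ d0.
  exists (A' \o B'); first exact: sa_comp.
  have oBop := aB.1; have oB'op := (Sa _ SB').1.
  have lA' := adjointable_oplin (Sa _ SA').
  (* Because [d <= 1], the approximant [A'] has a bound that does not depend on [e]. *)
  have bA' : opbd A' (M + 1).
    by have := opbd_sub hM kA; rewrite opprB addrC subrK; apply: opbdW; rewrite lerD2l.
  have e1 : opbd ((A \o B) - (A' \o B')) (d * N + (M + 1) * d).
    have d0' := ltW d0; split; first by rewrite !(mulr_ge0, addr_ge0).
    move=> xi r hx hr; rewrite -[X in hbd X _]/(A (B xi) - A' (B' xi)).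
    have -> : A (B xi) - A' (B' xi) = (A - A') (B xi) + A' ((B - B') xi).
      rewrite !opB_E (oplinB lA' (oBop.1 _ hx) (oB'op.1 _ hx)).
      by rewrite addrA subrK.
    rewrite mulrDl; apply: hbdD.
      by rewrite -mulrA; apply: kA.2; [exact: oBop.1|exact: hN.2].
    rewrite -mulrA; apply: bA'.2; last exact: kB.2.
    by apply: hmodB; [exact: oBop.1|exact: oB'op.1].
  by apply: opbdW e1; apply: le_trans d2; nra.
- move=> A B /opclosureP[//|aA hA] aB adj; apply/opclosureP => //; split=> //.
  move=> e e0; have [A' SA' kA] := hA _ e0.
  have [oA' [B' oB' adj']] := Sa _ SA'.
  have aB' : adjointable B' by exact: adjointable_adjoint adj'.
  exists B'; first exact: sa_star adj'.
  (* Taking adjoints preserves bounds, so the adjoint of an approximant approximates the adjoint. *)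
  apply: opbd_adjoint kA.
  + exact: is_op_sub aA.1 oA'.
  + exact: is_op_sub aB.1 oB'.
  + rewrite -!scale_opN1; apply: adjoint_add => //; try exact: aA.1; try exact: aB.1.
    * exact: is_op_scale.
    * exact: is_op_scale.
    * by have := adjoint_scale (-1) oA' oB' adj'; rewrite rmorphN rmorph1.
- have oa : opclosure S `<=` adjointable by move=> A [].
  move=> A /opclosureP[//|aA hA]; apply/opclosureP => //; split=> //.
  move=> e e0; have e2 : 0 < e / 2 by rewrite divr_gt0.
  have [B /opclosureP[//|aB hB] AB] := hA _ e2; have [D SD BD] := hB _ e2.
  by exists D => //; rewrite [e]splitr; exact: opbd_triangle AB BD.
Qed.

(** The limit is taken pointwise. For [m >= n] the bound on [A n - A m] is at most 2/(n+1), and it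
    survives the limit in [m]. *)
Lemma op_limit (A : nat -> op R H) :
  (forall n, is_op (A n) /\ oplin (A n)) ->
  (forall n m, opbd (A n - A m) (n.+1%:R^-1 + m.+1%:R^-1)) ->
  exists L : op R H, is_op L /\ forall n, opbd (A n - L) (2 * n.+1%:R^-1).
Proof.
move=> oA cA.
have small (e : R) : 0 < e -> exists N, forall n, (N <= n)%N -> n.+1%:R^-1 <= e.
  move=> e0; have /= [N _ hN] := near_infty_natSinv_lt (PosNum e0).
  by exists N => n Nn; apply: ltW; exact: hN.
have ex xi (hx : hmod xi) g : exists l : C, (fun n => A n xi g) @ \oo --> l.
  have [r hr] := hmod_hbd hx; have [r0 _] := hr.
  apply: cplx_complete => e e0.
  have K0 : 0 < 2 * (r + 1) by rewrite mulr_gt0// ltr_wpDl.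
  have [N hN] := small _ (divr_gt0 e0 K0); exists N => n m Nn Nm.
  apply: le_trans (hbd_point g ((cA n m).2 _ _ hx hr)) _.
  apply: le_trans (_ : (e / (2 * (r + 1)) + e / (2 * (r + 1))) * (r + 1) <= _).
    by apply: ler_pM; rewrite ?addr_ge0 ?invr_ge0 ?lerDl ?lerD// hN.
  rewrite le_eqVlt; apply/orP; left; apply/eqP; field.
  by rewrite gt_eqF// ltr_wpDl.
(* The value 0 outside [hmod] is the convention imposed by [is_op]. *)
pose L xi := if pselect (hmod xi) is left hx then fun g => projT1 (cid (ex xi hx g)) else 0.
have Lcv xi : hmod xi -> forall g, (fun n => A n xi g) @ \oo --> L xi g.
  by move=> hx g; rewrite /L; case: pselect => // h; case: cid.
have Lb n xi r : hmod xi -> hbd xi r -> hbd ((A n - L) xi) (2 * n.+1%:R^-1 * r).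
  move=> hx hr; have [r0 _] := hr; split; first by rewrite !mulr_ge0// invr_ge0.
  move=> x; apply: (@l2le_lim _ _ _ _ \oo _ (fun m => (A n - A m) xi)).
    move=> g _; rewrite !opB_E.
    by apply: cvgB; [exact: cvg_cst|exact: Lcv].
  exists n => // m /= nm; apply: l2leW (_ : l2le _ _ ((n.+1%:R^-1 + m.+1%:R^-1) * r)).
  - by rewrite mulr_ge0// addr_ge0 ?invr_ge0.
  - by rewrite ler_wpM2r// mulr2n mulrDl !mul1r lerD2l lef_pV2 ?posrE// ler_nat.
  - by apply: ((cA n m).2 _ _ hx hr).2.
exists L; split; last by move=> n; split; [rewrite mulr_ge0 ?invr_ge0|exact: Lb].
split; last by move=> xi hx; rewrite /L; case: pselect.
move=> xi hx; apply: hmod_closed => e e0.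
have [r hr] := hmod_hbd hx; have [r0 _] := hr.
have K0 : 0 < 2 * (r + 1) by rewrite mulr_gt0// ltr_wpDl.
have [N hN] := small _ (divr_gt0 e0 K0).
exists (A N xi); first exact: (oA N).1.1.
apply: hbd_subC; have := Lb N xi r hx hr; apply: hbdW.
apply: le_trans (_ : 2 * (e / (2 * (r + 1))) * (r + 1) <= _).
  by apply: ler_pM; rewrite ?mulr_ge0 ?invr_ge0 ?lerDl// ler_wpM2l// hN.
rewrite le_eqVlt; apply/orP; left; apply/eqP; field.
by rewrite gt_eqF// ltr_wpDl.
Qed.

(** By [opbd_adjoint] the adjoints satisfy the same Cauchy estimate, and their limit is an adjoint
    of the limit. Without them the limit could not be shown to be adjointable. *)
Lemma adjointable_limit (A B : nat -> op R H) :
  (forall n, is_op (A n) /\ is_op (B n)) -> (forall n, adjoint_of (A n) (B n)) ->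
  (forall n m, opbd (A n - A m) (n.+1%:R^-1 + m.+1%:R^-1)) ->
  exists L : op R H, adjointable L /\ forall n, opbd (A n - L) (2 * n.+1%:R^-1).
Proof.
move=> oAB adj cA.
have lA n : oplin (A n) by case: (oAB n) => oA oB; exact: (adjoint_oplin oA oB (adj n)).
have lB n : oplin (B n).
  by case: (oAB n) => oA oB; exact: (adjoint_oplin oB oA (adjoint_sym oA oB (adj n))).
have cB n m : opbd (B n - B m) (n.+1%:R^-1 + m.+1%:R^-1).
  have [oA oB] := oAB n; have [oA' oB'] := oAB m.
  apply: (opbd_adjoint (is_op_sub oA oA') (is_op_sub oB oB') _ (cA n m)).
  rewrite -!scale_opN1; apply: adjoint_add => //; try exact: is_op_scale.
  by have := adjoint_scale (-1) oA' oB' (adj m); rewrite rmorphN rmorph1.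
have [n|L [oL hL]] := op_limit _ cA; first by have [] := oAB n.
have [n|L' [oL' hL']] := op_limit _ cB; first by have [] := oAB n.
exists L; split=> //; split=> //; exists L' => // xi eta hx he x.
apply/eqP; rewrite -subr_eq0; apply/eqP.
have [r hr] := hmod_hbd hx; have [s hs] := hmod_hbd he.
have [r0 _] := hr; have [s0 _] := hs.
apply: (@cnorm_small1 _ _ (4 * (r * s))) => e e0 _.
have /= [n _ /(_ n (leqnn n)) hn] := near_infty_natSinv_lt (PosNum e0).
have [oA oB] := oAB n.
have -> : inner (L xi) eta x - inner xi (L' eta) x =
    inner xi ((B n - L') eta) x - inner ((A n - L) xi) eta x.
  have h1 := oA.1 _ hx; have h2 := oB.1 _ he.
  rewrite !opB_E (innerBl x h1 (oL.1 _ hx) he) (innerBr x hx h2 (oL'.1 _ he)).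
  by rewrite adj//; move: (inner _ _ x) (inner _ _ x) => a b; ring.
apply: le_trans (cnorm_triangle _ _) _; rewrite cnormN.
have h1 := inner_bound x hr ((hL' n).2 _ _ he hs).
have h2 := inner_bound x ((hL n).2 _ _ hx hr) hs.
apply: le_trans (lerD h1 h2) _.
have -> : r * (2 * n.+1%:R^-1 * s) + 2 * n.+1%:R^-1 * r * s = 4 * (r * s) * n.+1%:R^-1.
  by ring.
by apply: ler_wpM2l; [rewrite !mulr_ge0|exact: ltW].
Qed.

End HilbertModule.

(** * Etale groupoids and local sections of the range map *)

(** Multiplication and the action are continuous only on composable pairs; this is the form in which
    that continuity is applied to moving arrows. *)
Lemma within_cvg (S T : topologicalType) (A : set S) (f : S -> T) (I : Type)
    (F : set_system I) {FF : Filter F} (u : I -> S) (x : S) :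
  {within A, continuous f} -> A x -> u @ F --> x -> (\forall i \near F, A (u i)) ->
  (fun i => f (u i)) @ F --> f x.
Proof.
move=> /subspace_continuousP cf Ax ux Au W /(cf x Ax) /ux.
by rewrite /= /nbhs/=; apply: filterS2 Au => i Ai; exact.
Qed.

Lemma cvg_congr (T : topologicalType) (I : Type) (F : set_system I) {FF : Filter F}
    (u v : I -> T) (l : T) :
  (\forall i \near F, u i = v i) -> v @ F --> l -> u @ F --> l.
Proof.
move=> uv vl U nU; have h : F (v @^-1` U) := vl U nU.
by apply: filterS2 uv h => i; rewrite /= => ->.
Qed.

Lemma near_neq (T : topologicalType) (I : Type) (F : set_system I) {FF : Filter F}
    (u v : I -> T) (a b : T) : hausdorff_space T ->
  u @ F --> a -> v @ F --> b -> a <> b -> \forall i \near F, u i <> v i.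
Proof.
rewrite open_hausdorff => hT ua vb /eqP ab.
have [[U V] /= [Ua Vb] [oU oV /eqP UV]] := hT _ _ ab.
have nU : nbhs a U by exact: (open_nbhs_nbhs (conj oU (set_mem Ua))).
have nV : nbhs b V by exact: (open_nbhs_nbhs (conj oV (set_mem Vb))).
have h1 : \forall i \near F, U (u i) := ua _ nU.
have h2 : \forall i \near F, V (v i) := vb _ nV.
apply: filterS2 h1 h2 => i Ui Vi uv.
suff : set0 (u i) by [].
by rewrite -UV; split => //=; rewrite uv.
Qed.

(** The principle by which identities known on arrows extend to all of [beta]. *)
Lemma cvg_near_eq (T : topologicalType) (I : Type) (F : set_system I)
    {FF : ProperFilter F} (u v : I -> T) (a b : T) : hausdorff_space T ->
  u @ F --> a -> v @ F --> b -> (\forall i \near F, u i = v i) -> a = b.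
Proof.
move=> hT ua vb uv; apply: contrapT => ab.
by have [i []] := filter_ex (filterI uv (near_neq hT ua vb ab)).
Qed.

Lemma hausdorff_prod (S T : topologicalType) :
  hausdorff_space S -> hausdorff_space T -> hausdorff_space (S * T)%type.
Proof.
move=> hS hT [a b] [c d] cl; congr pair.
  apply: hS => U V nU nV.
  have [||[x y] [/= Ux Vx]] := cl (fst @^-1` U) (fst @^-1` V);
    [exact: cvg_fst nU|exact: cvg_fst nV|by exists x].
apply: hT => U V nU nV.
have [||[x y] [/= Ux Vx]] := cl (snd @^-1` U) (snd @^-1` V);
  [exact: cvg_snd nU|exact: cvg_snd nV|by exists y].
Qed.

Lemma near_all (I : Type) (F : set_system I) {FF : Filter F} (T : eqType)
    (s : seq T) (P : T -> I -> Prop) :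
  (forall x, x \in s -> \forall i \near F, P x i) ->
  \forall i \near F, forall x, x \in s -> P x i.
Proof.
elim: s => [|x s ih] h; first exact: filterE.
have h1 : \forall i \near F, P x i by apply: h; rewrite inE eqxx.
have h2 : \forall i \near F, forall y, y \in s -> P y i.
  by apply: ih => y ys; apply: h; rewrite inE ys orbT.
apply: filterS2 h1 h2 => i Px Ps y; rewrite inE => /orP[/eqP -> //|]; exact: Ps.
Qed.

Lemma cvg_bigsum (K : numFieldType) (I : Type) (J : eqType) (F : set_system I)
    {FF : Filter F} (s : seq J) (u : J -> I -> K) (l : J -> K) :
  (forall j, j \in s -> u j @ F --> l j) ->
  (fun i => \sum_(j <- s) u j i) @ F --> \sum_(j <- s) l j.
Proof.
elim: s => [|j s ih] h.
  by under eq_fun do rewrite big_nil; rewrite big_nil; exact: cvg_cst.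
under eq_fun do rewrite big_cons.
rewrite big_cons; apply: cvgD; first by apply: h; rewrite inE eqxx.
by apply: ih => k ks; apply: h; rewrite inE ks orbT.
Qed.

Section GroupoidAlgebra.
Context {G : etale_groupoid}.
Implicit Types g h k : G.

Let gr := lc_groupoidP (etale_lc G).

Lemma rngM g h : gsrc g = grng h -> grng (gmul g h) = grng g.
Proof. exact: grng_mul gr g h. Qed.
Lemma srcM g h : gsrc g = grng h -> gsrc (gmul g h) = gsrc h.
Proof. exact: gsrc_mul gr g h. Qed.
Lemma rngV g : grng (ginv g) = gsrc g. Proof. exact: grng_inv gr g. Qed.
Lemma srcV g : gsrc (ginv g) = grng g. Proof. exact: gsrc_inv gr g. Qed.
Lemma rng1 (x : units G) : grng (gunit x) = x. Proof. exact: grng_unit gr x. Qed.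
Lemma src1 (x : units G) : gsrc (gunit x) = x. Proof. exact: gsrc_unit gr x. Qed.
Lemma amulA g h k : gsrc g = grng h -> gsrc h = grng k ->
  gmul g (gmul h k) = gmul (gmul g h) k.
Proof. exact: gmulA gr g h k. Qed.
Lemma amul1 x g : grng g = x -> gmul (gunit x) g = g.
Proof. by move=> <-; exact: gmul1g gr g. Qed.
Lemma amulr1 x g : gsrc g = x -> gmul g (gunit x) = g.
Proof. by move=> <-; exact: gmulg1 gr g. Qed.
Lemma amulVg g : gmul (ginv g) g = gunit (gsrc g). Proof. exact: gmulVg gr g. Qed.
Lemma amulgV g : gmul g (ginv g) = gunit (grng g). Proof. exact: gmulgV gr g. Qed.

Lemma amulKg g h : gsrc g = grng h -> gmul (ginv g) (gmul g h) = h.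
Proof. by move=> e; rewrite amulA ?srcV// amulVg amul1. Qed.

Lemma ainv_uniq g h : gsrc g = grng h -> gmul g h = gunit (grng g) -> h = ginv g.
Proof. by move=> e e1; rewrite -(amulKg e) e1 amulr1 ?srcV. Qed.

Lemma ainvK g : ginv (ginv g) = g.
Proof. by apply/esym/ainv_uniq; rewrite ?srcV ?rngV ?amulVg. Qed.

Lemma amulKVg g h : grng g = grng h -> gmul g (gmul (ginv g) h) = h.
Proof. by move=> e; have := @amulKg (ginv g) h; rewrite ainvK srcV; exact. Qed.

Lemma ainvM g h : gsrc g = grng h -> ginv (gmul g h) = gmul (ginv h) (ginv g).
Proof.
move=> e; apply/esym/ainv_uniq.
  by rewrite srcM// rngM ?rngV ?srcV.
rewrite rngM// -amulA ?rngM ?rngV ?srcV//.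
by rewrite amulKVg ?rngV// amulgV.
Qed.

Lemma inv_mulM g h k : gsrc g = grng h -> grng h = grng k ->
  gmul (ginv (gmul g h)) (gmul g k) = gmul (ginv h) k.
Proof.
move=> gh hk; rewrite ainvM// -amulA ?srcV ?rngV ?rngM ?gh//.
by rewrite amulKg// gh.
Qed.

Lemma left_translation_bij g :
  set_bij (@fibre G (gsrc g)) (@fibre G (grng g)) (gmul g).
Proof.
split=> [h /= hg|h k|h /= hg].
- by rewrite /fibre/= rngM.
- move=> /set_mem hg /set_mem kg e.
  by rewrite -(@amulKg g h) ?e ?amulKg.
- exists (gmul (ginv g) h); first by rewrite /fibre/= rngM ?rngV// srcV hg.
  by rewrite amulKVg.
Qed.

Lemma hausdorff_arrows : hausdorff_space G.
Proof. by have [] := lc_arrows (etale_lc G). Qed.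

Lemma hausdorff_units : hausdorff_space (units G).
Proof. by have [] := lc_units (etale_lc G). Qed.

Lemma cvg_rng (I : Type) (F : set_system I) {FF : Filter F} (u : I -> G) g :
  u @ F --> g -> (fun i => grng (u i)) @ F --> grng g.
Proof. by move=> ug; apply: cvg_comp ug _; exact: (grng_continuous (etale_lc G)). Qed.

Lemma cvg_src (I : Type) (F : set_system I) {FF : Filter F} (u : I -> G) g :
  u @ F --> g -> (fun i => gsrc (u i)) @ F --> gsrc g.
Proof. by move=> ug; apply: cvg_comp ug _; exact: (gsrc_continuous (etale_lc G)). Qed.

Lemma cvg_inv (I : Type) (F : set_system I) {FF : Filter F} (u : I -> G) g :
  u @ F --> g -> (fun i => ginv (u i)) @ F --> ginv g.
Proof. by move=> ug; apply: cvg_comp ug _; exact: (ginv_continuous (etale_lc G)). Qed.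

Lemma cvg_unit (I : Type) (F : set_system I) {FF : Filter F} (u : I -> units G) x :
  u @ F --> x -> (fun i => gunit (u i)) @ F --> gunit x.
Proof. by move=> ug; apply: cvg_comp ug _; exact: (gunit_continuous (etale_lc G)). Qed.

Lemma cvg_mul (I : Type) (F : set_system I) {FF : Filter F} (u v : I -> G) g h :
  gsrc g = grng h -> u @ F --> g -> v @ F --> h ->
  (\forall i \near F, gsrc (u i) = grng (v i)) ->
  (fun i => gmul (u i) (v i)) @ F --> gmul g h.
Proof.
move=> gh ug vh uv.
apply: (@within_cvg _ _ _ _ _ _ _ (fun i => (u i, v i)) (g, h)
  (gmul_continuous (etale_lc G)) gh) => //.
exact: cvg_pair.
Qed.

Lemma compact_mul (K L : set G) : compact K -> compact L ->
  compact [set gmul p.1 p.2 | p in K `*` L `&` composable G].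
Proof.
move=> cK cL; apply: continuous_compact.
  by apply: continuous_subspaceW (gmul_continuous (etale_lc G)) => p [].
apply: (subclosed_compact _ (compact_setX cK cL)); last by move=> p [].
apply: closedI; first by apply: compact_closed (compact_setX cK cL);
  exact: hausdorff_prod (hausdorff_arrows) (hausdorff_arrows).
(* The composable pairs form a closed set because the unit space is Hausdorff. *)
have -> : composable G = [set p | gsrc p.1 = grng p.2] by [].
move=> p pc; apply: contrapT => ne.
have c1 : (fun q : G * G => gsrc q.1) @ p --> gsrc p.1.
  by apply: cvg_src; exact: cvg_fst.
have c2 : (fun q : G * G => grng q.2) @ p --> grng p.2.
  by apply: cvg_rng; exact: cvg_snd.
have n1 : \forall q \near p, gsrc q.1 <> grng q.2.
  exact: near_neq hausdorff_units c1 c2 ne.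
by have [q [/= e /=]] := pc _ n1.
Qed.

Lemma compact_inv (K : set G) : compact K -> compact (@ginv G @` K).
Proof.
move=> cK; apply: continuous_compact => //; apply: continuous_subspaceT.
exact: (ginv_continuous (etale_lc G)).
Qed.

Lemma compact_rng (K : set G) : compact K -> compact (@grng G @` K).
Proof.
move=> cK; apply: continuous_compact => //; apply: continuous_subspaceT.
exact: (grng_continuous (etale_lc G)).
Qed.

End GroupoidAlgebra.

(** * Local sections through arrows, and sums over nearby fibres *)

Section LocalSections.
Context {G : etale_groupoid}.
Local Notation X := (units G).
Implicit Types (g h : G) (x : X) (K : set G).

(** The last clause says that every arrow close to [s x] lies on the section, so that its image is
    open. *)
Definition is_section (V : set X) (s : X -> G) : Prop :=
  [/\ open V, forall x, V x -> grng (s x) = x, forall x, V x -> s @ x --> s x &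
      forall x, V x -> \forall h \near s x, h = s (grng h)].

Lemma local_section g : exists s : X -> G, exists V : set X,
  [/\ is_section V s, V (grng g) & s (grng g) = g].
Proof.
have [cr /(_ g)[U [oU Ug oV injU opU]]] := etale_local_homeo G.
pose s x := xget g (U `&` [set h | grng h = x]).
have sE h : U h -> s (grng h) = h.
  move=> Uh; rewrite /s; case: xgetP => [k _ [Uk /= kh]|/(_ h)[]//].
  by apply: injU => //; exact/mem_set.
exists s, (@grng G @` U); split; [split=> //| |].
- by move=> _ [h Uh <-]; rewrite sE.
- move=> _ [h Uh <-] W; rewrite sE// => nW.
  rewrite nbhsE in nW; have [W' [oW' W'h] WW'] := nW.
  have : nbhs (grng h) (@grng G @` (U `&` W')).
    apply: open_nbhs_nbhs; split; last by exists h.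
    by apply: opU; [exact: openI|exact: subIsetl].
  by apply: filterS => _ [k [Uk W'k] <-] /=; rewrite sE//; exact: WW'.
- move=> _ [h Uh <-]; rewrite sE//; have : nbhs h U by exact: open_nbhs_nbhs.
  by apply: filterS => k Uk; rewrite sE.
- by exists g.
- exact: sE.
Qed.

(** A chosen section through [g], total as a function but meaningful on [sec_dom g] only. *)
Definition sec g : X -> G := projT1 (cid (local_section g)).
Definition sec_dom g : set X := projT1 (cid (projT2 (cid (local_section g)))).

Let sec_spec g : [/\ is_section (sec_dom g) (sec g), sec_dom g (grng g) &
  sec g (grng g) = g].
Proof. exact: (projT2 (cid (projT2 (cid (local_section g))))). Qed.

Lemma sec_rng g : sec g (grng g) = g. Proof. by have [] := sec_spec g. Qed.

Lemma sec_domP g : sec_dom g (grng g). Proof. by have [] := sec_spec g. Qed.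

Lemma sec_dom_near g x : sec_dom g x -> nbhs x (sec_dom g).
Proof. by have [[oV _ _ _] _ _] := sec_spec g; move=> Vx; exact: open_nbhs_nbhs. Qed.

Lemma sec_range g x : sec_dom g x -> grng (sec g x) = x.
Proof. by have [[_ + _ _] _ _] := sec_spec g; apply. Qed.

Lemma sec_cvg g x : sec_dom g x -> sec g @ x --> sec g x.
Proof. by have [[_ _ + _] _ _] := sec_spec g; apply. Qed.

Lemma sec_near g x : sec_dom g x -> \forall h \near sec g x, h = sec g (grng h).
Proof. by have [[_ _ _ +] _ _] := sec_spec g; apply. Qed.

Lemma sec_cvg_to g : sec g @ grng g --> g.
Proof. by have := sec_cvg (sec_domP g); rewrite sec_rng. Qed.

Lemma sec_near_eq g : \forall h \near g, h = sec g (grng h).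
Proof. by have := sec_near (sec_domP g); rewrite sec_rng. Qed.

Lemma near_sec_dom g : \forall x \near grng g, sec_dom g x.
Proof. exact/sec_dom_near/sec_domP. Qed.

(** Lists directed by inclusion: near-covering compactness along this filter yields a single list
    that works for the whole compact set. *)
Let eventual {T : eqType} : set_system (seq T) :=
  filter_from [set: seq T] (fun l0 => [set l : seq T | {subset l0 <= l}]).

Let eventual_filter (T : eqType) : Filter (@eventual T).
Proof.
apply: filter_from_filter; first by exists [::].
move=> l m _ _; exists (l ++ m) => // n nlm.
by split=> x xl; apply: nlm; rewrite mem_cat xl ?orbT.
Qed.

(** Fibres are discrete: an arrow over [x] has a neighbourhood, the image of a section, that meets
    the fibre in that arrow alone, while an arrow not over [x] has a neighbourhood missing the
    fibre. *)
Lemma compact_fibre K x : compact K ->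
  exists2 l : seq G, fin_in (@fibre G x) l & forall h, K h -> grng h = x -> h \in l.
Proof.
move=> /compact_near_coveringP/near_covering_withinP cK.
have [g Kg|l0 _ /(_ l0) h0] := @cK (seq G) eventual
  (fun l h => grng h = x -> h \in l) (eventual_filter _).
  have [gx|gx] := pselect (grng g = x); last first.
    have n1 : \forall h \near g, grng h <> x.
      exact: (near_neq hausdorff_units (@grng_continuous _ (etale_lc G) g) (cvg_cst x) gx).
    exists ([set h : G | grng h <> x], setT) => /=.
      by split => //; exact: filterT.
    by move=> [h l] /= [hx _] _ /hx.
  exists ([set h : G | h = sec g (grng h)], [set l : seq G | {subset [:: g] <= l}]) => /=.
    by split; [exact: sec_near_eq|exists [:: g]].
  move=> [h l] /= [hs gl] _ hx; apply: gl; rewrite hs hx -gx sec_rng.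
  by rewrite inE.
exists (undup [seq h <- l0 | `[< grng h = x >]]).
  split; first exact: undup_uniq.
  by move=> h; rewrite mem_undup mem_filter => /andP[/asboolP].
by move=> h Kh hx; rewrite mem_undup mem_filter (h0 _ h)// andbT; exact/asboolP.
Qed.

Lemma sections_distinct (l : seq G) x : uniq l -> (forall g, g \in l -> grng g = x) ->
  \forall y \near x, {in l &, injective (fun g => sec g y)}.
Proof.
move=> ul lx.
have : \forall y \near x, forall g, g \in l -> forall h, h \in l ->
    g <> h -> sec g y <> sec h y.
  apply: near_all => g gl; apply: near_all => h hl.
  have [->|gh] := pselect (g = h); first exact: filterE.
  have cg : sec g @ x --> g by rewrite -(lx g gl); exact: sec_cvg_to.
  have ch : sec h @ x --> h by rewrite -(lx h hl); exact: sec_cvg_to.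
  by apply: filterS (near_neq hausdorff_arrows cg ch gh) => y yy _.
apply: filterS => y d g h gl hl e; apply: contrapT => gh; exact: d gl h hl gh e.
Qed.

(** Each point of [K] has a neighbourhood whose arrows either have range away from [x] or lie on the
    section through that point; compactness makes the choice of [y] uniform. *)
Lemma sections_cover K x (l : seq G) : compact K ->
  (forall h, K h -> grng h = x -> h \in l) ->
  \forall y \near x, forall h, K h -> grng h = y -> h \in [seq sec g y | g <- l].
Proof.
move=> /compact_near_coveringP/near_covering_withinP cK lK.
have := @cK X (nbhs x) (fun y h => grng h = y -> h \in [seq sec g y | g <- l]) _.
apply => g Kg; have [gx|gx] := pselect (grng g = x); last first.
  have c1 : (fun p : G * X => grng p.1) @ ((g, x) : G * X) --> grng g.
    by apply: cvg_rng; exact: cvg_fst.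
  have c2 : (fun p : G * X => p.2) @ ((g, x) : G * X) --> x by exact: cvg_snd.
  have n1 : \forall p \near ((g, x) : G * X), grng p.1 <> p.2.
    exact: near_neq hausdorff_units c1 c2 gx.
  by apply: filterS n1 => -[h y] /= hy _ /hy.
exists ([set h : G | h = sec g (grng h)], setT) => /=.
  by split; [exact: sec_near_eq|exact: filterT].
move=> [h y] /= [e _] _ hy; apply/mapP; exists g; first exact: lK.
by rewrite -hy.
Qed.

(** Close to [x], fibre sums become finite sums indexed by one fixed list; the continuity of
    convolutions rests on this. *)
Lemma fibre_sum_near (R : realType) K x (l : seq G) : compact K ->
  fin_in (@fibre G x) l -> (forall h, K h -> grng h = x -> h \in l) ->
  \forall y \near x, (forall g, g \in l -> sec_dom g y) /\
    forall F : G -> cplx R, (forall h, grng h = y -> ~ K h -> F h = 0) ->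
      csum (@fibre G y) F = \sum_(g <- l) F (sec g y).
Proof.
move=> cK [ul lx] lK.
have n1 := sections_distinct ul lx; have n2 := sections_cover cK lK.
have n3 : \forall y \near x, forall g, g \in l -> sec_dom g y.
  by apply: near_all => g gl; rewrite -(lx g gl); exact: near_sec_dom.
apply: filterS3 n1 n2 n3 => y d c s; split=> // F F0.
rewrite -(big_map (fun g => sec g y) xpredT F) (@csum_fin _ _ _ _ [seq sec g y | g <- l])//.
  split; first by rewrite map_inj_in_uniq.
  by move=> _ /mapP[g gl ->]; rewrite /fibre/= sec_range//; exact: s.
move=> h hy hl; apply: F0 => // Kh; move/negP: hl; apply; exact: c.
Qed.

(** The number of sections needed is locally constant, hence bounded over the compact range of [K];
    over the other units the empty list works. *)
Lemma fibre_count K : compact K -> exists N : nat, forall x,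
  exists2 l : seq G, fin_in (@fibre G x) l &
    (size l <= N)%N /\ forall h, K h -> grng h = x -> h \in l.
Proof.
move=> cK; have := compact_rng cK => /compact_near_coveringP crK.
pose P (N : nat) x := exists2 l : seq G, fin_in (@fibre G x) l &
    (size l <= N)%N /\ forall h, K h -> grng h = x -> h \in l.
have : \forall N \near \oo, @grng G @` K `<=` P N.
  apply: (@crK nat \oo P) => x _.
  have [l lx lK] := compact_fibre x cK; have [ul lx'] := lx.
  have n1 := sections_distinct ul lx'; have n2 := sections_cover cK lK.
  have n3 : \forall y \near x, forall g, g \in l -> sec_dom g y.
    by apply: near_all => g gl; rewrite -(lx' g gl); exact: near_sec_dom.
  exists ([set y | P (size l) y], [set N : nat | (size l <= N)%N]) => /=.
    split; last by exists (size l).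
    apply: filterS3 n1 n2 n3 => y d c s; exists [seq sec g y | g <- l].
      split; first by rewrite map_inj_in_uniq.
      by move=> _ /mapP[g gl ->]; rewrite /fibre/= sec_range//; exact: s.
    by split=> //; rewrite size_map.
  by move=> [y N] /= [[m my [sm mK]] lN]; exists m => //; split=> //; exact: leq_trans lN.
move=> [N _ /(_ N (leqnn N)) hN]; exists N => x.
have [[h [Kh hx]]|no] := pselect (exists h, K h /\ grng h = x).
  by apply: hN; exists h.
exists [::]; first exact: fin_in_nil.
by split=> // h Kh hx; case: no; exists h.
Qed.

Lemma bump (R : realType) x (V : set X) : nbhs x V ->
  exists psi : X -> R, [/\ continuous psi, forall y, 0 <= psi y <= 1,
    \forall y \near x, psi y = 1 &
    exists2 L, compact L & L `<=` V /\ forall y, ~ L y -> psi y = 0].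
Proof.
move=> nV; have [lcX hX _] := lc_units (etale_lc G).
have [K nK [cK clK]] : compact_near (nbhs x).
  by have := lcX x I; rewrite withinET.
have clB : closed (~` (K `&` V)°) by rewrite closedC; exact: open_interior.
have Bx : ~ (~` (K `&` V)°) x by apply; exact: filterI.
have /(@uniform_separatorP _ R)[k [ck k01 kx kB]] :
    uniform_separator [set x] (~` (K `&` V)°).
  exact: (@locally_compact_completely_regular _ R lcX hX).
have k0 y : 0 <= k y <= 1.
  by have : range k (k y) by [exists y]; move=> /k01; rewrite /= in_itv.
have kx0 : k x = 0 by apply: kx; exists x.
have kV y : ~ (K `&` V) y -> k y = 1.
  by move=> KVy; apply: kB; exists y => // /interior_subset.
(* Complete regularity only gives [k x = 0] at the point itself. The affine map makes [psi] equal to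
   1 where k < 1/3 and to 0 where k > 2/3, a region that contains the complement of [K] and of
   [V]. *)
pose psi y := Num.min 1 (Num.max 0 (2 - 3 * k y)).
have cpsi : continuous psi.
  move=> y; apply: (@continuous_min _ _ (cst 1) (fun y => Num.max 0 (2 - 3 * k y))).
    exact: cst_continuous.
  apply: (@continuous_max _ _ (cst 0) (fun y => 2 - 3 * k y)); first exact: cst_continuous.
  apply: continuousB; first exact: cst_continuous.
  by apply: continuousM; [exact: cst_continuous|exact: ck].
have ltk : \forall y \near x, k y < 1 / 3.
  by apply: (cvgr_lt _ (ck x)); rewrite kx0 divr_gt0.
exists psi; split=> //.
- by move=> y; rewrite /psi le_min ler01 le_max lexx ge_min lexx.
- apply: filterS ltk => y ky; rewrite /psi max_r; last by lra.
  by rewrite min_l//; lra.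
- exists (K `&` [set y | k y <= 2 / 3]).
    apply: (subclosed_compact _ cK); last by move=> y [].
    apply: closedI => //; apply: (@closed_comp _ _ k [set t | t <= 2 / 3]).
      by move=> y _; exact: ck.
    exact: closed_le.
  split=> [y [Ky /= ky]|y nLy].
    by apply: contrapT => Vy; move: ky; rewrite kV => [|[]//]; lra.
  rewrite /psi max_l ?min_r//; have [Ky|Ky] := pselect (K y).
    have : ~ (k y <= 2 / 3) by move=> ky; apply: nLy.
    by move/negP; rewrite -ltNge; lra.
  by rewrite kV => [|[]//]; lra.
Qed.

End LocalSections.

(** * The spectrum of [C0r] *)

Lemma initial_cvgP (S : choiceType) (T : topologicalType) (f : S -> T) (I : Type)
    (F : set_system I) {FF : Filter F} (u : I -> S) (s : S) :
  u @ F --> (s : initial_topology f) <-> (fun i => f (u i)) @ F --> f s.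
Proof.
split=> [us A nA|fus].
  exact: (us _ (@initial_continuous _ _ f s A nA)).
move=> A /=; rewrite nbhsE => -[B [[C oC <-] Cs] BA].
have : \forall i \near F, C (f (u i)) by apply: fus; exact: open_nbhs_nbhs.
by apply: filterS => i Ci; exact: BA.
Qed.

Lemma sub_cvgP (T : topologicalType) (A : set T) (I : Type)
    (F : set_system I) {FF : Filter F} (u : I -> set_type A) (s : set_type A) :
  u @ F --> s <-> (fun i => set_val (u i)) @ F --> set_val s.
Proof. exact: initial_cvgP. Qed.

Lemma prod_topology_cvgP (J : choiceType) (T : J -> topologicalType) (I : Type)
    (F : set_system I) {FF : Filter F} (u : I -> prod_topology T) (s : prod_topology T) :
  u @ F --> s <-> forall j, (fun i => u i j) @ F --> s j.
Proof.
split=> [us j|us].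
  by move: us => /cvg_sup/(_ j)/(initial_cvgP (fun s : prod_topology T => s j)).
by apply/cvg_sup => j; apply/(initial_cvgP (fun s : prod_topology T => s j)).
Qed.

Lemma compact_bound (R : realType) (T : topologicalType) (K : set T) (f : T -> cplx R) :
  {within K, continuous f} -> compact K -> exists M : R, forall x, K x -> cnorm (f x) <= M.
Proof.
move=> cf cK; have cK' := continuous_compact cf cK.
move: cK' => /compact_near_coveringP cfK.
have := cfK nat \oo (fun n z => cnorm z <= n%:R :> R) _; case.
  move=> z _; pose n := (Num.trunc (cnorm z + 1)).+1.
  have nz : cnorm z + 1 < n%:R by rewrite truncnS_gt.
  exists ([set w | cnorm (w - z) < 1], [set m | (n <= m)%N]) => /=.
    split; last by exists n.
    exact: ((cvg_cnormP id z).1 (@cvg_id _ (nbhs z)) 1 ltr01).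
  move=> [w m] /= [wz nm].
  apply: le_trans (_ : n%:R <= _); last by rewrite ler_nat.
  apply: le_trans (ltW nz); have := cnorm_triangle (w - z) z; rewrite subrK addrC.
  by move=> /le_trans; apply; rewrite lerD2l ltW.
by move=> n _ /(_ n (leqnn n)) h; exists n%:R => x Kx; apply: h; exists x.
Qed.

Lemma ultra_cluster_cvg (I : Type) (T : topologicalType) (F : set_system I)
    {FF : UltraFilter F} (u : I -> T) (l : T) : cluster (u @ F) l -> u @ F --> l.
Proof.
move=> cl U nU; have [//|nFU] := in_ultra_setVsetC (u @^-1` U) FF.
by have [x [nUx Ux]] := cl (~` U) U nFU nU.
Qed.

Lemma ultra_bounded_cvg (R : realType) (I : Type) (F : set_system I)
    {FF : UltraFilter F} (u : I -> cplx R) (M : R) :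
  (forall i, cnorm (u i) <= M) -> exists l : cplx R, u @ F --> l.
Proof.
move=> uM.
have ex (v : I -> R) : (forall i, `|v i| <= M) -> exists l : R, v @ F --> l.
  move=> vM; have vF : F (v @^-1` `[- M, M]).
    by apply: filterE => i; rewrite /= in_itv /= -ler_norml.
  have [l [_ vl]] := @segment_compact R (- M) M (v @ F) _ vF.
  by exists l; exact: ultra_cluster_cvg.
have [a ca] := ex (fun i => complex.Re (u i)) (fun i => le_trans (Re_le_cnorm _) (uM i)).
have [b cb] := ex (fun i => complex.Im (u i)) (fun i => le_trans (Im_le_cnorm _) (uM i)).
by exists (Complex a b); exact: cvg_ReIm.
Qed.

Lemma C0r_zero (R : realType) (G : groupoid_data) : C0r (0 : G -> cplx R).
Proof.
have b0 : Cb (0 : G -> cplx R).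
  by split; [exact: cst_continuous|exists 0 => x; rewrite cnorm0].
split=> // e e0; exists 0, set0; split=> //; first exact: compact0.
  have -> : supp (0 : G -> cplx R) = set0; last by [].
  rewrite /supp; have -> : [set x | (0 : G -> cplx R) x != 0] = set0.
    by apply/seteqP; split => x //=; rewrite eqxx.
  by rewrite closure0.
by move=> g; rewrite subrr cnorm0 ltW.
Qed.

Lemma cvg_cplx_real (R : realType) (I : Type) (F : set_system I) {FF : Filter F}
    (u : I -> R) (l : R) :
  u @ F --> l -> (fun i => Complex (u i) 0 : cplx R) @ F --> (Complex l 0 : cplx R).
Proof.
move=> ul; apply: (@cvg_comp _ _ _ u (fun x : R => Complex x 0 : cplx R) _ _ _ ul).
exact: (@real_cplx_continuous R l).
Qed.

Lemma cvg_inverse (K : numFieldType) (I : Type) (F : set_system I) {FF : Filter F}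
    (u : I -> K) (l : K) :
  l != 0 -> u @ F --> l -> (fun i => (u i)^-1) @ F --> l^-1.
Proof. by move=> l0 ul; exact: (cvgV l0 ul). Qed.

Section SpectrumOfC0r.
Context {R : realType} {G : etale_groupoid}.
Local Notation C := (cplx R).
Local Notation X := (units G).
Local Notation B := (beta R G).
Implicit Types (f h : G -> C) (z : B) (x : X) (g : G).

Lemma C0r_comp_rng (k : X -> C) : C0 k -> C0r (k \o @grng G).
Proof.
move=> [ck k0].
have ckr : continuous (k \o @grng G).
  by move=> g; apply: continuous_comp; [exact: (grng_continuous (etale_lc G))|exact: ck].
have [M kM] : exists M : R, forall x, cnorm (k x) <= M.
  have [K cK hK] := k0 1 ltr01.
  have [M hM] := compact_bound (continuous_subspaceT ck) cK.
  exists (Num.max M 1) => x; rewrite le_max.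
  by have [/hM ->//|/hK ->] := pselect (K x); rewrite orbT.
split; first by split=> //; exists M => g; exact: kM.
move=> e e0; have [K cK hK] := k0 _ e0.
(* The factor [t] vanishes where |k| <= e and equals (|k| - e)/|k| elsewhere, so that multiplying
   [k] by it moves [k] by at most [e]. The denominator avoids zeros of [k]. *)
pose t x : R := Num.max 0 (cnorm (k x) - e) / Num.max (cnorm (k x)) e.
have m0 x : 0 < Num.max (cnorm (k x)) e by rewrite lt_max e0 orbT.
have ct : continuous t.
  move=> x; have cn : cnorm \o k @ x --> cnorm (k x) by apply: cvg_cnorm; exact: ck.
  apply: cvgM.
    apply: (@continuous_max _ _ (cst 0) (fun y => cnorm (k y) - e)); first exact: cst_continuous.
    by apply: cvgB => //; exact: cvg_cst.
  apply: cvg_inverse; first by rewrite gt_eqF.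
  apply: (@continuous_max _ _ (fun y => cnorm (k y)) (cst e)) => //; exact: cst_continuous.
have t0 x : 0 <= t x by apply: divr_ge0; [rewrite le_max lexx|exact: ltW].
have t1 x : t x <= 1.
  rewrite ler_pdivrMr// mul1r ge_max !le_max cnorm_ge0 /=.
  by rewrite lerBlDr lerDl (ltW e0).
exists (fun g => k (grng g) * (Complex (t (grng g)) 0 : C)), K; split.
- split.
    move=> g; apply: cvgM; first exact: ckr.
    apply: cvg_cplx_real; apply: (@continuous_comp _ _ _ (@grng G) t); last exact: ct.
    exact: (grng_continuous (etale_lc G)).
  exists M => g; rewrite cnormM cnorm_real ger0_norm//.
  by apply: le_trans (ler_pM (cnorm_ge0 _) (t0 _) (kM _) (t1 _)) _; rewrite mulr1.
- exact: cK.
- have clK : closed (@grng G @^-1` K).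
    apply: preimage_closed; last exact: compact_closed (hausdorff_units) cK.
    by move=> y _; exact: (grng_continuous (etale_lc G)).
  rewrite [X in _ `<=` X](closure_id _).1 //; apply: closureS => g /=.
  apply: contra_neqP => nK; rewrite /t; have := hK _ nK => ke.
  by rewrite max_l ?mul0r ?mulr0// subr_le0.
- move=> g; rewrite -[X in X - _]mulr1 -mulrBr cnormM.
  have -> : 1 - Complex (t (grng g)) 0 = Complex (1 - t (grng g)) 0 :> C.
    by rewrite -[LHS]/(Complex (1 - t (grng g)) (0 - 0)) subr0.
  rewrite cnorm_real ger0_norm ?subr_ge0// /t; set a := cnorm (k (grng g)).
  have [ae|ea] := leP a e.
    by rewrite max_l ?mul0r ?subr0 ?mulr1// subr_le0.
  have ea0 : 0 <= a - e by rewrite subr_ge0 ltW.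
  rewrite (max_r ea0) -[leRHS](_ : a * (1 - (a - e) / a) = e)//.
  by field; rewrite gt_eqF// (lt_trans e0).
Qed.

Lemma C0_bump (psi : X -> R) (L : set X) : continuous psi -> compact L ->
  (forall x, ~ L x -> psi x = 0) -> C0 (fun x => Complex (psi x) 0 : C).
Proof.
move=> cpsi cL psi0; split.
  by move=> x; apply: cvg_cplx_real; exact: cpsi.
by move=> e e0; exists L => // x /psi0 ->; rewrite cnorm0 ltW.
Qed.

Lemma bump_C0 x (V : set X) : nbhs x V -> exists k : X -> C,
  [/\ C0 k, \forall y \near x, k y = 1 & forall y, ~ V y -> k y = 0].
Proof.
move=> /(bump R)[psi [cpsi p01 p1 [L cL [LV pL]]]].
exists (fun x => Complex (psi x) 0); split.
- exact: C0_bump pL.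
- by apply: filterS p1 => y ->.
- by move=> y Vy; rewrite pL// => /LV.
Qed.

Lemma beta_evalN z f : ~ C0r f -> beta_eval z f = 0.
Proof. exact: (character_out (beta_character z)). Qed.

Lemma beta_evalD z f h : C0r f -> C0r h ->
  beta_eval z (f + h) = beta_eval z f + beta_eval z h.
Proof. exact: (characterD (beta_character z)). Qed.

Lemma beta_evalZ z (c : C) f : C0r f ->
  beta_eval z (fun g => c * f g) = c * beta_eval z f.
Proof. exact: (characterZ (beta_character z)). Qed.

Lemma beta_evalM z f h : C0r f -> C0r h ->
  beta_eval z (f * h) = beta_eval z f * beta_eval z h.
Proof. exact: (characterM (beta_character z)). Qed.

Lemma beta_eval_conj z f : C0r f ->
  beta_eval z (fun g => Num.conj (f g)) = Num.conj (beta_eval z f).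
Proof. exact: (character_conj (beta_character z)). Qed.

Lemma beta_eval_emb g f : C0r f -> beta_eval (beta_emb R g) f = f g.
Proof. exact: evaluationE. Qed.

Lemma beta_cvgP (I : Type) (F : set_system I) {FF : Filter F} (u : I -> B) z :
  u @ F --> z <->
  forall f, C0r f -> (fun i => beta_eval (u i) f) @ F --> beta_eval z f.
Proof.
split=> [uz f _|uz].
  by move: uz => /sub_cvgP/(@prod_topology_cvgP _ (fun=> C))/(_ f).
apply/sub_cvgP/(@prod_topology_cvgP _ (fun=> C)) => f.
have [Cf|Cf] := pselect (C0r f); first exact: uz.
rewrite -[X in _ --> X]/(beta_eval z f) beta_evalN//.
have -> : (fun i => set_val (u i) f) = cst 0.
  by apply/funext => i; exact: beta_evalN.
exact: cvg_cst.
Qed.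

Lemma beta_ext z z' : (forall f, C0r f -> beta_eval z f = beta_eval z' f) -> z = z'.
Proof.
move=> h; apply: val_inj; apply/funext => f.
have [Cf|Cf] := pselect (C0r f); first exact: h.
by rewrite -[LHS]/(beta_eval z f) -[RHS]/(beta_eval z' f) !beta_evalN.
Qed.

Lemma beta_hausdorff : hausdorff_space B.
Proof.
move=> z z' cl; apply: beta_ext => f Cf; apply: (@cplx_hausdorff R) => U V nU nV.
have c1 : (fun w : B => beta_eval w f) @ z --> beta_eval z f.
  by have /beta_cvgP := @cvg_id _ (nbhs z); apply.
have c2 : (fun w : B => beta_eval w f) @ z' --> beta_eval z' f.
  by have /beta_cvgP := @cvg_id _ (nbhs z'); apply.
by have [w [Uw Vw]] := cl _ _ (c1 _ nU) (c2 _ nV); exists (beta_eval w f).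
Qed.

(* If [a - z(a)] were invertible in [C_b(G)], every [f] in [C_0(G, r)] would be
   a multiple of it in [C_0(G, r)], and [z] would vanish. *)
Lemma character_not_invertible z a (d : R) : C0r a -> 0 < d ->
  (forall g, d <= cnorm (a g - beta_eval z a)) -> False.
Proof.
move=> Ca d0 hd; have [f0 Cf /eqP zf] := character_neq0 (beta_character z); apply: zf.
rewrite -/(beta_eval z f0); set c := beta_eval z a in hd *.
have nz g : a g - c != 0.
  by apply/eqP => e; move: (hd g); rewrite e cnorm0 leNgt d0.
have bb : Cb (fun g => (a g - c)^-1).
  split.
    move=> g; apply: cvg_inverse; first exact: nz.
    by apply: cvgB; [exact: Ca.1.1|exact: cvg_cst].
  by exists d^-1 => g; rewrite cnormV lef_pV2 ?posrE// (lt_le_trans d0).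
have Ck : C0r (f0 * (fun g => (a g - c)^-1)) by exact: C0r_mulr.
set k := f0 * _ in Ck.
have : f0 = k * a + (fun g => (- c) * k g).
  apply/funext => g; rewrite -[RHS]/(k g * a g + (- c) * k g) mulrC -mulrDl.
  by rewrite mulrC -[k g]/(f0 g * (a g - c)^-1) mulfVK.
move=> ->; rewrite (beta_evalD z (C0r_mulr Ck Ca.1) (C0r_scale (- c) Ck)).
by rewrite (beta_evalM z Ck Ca) (beta_evalZ z (- c) Ck) -/c; ring.
Qed.

(** If |z(f)| exceeded M, the function f - z(f) would be bounded away from zero by |z(f)| - M. *)
Lemma beta_eval_le z f (M : R) : C0r f -> (forall g, cnorm (f g) <= M) ->
  cnorm (beta_eval z f) <= M.
Proof.
move=> Cf fM; rewrite leNgt; apply/negP => Mz.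
apply: (@character_not_invertible z f (cnorm (beta_eval z f) - M)) => //.
  by rewrite subr_gt0.
move=> g; rewrite lerBlDr.
have := cnorm_triangle (beta_eval z f - f g) (f g); rewrite subrK cnorm_dist.
by move=> /le_trans; apply; rewrite lerD2l.
Qed.

(** With c = z(f), the term |f - c|^2 need not lie in [C0r] because of the constant |c|^2. The
    element [a] omits these constants, and subtracting z(a) restores them. *)
Let sum_of_squares z (l : seq (G -> C)) : (forall f, List.In f l -> C0r f) ->
  exists2 a, C0r a & forall g, a g - beta_eval z a =
    Complex (\sum_(f <- l) cnorm (f g - beta_eval z f) ^+ 2) 0.
Proof.
elim: l => [_|f l ih Cl].
  exists 0; first exact: C0r_zero.
  move=> g; rewrite big_nil.
  have e : (0 : G -> C) = fun g => 0 * (0 : G -> C) g by apply/funext => k; rewrite mul0r.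
  by rewrite e beta_evalZ ?mul0r ?subrr//; exact: C0r_zero.
have [|a Ca ha] := ih; first by move=> h hl; apply: Cl; right.
have Cf : C0r f by apply: Cl; left.
have Cf' := C0r_conj Cf; set c := beta_eval z f.
pose f1 := f * (fun g => Num.conj (f g)).
pose f2 g := - c * Num.conj (f g); pose f3 g := - Num.conj c * f g.
have C1 : C0r f1 by exact: C0r_mulr Cf'.1.
have C2 : C0r f2 by exact: C0r_scale.
have C3 : C0r f3 by exact: C0r_scale.
have C23 := C0r_add C2 C3; have C123 := C0r_add C1 C23.
exists (a + (f1 + (f2 + f3))); first exact: C0r_add.
move=> g; rewrite big_cons (beta_evalD z Ca C123) (beta_evalD z C1 C23) (beta_evalD z C2 C3).
rewrite (beta_evalM z Cf Cf') (beta_evalZ z (- c) Cf') (beta_evalZ z (- Num.conj c) Cf).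
rewrite (beta_eval_conj z Cf) -/c.
rewrite -[(a + _) g]/(a g + (f g * Num.conj (f g) + (- c * Num.conj (f g) + - Num.conj c * f g))).
have -> : Complex (cnorm (f g - c) ^+ 2 + \sum_(j <- l) cnorm (j g - beta_eval z j) ^+ 2) 0
  = Complex (cnorm (f g - c) ^+ 2) 0 + (a g - beta_eval z a) :> C.
  by rewrite ha -[RHS]/(Complex (_ + _) (0 + 0)) addr0.
by rewrite sqr_cnorm rmorphB /=; ring.
Qed.

(** The traces on [G] of the basic neighbourhoods of [z]. That this filter is proper is the density
    of the arrows in [beta]. *)
Definition beta_filter z : set_system G :=
  filter_from [set p : seq (G -> C) * R | (forall f, List.In f p.1 -> C0r f) /\ 0 < p.2]
    (fun p => [set g | forall f, List.In f p.1 -> cnorm (f g - beta_eval z f) < p.2]).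

Global Instance beta_filter_proper z : ProperFilter (beta_filter z).
Proof.
apply: filter_from_proper.
  apply: filter_from_filter; first by exists ([::], 1).
  move=> [l d] [m e] /= [Cl d0] [Cm e0]; exists (l ++ m, Num.min d e) => /=.
    split; last by rewrite lt_min d0.
    by move=> f /(@List.in_app_or _ _ _ _)[/Cl|/Cm].
  move=> g /= h; split=> f fl; have := h f (List.in_or_app _ _ _ _); rewrite lt_min.
    by move=> /(_ (or_introl fl))/andP[].
  by move=> /(_ (or_intror fl))/andP[].
move=> [l e] /= [Cl e0]; apply: contrapT => no.
have [a Ca ha] := sum_of_squares z Cl.
(* If no arrow satisfies all the inequalities, one of the squares is at least e^2 at each arrow, and
   so is their sum. *)
apply: (@character_not_invertible z a (e ^+ 2)) => //; first exact: exprn_gt0.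
move=> g; rewrite ha cnorm_real ger0_norm ?sumr_ge0//; last by move=> *; exact: sqr_ge0.
have [f [fl ef]] : exists f, List.In f l /\ e <= cnorm (f g - beta_eval z f).
  apply: contrapT => h; apply: no; exists g => f fl; rewrite ltNge; apply/negP => ef.
  by apply: h; exists f.
apply: le_trans (_ : cnorm (f g - beta_eval z f) ^+ 2 <= _).
  by rewrite ler_sqr ?nnegrE ?cnorm_ge0// ltW.
elim: (l) fl => //= h m ih [->|/ih {}ih]; rewrite big_cons.
  by rewrite lerDl sumr_ge0// => *; exact: sqr_ge0.
by apply: le_trans ih _; rewrite lerDr sqr_ge0.
Qed.

Lemma beta_filter_cvg z f : C0r f -> f @ beta_filter z --> beta_eval z f.
Proof.
move=> Cf; apply/cvg_cnormP => e e0; exists ([:: f], e) => /=.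
  by split=> // h [<-|].
by move=> g /(_ f (or_introl erefl)).
Qed.

Arguments beta_filter_cvg z {f}.

Lemma beta_emb_cvg z : @beta_emb R G @ beta_filter z --> z.
Proof.
apply/beta_cvgP => f Cf.
have -> : (fun g => beta_eval (beta_emb R g) f) = f.
  by apply/funext => g; exact: beta_eval_emb.
exact: beta_filter_cvg.
Qed.

Arguments beta_emb_cvg z : clear implicits.

Lemma beta_emb_continuous : continuous (@beta_emb R G).
Proof.
move=> g; apply/beta_cvgP => f Cf; rewrite beta_eval_emb//.
have -> : (fun g => beta_eval (beta_emb R g) f) = f.
  by apply/funext => h; exact: beta_eval_emb.
exact: Cf.1.1.
Qed.

Lemma cvg_beta_emb (I : Type) (F : set_system I) {FF : Filter F} (u : I -> G) g :
  u @ F --> g -> (fun i => beta_emb R (u i)) @ F --> beta_emb R g.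
Proof. by move=> ug; apply: cvg_comp ug _; exact: beta_emb_continuous. Qed.

Lemma beta_eval_near_eq z f h : C0r f -> C0r h ->
  (\forall g \near beta_filter z, f g = h g) -> beta_eval z f = beta_eval z h.
Proof.
move=> Cf Ch; apply: (@cvg_near_eq _ _ (beta_filter z) _ f h _ _ (@cplx_hausdorff R)).
  exact: beta_filter_cvg.
exact: beta_filter_cvg.
Qed.

(** The existence of the base point is what has to be shown. Along the filter of [z] the function
    [f0] stays away from zero, so the ranges lie in a compact set, and any cluster point of them
    serves. *)
Lemma beta_qP z (k : X -> C) : C0 k -> beta_eval z (k \o @grng G) = k (beta_q z).
Proof.
move: k; suff [x hx] : exists x, forall k : X -> C, C0 k -> beta_eval z (k \o @grng G) = k x.
  by rewrite /beta_q; case: xgetP => [y _ hy //|/(_ x) []].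
have [f0 Cf zf] := character_neq0 (beta_character z); rewrite -/(beta_eval z f0) in zf.
have z2 : 0 < cnorm (beta_eval z f0) / 2 by rewrite divr_gt0// cnorm_gt0.
have [h [K [_ cK hK fh]]] := Cf.2 _ z2.
have rK : (@grng G @ beta_filter z) K.
  have lt : cnorm (beta_eval z f0) / 2 < cnorm (beta_eval z f0).
    by rewrite [ltRHS]splitr ltrDl.
  have : \forall g \near beta_filter z, cnorm (beta_eval z f0) / 2 < cnorm (f0 g).
    exact: cnorm_lt_near (beta_filter_cvg z Cf) lt.
  apply: filterS => g hg.
  apply: hK; apply: subset_closure => /=; apply/eqP => h0.
  by move: (fh g); rewrite h0 subr0 leNgt hg.
have [x [_ cx]] := cK _ _ rK.
exists x => k Ck; apply: (@cplx_hausdorff R) => U V nU nV.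
have h1 : beta_filter z ((k \o @grng G) @^-1` U) := beta_filter_cvg z (C0r_comp_rng Ck) U nU.
have h2 : (@grng G @ beta_filter z) (k @^-1` U).
  exact: h1.
by have [y [Uy Vy]] := cx _ _ h2 (Ck.1 x _ nV); exists (k y).
Qed.

Lemma C0_separates x y : (forall k : X -> C, C0 k -> k x = k y) -> x = y.
Proof.
move=> h; apply: contrapT => xy.
have n1 : \forall w \near x, w <> y.
  exact: (near_neq hausdorff_units (@cvg_id _ (nbhs x)) (cvg_cst y) xy).
have [k [Ck k1 k0]] := bump_C0 n1.
have := h k Ck; rewrite (nbhs_singleton k1) k0 => [/eqP|//].
by rewrite oner_eq0.
Qed.

Lemma beta_q_emb g : beta_q (beta_emb R g) = grng g.
Proof.
apply: C0_separates => k Ck; rewrite -beta_qP// beta_eval_emb//.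
exact: C0r_comp_rng.
Qed.

Lemma cvg_beta_q (I : Type) (F : set_system I) {FF : Filter F} (u : I -> B) z :
  u @ F --> z -> (fun i => beta_q (u i)) @ F --> beta_q z.
Proof.
(* A function equal to 1 at [beta_q z] and vanishing off [V] detects membership in [V], and its
   values along [u] converge. *)
move=> uz V nV; have [k [Ck k1 k0]] := bump_C0 nV.
have : (fun i => k (beta_q (u i))) @ F --> (1 : C).
  rewrite -(nbhs_singleton k1) -beta_qP//.
  have -> : (fun i => k (beta_q (u i))) = fun i => beta_eval (u i) (k \o @grng G).
    by apply/funext => i; rewrite beta_qP.
  by have /beta_cvgP := uz; apply; exact: C0r_comp_rng.
move=> ku; have : \forall i \near F, 0 < cnorm (k (beta_q (u i))).
  by apply: cnorm_lt_near ku _; rewrite cnorm1.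
apply: filterS => i ki.
by apply: contrapT => /k0 e; move: ki; rewrite e cnorm0 ltxx.
Qed.

Lemma cvg_rng_beta_filter z : @grng G @ beta_filter z --> beta_q z.
Proof.
have e : @grng G = fun g => beta_q (beta_emb R g).
  by apply/funext => g; rewrite beta_q_emb.
by rewrite e; exact: cvg_beta_q (beta_emb_cvg z).
Qed.

(** The pointwise limit satisfies all the identities of a character; only its nonvanishing has to be
    assumed, which excludes that the points escape over infinity in the unit space. *)
Lemma beta_limit (I : Type) (F : set_system I) {FF : ProperFilter F} (u : I -> B) :
  (forall f, C0r f -> exists l : C, (fun i => beta_eval (u i) f) @ F --> l) ->
  (exists f, exists l : C, [/\ C0r f, l != 0 & (fun i => beta_eval (u i) f) @ F --> l]) ->
  exists z, u @ F --> z.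
Proof.
move=> ex [f0 [l0 [Cf0 l00 fl0]]].
pose w f : C := if pselect (C0r f) is left Cf then projT1 (cid (ex f Cf)) else 0.
have wP f : C0r f -> (fun i => beta_eval (u i) f) @ F --> w f.
  move=> Cf; rewrite /w; case: pselect => [Cf'|nCf]; last by case: (nCf Cf).
  exact: (projT2 (cid (ex f Cf'))).
have uniq f l : C0r f -> (fun i => beta_eval (u i) f) @ F --> l -> w f = l.
  move=> Cf h; exact: (@cvg_unique _ (@cplx_hausdorff R) _ _ _ _ (wP f Cf) h).
have cw : is_character w.
  split.
  - by move=> f Cf; rewrite /w; case: pselect.
  - move=> f h Cf Ch; apply: uniq; first exact: C0r_add.
    have -> : (fun i => beta_eval (u i) (f + h)) =
              (fun i => beta_eval (u i) f + beta_eval (u i) h).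
      by apply/funext => i; rewrite beta_evalD.
    by apply: cvgD; exact: wP.
  - move=> c f Cf; apply: uniq; first exact: C0r_scale.
    have -> : (fun i => beta_eval (u i) (fun g => c * f g)) =
              (fun i => c * beta_eval (u i) f).
      by apply/funext => i; rewrite beta_evalZ.
    by apply: cvgM; [exact: cvg_cst|exact: wP].
  - move=> f h Cf Ch; apply: uniq; first exact: C0r_mulr Ch.1.
    have -> : (fun i => beta_eval (u i) (f * h)) =
              (fun i => beta_eval (u i) f * beta_eval (u i) h).
      by apply/funext => i; rewrite beta_evalM.
    by apply: cvgM; exact: wP.
  - move=> f Cf; apply: uniq; first exact: C0r_conj.
    have -> : (fun i => beta_eval (u i) (fun g => Num.conj (f g))) =
              (fun i => Num.conj (beta_eval (u i) f)).
      by apply/funext => i; rewrite beta_eval_conj.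
    by apply: cvg_comp (wP f Cf) _; exact: conj_continuous.
  - by exists f0 => //; rewrite (uniq f0 l0).
exists (exist _ w (mem_set cw)); apply/beta_cvgP => f Cf; exact: wP.
Qed.

(** This is the properness of [beta_q]. Along an ultrafilter all bounded values converge, and a bump
    at the limit of the base points ensures a nonzero limit. *)
Lemma compact_beta_q (K : set X) : compact K -> compact [set z : B | K (beta_q z)].
Proof.
move=> cK; rewrite compact_ultra => F FU FK.
have UP : ProperFilter F by case: FU.
have [x [Kx /ultra_cluster_cvg qx]] := cK (@beta_q R G @ F) _ FK.
have [z Fz] : exists z, id @ F --> z.
  apply: beta_limit.
    move=> f Cf; have [_ [M fM]] := Cf.1.
    by apply: (@ultra_bounded_cvg _ _ _ _ _ M) => z; exact: beta_eval_le.
  have [k [Ck k1 _]] := bump_C0 (@filterT _ (nbhs x) _).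
  exists (k \o @grng G), 1; split; [exact: C0r_comp_rng|exact: oner_neq0|].
  have h : \forall z \near F, beta_eval z (k \o @grng G) = 1.
    have h : \forall z \near F, k (beta_q z) = 1 := qx _ k1.
    by apply: filterS h => z; rewrite beta_qP.
  by apply/cvg_cnormP => e e0; apply: filterS h => z ->; rewrite subrr cnorm0.
have qz : @beta_q R G @ F --> beta_q z by exact: cvg_beta_q Fz.
exists z; split; last exact: Fz.
by rewrite /= (cvg_unique hausdorff_units qz qx).
Qed.

End SpectrumOfC0r.

(** * The action of [G] on its fibrewise compactification *)

Section SemidirectSpace.
Context {R : realType} {G : etale_groupoid}.
Local Notation C := (cplx R).
Local Notation X := (units G).
Local Notation B := (beta R G).
Local Notation SD := (semidirect R G).
Implicit Types (z : B) (x : X) (g h : G) (p : SD).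

Definition sd_pt p : B := (set_val p).1.
Definition sd_arr p : G := (set_val p).2.

Definition mk_sd z g (e : beta_q z = grng g) : SD := exist _ (z, g) (mem_set e).

(* Functions on the semidirect product are handled as functions of pairs,
   with value [0] on the pairs [(z, g)] such that [beta_q z != grng g]. *)
Definition ev (f : SD -> C) z g : C := oapp f 0 (insub (z, g)).

Lemma sdP p : beta_q (sd_pt p) = grng (sd_arr p).
Proof. exact: (set_valP p). Qed.

Lemma ev_mk (f : SD -> C) z g (e : beta_q z = grng g) : ev f z g = f (mk_sd e).
Proof.
rewrite /ev; case: insubP => [p _ pv|/negP[]]; last exact: mem_set.
by congr f; apply: val_inj; rewrite pv.
Qed.

Lemma ev_val (f : SD -> C) p : ev f (sd_pt p) (sd_arr p) = f p.
Proof. by rewrite (ev_mk _ (sdP p)); congr f; apply: val_inj; case: p => -[]. Qed.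

Lemma ev_out (f : SD -> C) z g : beta_q z <> grng g -> ev f z g = 0.
Proof. by move=> ne; rewrite /ev insubF//; apply/negP => /set_mem. Qed.

Lemma ev_fun (Phi : B -> G -> C) z g : beta_q z = grng g ->
  ev (fun p => Phi (sd_pt p) (sd_arr p)) z g = Phi z g.
Proof. by move=> e; rewrite (ev_mk _ e). Qed.

Lemma sd_cvgP (I : Type) (F : set_system I) {FF : Filter F} (u : I -> SD) p :
  u @ F --> p <->
  (fun i => sd_pt (u i)) @ F --> sd_pt p /\ (fun i => sd_arr (u i)) @ F --> sd_arr p.
Proof.
split=> [/(@sub_cvgP _ (@sd_arrows R G)) h|[h k]].
  by split; [exact: cvg_comp h (@cvg_fst _ _ _ _ _)|exact: cvg_comp h (@cvg_snd _ _ _ _ _)].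
apply/(@sub_cvgP _ (@sd_arrows R G)).
have -> : (fun i => set_val (u i)) = fun i => (sd_pt (u i), sd_arr (u i)).
  by apply/funext => i; rewrite /sd_pt /sd_arr; case: (set_val (u i)).
have -> : set_val p = (sd_pt p, sd_arr p) by rewrite /sd_pt /sd_arr; case: (set_val p).
exact: (cvg_pair h k).
Qed.

(** Continuity on the fibre product for functions that are total on pairs, which keeps proofs of
    membership out of the formulas. *)
Definition sd_cont (Phi : B -> G -> C) : Prop :=
  forall (I : Type) (F : set_system I) (FF : Filter F) (u : I -> B) (v : I -> G) z g,
    beta_q z = grng g -> u @ F --> z -> v @ F --> g ->
    (\forall i \near F, beta_q (u i) = grng (v i)) ->
    (fun i => Phi (u i) (v i)) @ F --> Phi z g.

Lemma continuous_sd_cont (f : SD -> C) : continuous f -> sd_cont (ev f).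
Proof.
move=> cf I F FF u v z g e uz vg uv; rewrite (ev_mk f e).
(* Where the pair is not an arrow of the semidirect product, the limit itself serves as default
   value. *)
pose w i : SD := if pselect (beta_q (u i) = grng (v i)) is left ei
  then mk_sd ei else mk_sd e.
have wv : \forall i \near F, u i = sd_pt (w i) /\ v i = sd_arr (w i).
  by apply: filterS uv => i ei; rewrite /w; case: pselect.
have wp : w @ F --> mk_sd e.
  apply: (@sd_cvgP I F FF w (mk_sd e)).2; split.
    by apply: cvg_congr uz; apply: filterS wv => i [].
  by apply: cvg_congr vg; apply: filterS wv => i [].
have fw : (fun i => f (w i)) @ F --> f (mk_sd e).
  by apply: cvg_comp wp _; exact: cf.
apply: cvg_congr fw.
by apply: filterS wv => i [-> ->]; rewrite ev_val.
Qed.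

Lemma sd_cont_continuous (Phi : B -> G -> C) : sd_cont Phi ->
  continuous (fun p : SD => Phi (sd_pt p) (sd_arr p)).
Proof.
move=> cP p; have [h k] := (sd_cvgP id p).1 (@cvg_id _ (nbhs p)).
apply: (cP _ (nbhs p) _ _ _ _ _ (sdP p) h k).
by apply: filterE => i; exact: sdP.
Qed.

Lemma compact_sd (K : set G) : compact K -> compact [set p : SD | K (sd_arr p)].
Proof.
move=> cK; rewrite compact_ultra => F FU FK.
have UP : ProperFilter F by case: FU.
have [g [Kg /ultra_cluster_cvg gF]] := cK (sd_arr @ F) _ FK.
have FK' : F [set p | (@grng G @` K) (beta_q (sd_pt p))].
  by apply: filterS FK => p Kp; exists (sd_arr p) => //; rewrite sdP.
have [z [_ /ultra_cluster_cvg zF]] :=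
  @compact_beta_q R G _ (compact_rng cK) (sd_pt @ F) _ FK'.
have e : beta_q z = grng g.
  apply: (@cvg_unique _ hausdorff_units (beta_q @ (sd_pt @ F))).
    exact: cvg_beta_q zF.
  have -> : beta_q @ (sd_pt @ F) = (fun p => grng (sd_arr p)) @ F.
    by apply/seteqP; split=> A; rewrite /= /nbhs /=; apply: filterS => p /=; rewrite sdP.
  exact: cvg_rng gF.
by exists (mk_sd e); split=> //=; apply: (@sd_cvgP _ F _ id (mk_sd e)).2.
Qed.

Lemma closed_sd_arr (K : set G) : closed K -> closed [set p : SD | K (sd_arr p)].
Proof.
move=> cK; apply: closed_comp => // p _.
by have [] := (sd_cvgP id p).1 (@cvg_id _ (nbhs p)).
Qed.

Lemma Cc_sd (Phi : B -> G -> C) (K : set G) : compact K -> sd_cont Phi ->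
  (forall z g, beta_q z = grng g -> ~ K g -> Phi z g = 0) ->
  Cc (fun p : SD => Phi (sd_pt p) (sd_arr p)).
Proof.
move=> cK cP PK; split; first exact: sd_cont_continuous.
apply: (subclosed_compact (@closed_closure _ _) (compact_sd cK)).
have clK := closed_sd_arr (compact_closed hausdorff_arrows cK).
rewrite [X in _ `<=` X](closure_id _).1//; apply: closureS => p /=.
by apply: contra_neqP => nK; apply: PK => //; exact: sdP.
Qed.

Lemma Cc_sd_supp (f : SD -> C) : Cc f -> exists2 K : set G, compact K &
  forall z g, ~ K g -> ev f z g = 0.
Proof.
move=> [_ cs]; exists (sd_arr @` supp f).
  apply: continuous_compact => //; apply: continuous_subspaceT => p.
  by have [] := (sd_cvgP id p).1 (@cvg_id _ (nbhs p)).
move=> z g nK; have [e|/ev_out//] := pselect (beta_q z = grng g).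
rewrite (ev_mk _ e); apply: contrapT => /eqP ne; apply: nK.
by exists (mk_sd e) => //; exact: subset_closure.
Qed.

Lemma Cc_bound (T : topologicalType) (f : T -> C) : Cc f ->
  exists2 M : R, 0 <= M & forall x : T, cnorm (f x) <= M.
Proof.
move=> [cf cs]; have [M hM] := compact_bound (continuous_subspaceT cf) cs.
exists (Num.max M 0) => [|x]; first by rewrite le_max lexx orbT.
rewrite le_max; have [-> |fx] := eqVneq (f x) 0; first by rewrite cnorm0 lexx orbT.
by rewrite hM//; exact: subset_closure.
Qed.

Lemma ev_bound (f : SD -> C) (M : R) : 0 <= M -> (forall p, cnorm (f p) <= M) ->
  forall z g, cnorm (ev f z g) <= M.
Proof.
move=> M0 fM z g; have [e|/ev_out ->] := pselect (beta_q z = grng g).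
  by rewrite (ev_mk _ e).
by rewrite cnorm0.
Qed.

(** Density of the arrows in fibred form: [(z, g)] is the limit of the pairs formed by [k] and the
    point over [grng k] of the section through [g]. *)
Lemma sd_dense z g : beta_q z = grng g ->
  [/\ @beta_emb R G @ beta_filter z --> z,
      (fun k => sec g (grng k)) @ beta_filter z --> g,
      \forall k \near beta_filter z, sec_dom g (grng k) &
      \forall k \near beta_filter z, beta_q (beta_emb R k) = grng (sec g (grng k))].
Proof.
move=> e; have cr := @cvg_rng_beta_filter R G z; rewrite e in cr.
have n1 : \forall k \near beta_filter z, sec_dom g (grng k) := cr _ (near_sec_dom g).
split=> //.
- exact: beta_emb_cvg.
- by apply: cvg_comp cr _; exact: sec_cvg_to.
- by apply: filterS n1 => k sk; rewrite beta_q_emb sec_range.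
Qed.

Definition fp_cont (P : G -> G -> C) : Prop :=
  forall (I : Type) (F : set_system I) (FF : Filter F) (u v : I -> G) g h,
    grng g = grng h -> u @ F --> g -> v @ F --> h ->
    (\forall i \near F, grng (u i) = grng (v i)) ->
    (fun i => P (u i) (v i)) @ F --> P g h.

(* Near [(z, g)] the fibre product [beta *_X G] is homeomorphic to [beta] via a
   local section through [g], so the extension over [z] of a bounded function of
   one variable does the job; cutting off by a bump function lands in [C0r]. *)
Lemma beta_extension (P : G -> G -> C) (M : R) : 0 <= M -> fp_cont P ->
  (forall g h, grng g = grng h -> cnorm (P g h) <= M) ->
  exists Phi : B -> G -> C,
    [/\ sd_cont Phi, forall g h, grng g = grng h -> Phi (beta_emb R g) h = P g h &
        forall z g, cnorm (Phi z g) <= M].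
Proof.
move=> M0 cP PM.
pose psi g : X -> R := projT1 (cid (bump R (near_sec_dom g))).
have psiP g : [/\ continuous (psi g), forall y, 0 <= psi g y <= 1,
    \forall y \near grng g, psi g y = 1 &
    exists2 L, compact L & L `<=` sec_dom g /\ forall y, ~ L y -> psi g y = 0].
  exact: (projT2 (cid (bump R (near_sec_dom g)))).
(* As a function of [h] this follows [P] along the section through [g]; the bump factor keeps it
   supported where the section is defined. *)
pose k g h : C := Complex (psi g (grng h)) 0 * P h (sec g (grng h)).
have kM g h : cnorm (k g h) <= M.
  have [_ p01 _ [L _ [LD pL]]] := psiP g.
  have [Lh|/pL p0] := pselect (L (grng h)); last first.
    by rewrite /k p0 mul0r cnorm0.
  have /andP[p0 p1] := p01 (grng h).
  rewrite /k cnormM cnorm_real (ger0_norm p0) -[leRHS]mul1r.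
  by apply: ler_pM => //; rewrite ?cnorm_ge0// PM// sec_range//; exact: LD.
have Ck g : C0r (k g).
  have [cpsi p01 _ [L cL [LD pL]]] := psiP g.
  have clL : closed L by exact: compact_closed hausdorff_units cL.
  have ck : continuous (k g).
    move=> h; have ch : (@grng G) @ h --> grng h by exact: (grng_continuous (etale_lc G)).
    have [Lh|nL] := pselect (L (grng h)).
      apply: cvgM.
        by apply: cvg_cplx_real; apply: cvg_comp ch _; exact: cpsi.
      have Dh := LD _ Lh; apply: cP.
      + by rewrite sec_range.
      + exact: cvg_id.
      + by apply: cvg_comp ch _; exact: sec_cvg.
      + have n1 : \forall h' \near h, sec_dom g (grng h') := ch _ (sec_dom_near Dh).
        by apply: filterS n1 => h' Dh'; rewrite sec_range.
    have nbL : nbhs (grng h) (~` L).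
      by apply: open_nbhs_nbhs; split=> //; exact: closed_openC.
    have n1 : \forall h' \near h, ~ L (grng h') := ch _ nbL.
    apply/cvg_cnormP => e e0; apply: filterS n1 => h' nL'.
    by rewrite /k !pL// !mul0r subrr cnorm0.
  have bk : Cb (k g) by split=> //; exists M.
  split=> // e e0; exists (k g), L; split=> //.
    have clrL : closed (@grng G @^-1` L).
      by apply: preimage_closed => // y _; exact: (grng_continuous (etale_lc G)).
    rewrite [X in _ `<=` X](closure_id _).1//; apply: closureS => h /=.
    by apply: contra_neqP => nL; rewrite /k pL// mul0r.
  by move=> h; rewrite subrr cnorm0 ltW.
(* For [g'] near [g] the sections through both agree near [grng g'] and both bumps equal 1 there, so
   the value at [z] is locally independent of the arrow used to define it. *)
have loc g : \forall g' \near g, forall z, beta_q z = grng g' ->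
    beta_eval z (k g') = beta_eval z (k g).
  have [_ _ p1 _] := psiP g.
  have n1 : \forall g' \near g, nbhs (grng g') [set y | psi g y = 1].
    exact: (cvg_rng (@cvg_id _ (nbhs g)) (nbhs_interior p1)).
  have n2 : \forall g' \near g, sec_dom g (grng g').
    exact: (cvg_rng (@cvg_id _ (nbhs g)) (near_sec_dom g)).
  apply: filterS3 n1 n2 (sec_near_eq g) => g' h1 h2 h3 z zg'.
  apply: beta_eval_near_eq => //.
  have cr := @cvg_rng_beta_filter R G z; rewrite zg' in cr.
  have m1 : \forall h \near beta_filter z, psi g (grng h) = 1 := cr _ h1.
  have [_ _ p1' _] := psiP g'.
  have m2 : \forall h \near beta_filter z, psi g' (grng h) = 1 := cr _ p1'.
  have m3 : \forall h \near beta_filter z, sec g (grng h) = sec g' (grng h).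
    have cs : (fun h => sec g (grng h)) @ beta_filter z --> g'.
      by rewrite h3; apply: cvg_comp cr _; exact: sec_cvg.
    have m4 : \forall h \near beta_filter z, sec_dom g (grng h) := cr _ (sec_dom_near h2).
    have m5 : \forall h \near beta_filter z,
      sec g (grng h) = sec g' (grng (sec g (grng h))) := cs _ (sec_near_eq g').
    by apply: filterS2 m4 m5 => h Dh {1}->; rewrite sec_range.
  by apply: filterS3 m1 m2 m3 => h e1 e2 e3; rewrite /k e1 e2 e3.
exists (fun z g => beta_eval z (k g)); split.
- move=> I F FF u v z g zg uz vg uv.
  have c1 : (fun i => beta_eval (u i) (k g)) @ F --> beta_eval z (k g).
    by have /beta_cvgP := uz; apply.
  apply: cvg_congr c1.
  have n1 : \forall i \near F, forall z, beta_q z = grng (v i) ->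
    beta_eval z (k (v i)) = beta_eval z (k g) := vg _ (loc g).
  by apply: filterS2 n1 uv => i hi ei; rewrite hi.
- move=> g h gh; rewrite beta_eval_emb// /k gh sec_rng.
  by have [_ _ p1 _] := psiP h; rewrite (nbhs_singleton p1) mul1r.
- by move=> z g; exact: beta_eval_le.
Qed.

Lemma C0r_translation (f : G -> C) : C0r f ->
  fp_cont (fun g h => f (gmul (ginv h) g)).
Proof.
move=> Cf I F FF u v g h gh ug vh uv.
have c : (fun i => gmul (ginv (v i)) (u i)) @ F --> gmul (ginv h) g.
  apply: cvg_mul (cvg_inv vh) ug _; first by rewrite srcV.
  by apply: filterS uv => i e; rewrite srcV.
by apply: cvg_comp c _; exact: Cf.1.1.
Qed.

(** The translate of [z] by [g] is the limit of translates of arrows. Its value on [f] is the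
    extension of (k, h) -> f(h^-1 k) evaluated at (z, g^-1); this formula makes the translation
    jointly continuous. *)
Lemma translate_exists g z : gsrc g = beta_q z -> exists w : B,
  [/\ (fun k => beta_emb R (gmul (ginv (sec (ginv g) (grng k))) k)) @ beta_filter z --> w &
      forall f (Phi : B -> G -> C), C0r f -> sd_cont Phi ->
        (forall k h, grng k = grng h -> Phi (beta_emb R k) h = f (gmul (ginv h) k)) ->
        beta_eval w f = Phi z (ginv g)].
Proof.
move=> gz; have zg : beta_q z = grng (ginv g) by rewrite rngV.
have [c1 c2 n1 n2] := sd_dense zg.
pose u k := beta_emb R (gmul (ginv (sec (ginv g) (grng k))) k).
have key f (Phi : B -> G -> C) : C0r f -> sd_cont Phi ->
    (forall k h, grng k = grng h -> Phi (beta_emb R k) h = f (gmul (ginv h) k)) ->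
    (fun k => beta_eval (u k) f) @ beta_filter z --> Phi z (ginv g).
  move=> Cf cPhi PhiE; apply: cvg_congr (cPhi _ _ _ _ _ _ _ zg c1 c2 n2).
  apply: filterS n2 => k; rewrite beta_q_emb => e.
  by rewrite /u beta_eval_emb// PhiE.
have [w uw] : exists w : B, u @ beta_filter z --> w.
  apply: (@beta_limit R G G (beta_filter z) _ u).
    move=> f Cf; have [_ [M fM]] := Cf.1.
    have M0 : 0 <= `|M| by [].
    have [g' h' _|Phi [cPhi PhiE _]] := beta_extension M0 (C0r_translation Cf).
      by apply: le_trans (fM _) (ler_norm _).
    by exists (Phi z (ginv g)); exact: key.
  (* The limit is a nonzero functional because the translated arrows have ranges tending to
     [grng g], where [k0] is 1. *)
  have [k0 [Ck k1 _]] := @bump_C0 R G (grng g) setT (@filterT _ (nbhs (grng g)) _).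
  exists (k0 \o @grng G), 1; split; [exact: C0r_comp_rng|exact: oner_neq0|].
  have cs : (fun k => gsrc (sec (ginv g) (grng k))) @ beta_filter z --> grng g.
    by rewrite -(srcV g); apply: cvg_src.
  have m1 : \forall k \near beta_filter z, k0 (gsrc (sec (ginv g) (grng k))) = 1 := cs _ k1.
  apply/cvg_cnormP => e e0; apply: filterS2 m1 n2 => k h1; rewrite beta_q_emb => h2.
  rewrite /u beta_eval_emb; last exact: C0r_comp_rng.
  by rewrite /= rngM ?srcV// rngV h1 subrr cnorm0.
exists w; split=> // f Phi Cf cPhi PhiE.
have cw : (fun k => beta_eval (u k) f) @ beta_filter z --> beta_eval w f.
  by have /beta_cvgP := uw; apply.
exact: (@cvg_unique _ (@cplx_hausdorff R) _ _ _ _ cw (key f Phi Cf cPhi PhiE)).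
Qed.

Definition translate g z : B :=
  if pselect (gsrc g = beta_q z) is left e then projT1 (cid (translate_exists e)) else z.

Lemma translate_cvg g z : gsrc g = beta_q z ->
  (fun k => beta_emb R (gmul (ginv (sec (ginv g) (grng k))) k)) @ beta_filter z -->
  translate g z.
Proof.
move=> e; rewrite /translate; case: pselect => [e'|ne]; last by case: (ne e).
by have [] := projT2 (cid (translate_exists e')).
Qed.

Lemma translate_eval g z f (Phi : B -> G -> C) : gsrc g = beta_q z ->
  C0r f -> sd_cont Phi ->
  (forall k h, grng k = grng h -> Phi (beta_emb R k) h = f (gmul (ginv h) k)) ->
  beta_eval (translate g z) f = Phi z (ginv g).
Proof.
move=> e; rewrite /translate; case: pselect => [e'|ne]; last by case: (ne e).
by have [_ +] := projT2 (cid (translate_exists e')); apply.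
Qed.

Lemma translate_q g z : gsrc g = beta_q z -> beta_q (translate g z) = grng g.
Proof.
move=> gz; have zg : beta_q z = grng (ginv g) by rewrite rngV.
have [c1 c2 n1 n2] := sd_dense zg.
have h1 := cvg_beta_q (translate_cvg gz).
have h2 : (fun k => gsrc (sec (ginv g) (grng k))) @ beta_filter z --> grng g.
  by rewrite -(srcV g); apply: cvg_src.
apply: (cvg_near_eq (F := beta_filter z) hausdorff_units (h1 _) h2).
by apply: filterS n2 => k; rewrite !beta_q_emb => e; rewrite rngM ?srcV// rngV.
Qed.

Lemma translate_continuous (I : Type) (F : set_system I) {FF : Filter F}
    (u : I -> G) (v : I -> B) g z : gsrc g = beta_q z ->
  u @ F --> g -> v @ F --> z -> (\forall i \near F, gsrc (u i) = beta_q (v i)) ->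
  (fun i => translate (u i) (v i)) @ F --> translate g z.
Proof.
move=> gz ug vz uv; apply/beta_cvgP => f Cf.
have [_ [M fM]] := Cf.1; have M0 : 0 <= `|M| by [].
have [g' h' _|Phi [cPhi PhiE _]] := beta_extension M0 (C0r_translation Cf).
  by apply: le_trans (fM _) (ler_norm _).
rewrite (translate_eval gz Cf cPhi PhiE).
have c1 : (fun i => Phi (v i) (ginv (u i))) @ F --> Phi z (ginv g).
  apply: cPhi => //; first by rewrite rngV.
    exact: cvg_inv.
  by apply: filterS uv => i e; rewrite rngV.
apply: cvg_congr c1; apply: filterS uv => i e.
by rewrite (translate_eval e Cf cPhi PhiE).
Qed.

Lemma translate_emb g h : gsrc g = grng h ->
  translate g (beta_emb R h) = beta_emb R (gmul g h).
Proof.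
move=> gh; have gz : gsrc g = beta_q (beta_emb R h) by rewrite beta_q_emb.
apply: beta_ext => f Cf.
have [_ [M fM]] := Cf.1; have M0 : 0 <= `|M| by [].
have [g' h' _|Phi [cPhi PhiE _]] := beta_extension M0 (C0r_translation Cf).
  by apply: le_trans (fM _) (ler_norm _).
by rewrite (translate_eval gz Cf cPhi PhiE) PhiE ?rngV// ainvK beta_eval_emb.
Qed.

Lemma translate_unit z : translate (gunit (beta_q z)) z = z.
Proof.
have gz : gsrc (gunit (beta_q z)) = beta_q z by rewrite src1.
have c2 := @beta_emb_cvg R G z.
have c1 : (fun k => translate (gunit (grng k)) (beta_emb R k)) @ beta_filter z -->
    translate (gunit (beta_q z)) z.
  apply: translate_continuous => //.
    by apply: cvg_unit; exact: cvg_rng_beta_filter.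
  by apply: filterE => k; rewrite src1 beta_q_emb.
apply: (cvg_near_eq (F := beta_filter z) beta_hausdorff c1 c2); apply: filterE => k.
by rewrite translate_emb ?src1// amul1.
Qed.

Lemma translate_mul g h z : gsrc g = grng h -> gsrc h = beta_q z ->
  translate (gmul g h) z = translate g (translate h z).
Proof.
move=> gh hz; have zh : beta_q z = grng (ginv h) by rewrite rngV.
have [c1 c2 n1 n2] := sd_dense zh.
(* The arrows [h] and [g] are replaced by [u k] and [v k], which converge to them and are composable
   with the arrow [k]; there the identity is associativity in [G]. *)
pose u k := ginv (sec (ginv h) (grng k)).
have uh : u @ beta_filter z --> h by rewrite -[X in _ --> X]ainvK; exact: cvg_inv.
have su : \forall k \near beta_filter z, gsrc (u k) = grng k.
  by apply: filterS n2 => k; rewrite beta_q_emb => e; rewrite /u srcV.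
have ru : (fun k => grng (u k)) @ beta_filter z --> grng (ginv g).
  by rewrite rngV gh; exact: cvg_rng.
pose v k := ginv (sec (ginv g) (grng (u k))).
have vg : v @ beta_filter z --> g.
  rewrite -[X in _ --> X]ainvK; apply: cvg_inv.
  by apply: cvg_comp ru _; exact: sec_cvg_to.
have sv : \forall k \near beta_filter z, gsrc (v k) = grng (u k).
  have m : \forall k \near beta_filter z, sec_dom (ginv g) (grng (u k)) :=
    ru _ (near_sec_dom (ginv g)).
  by apply: filterS m => k Dk; rewrite /v srcV sec_range.
have hw : (fun k => translate (u k) (beta_emb R k)) @ beta_filter z --> translate h z.
  apply: translate_continuous => //.
  by apply: filterS su => k e; rewrite beta_q_emb.
have lhs : (fun k => translate (gmul (v k) (u k)) (beta_emb R k)) @ beta_filter z -->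
    translate (gmul g h) z.
  apply: translate_continuous => //; first by rewrite srcM.
    exact: cvg_mul.
  by apply: filterS2 su sv => k e1 e2; rewrite srcM// beta_q_emb.
have rhs : (fun k => translate (v k) (translate (u k) (beta_emb R k))) @ beta_filter z -->
    translate g (translate h z).
  apply: translate_continuous => //; first by rewrite translate_q.
  by apply: filterS2 su sv => k e1 e2; rewrite translate_q ?beta_q_emb.
apply: (cvg_near_eq (F := beta_filter z) beta_hausdorff lhs rhs).
apply: filterS2 su sv => k e1 e2.
by rewrite !translate_emb ?srcM ?rngM// amulA.
Qed.

Lemma translate_action : is_translation_action translate.
Proof.
split.
- exact: translate_q.
- exact: translate_unit.
- exact: translate_mul.
- apply/subspace_continuousP => -[g z] /= gz.
  apply: (@translate_continuous _ (within _ (nbhs (g, z))) _ fst snd) => //.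
  + by apply: cvg_within_filter; exact: cvg_fst.
  + by apply: cvg_within_filter; exact: cvg_snd.
  + by rewrite near_withinE; apply: filterE => -[].
- exact: translate_emb.
Qed.

(** [beta_act] is an arbitrary translation action, and [translate] shows that there is one; from
    here on only the axioms of an action are used. *)
Lemma beta_actP : is_translation_action (@beta_act R G).
Proof. by rewrite /beta_act; case: xgetP => [a _ //|/(_ _ translate_action)]. Qed.

Lemma act_q' g z : gsrc g = beta_q z -> beta_q (beta_act g z) = grng g.
Proof. exact: act_q beta_actP g z. Qed.

Lemma act_mul' g h z : gsrc g = grng h -> gsrc h = beta_q z ->
  beta_act (gmul g h) z = beta_act g (beta_act h z).
Proof. exact: act_mul beta_actP g h z. Qed.

Lemma act_emb g h : gsrc g = grng h ->
  beta_act g (beta_emb R h) = beta_emb R (gmul g h).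
Proof. exact: act_translation beta_actP g h. Qed.

Lemma cvg_act (I : Type) (F : set_system I) {FF : Filter F}
    (u : I -> G) (v : I -> B) g z : gsrc g = beta_q z ->
  u @ F --> g -> v @ F --> z -> (\forall i \near F, gsrc (u i) = beta_q (v i)) ->
  (fun i => beta_act (u i) (v i)) @ F --> beta_act g z.
Proof.
move=> gz ug vz uv.
apply: (@within_cvg _ _ _ _ _ _ _ (fun i => (u i, v i)) (g, z)
  (act_continuous beta_actP) gz) => //.
exact: (cvg_pair ug vz).
Qed.

End SemidirectSpace.

(** * The regular representation of the semidirect product *)

Section FiniteKernels.
Context {R : realType} {T : choiceType}.
Local Notation C := (cplx R).
Implicit Types (A : set T) (xi : T -> C).

Lemma sqr_sum_le (l : seq T) (a : T -> R) :
  (\sum_(i <- l) a i) ^+ 2 <= (size l)%:R * \sum_(i <- l) a i ^+ 2.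
Proof.
elim: l => [|x l ih]; first by rewrite !big_nil expr0n mulr0.
rewrite !big_cons /=; move: ih (sumr_ge0 l (fun i (_ : true) => sqr_ge0 (a i))).
set S := \sum_(i <- l) a i; set Q := \sum_(i <- l) a i ^+ 2.
move: (a x) => b ih Q0; rewrite -[(size l).+1]addn1 natrD.
have [l0|l0] := eqVneq (size l) 0%N.
  rewrite l0 mul0r in ih; have -> : S = 0.
    by apply/eqP; rewrite -sqrf_eq0 eq_le ih sqr_ge0.
  by rewrite l0 add0r mul1r addr0 lerDl.
have n0 : 0 < (size l)%:R :> R by rewrite ltr0n lt0n.
move: (size l)%:R n0 ih => n n0 ih; rewrite -subr_ge0 -(pmulr_rge0 _ n0).
(* The identity behind the step is n ((n + 1) (b^2 + Q) - (b + S)^2) = (n b - S)^2 + (n + 1) (n Q -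
   S^2). *)
have : 0 <= (n * b - S) ^+ 2 by exact: sqr_ge0.
have : 0 <= (n + 1) * (n * Q - S ^+ 2) by rewrite mulr_ge0 ?subr_ge0// addr_ge0// ltW.
lra.
Qed.

Lemma l2le_finite A xi (l : seq T) (N : nat) (M : R) : 0 <= M -> (size l <= N)%N ->
  (forall x, A x -> x \notin l -> xi x = 0) -> (forall x, cnorm (xi x) <= M) ->
  l2le A xi (N%:R * M).
Proof.
move=> M0 lN xl xM s [us As].
apply: le_trans (_ : \sum_(x <- l) M ^+ 2 <= _); last first.
  rewrite big_const_seq count_predT iter_addr_0 -[_ *+ size l]mulr_natl exprMn ler_wpM2r ?sqr_ge0//.
  apply: le_trans (_ : N%:R <= _); first by rewrite ler_nat.
  by rewrite -natrX ler_nat; case: (N) => // n; rewrite expnS leq_pmulr// expn1.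
apply: le_trans (_ : \sum_(x <- [seq x <- s | x \in l]) cnorm (xi x) ^+ 2 <= _).
  rewrite (bigID (mem l))/= [X in _ + X]big1_seq ?addr0 ?big_filter//.
  by move=> x /andP[xnl /As Ax]; rewrite xl// cnorm0 expr0n.
apply: le_trans (_ : \sum_(x <- [seq x <- s | x \in l]) M ^+ 2 <= _).
  by apply: ler_sum => x _; rewrite ler_sqr ?nnegrE ?cnorm_ge0.
apply: sum_sub_le; first exact: filter_uniq.
  by move=> x; rewrite mem_filter => /andP[].
by move=> _; exact: sqr_ge0.
Qed.

(** Cauchy-Schwarz on a row costs a factor N, and the squares of a column add up to at most N
    M^2. *)
Lemma schur_test A (k : T -> T -> C) (N : nat) (M : R) xi (r : R) : 0 <= M ->
  (forall g h, cnorm (k g h) <= M) ->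
  (forall g, A g -> exists2 l, fin_in A l & (size l <= N)%N /\
     forall h, A h -> h \notin l -> k g h = 0) ->
  (forall h, A h -> exists2 l, fin_in A l & (size l <= N)%N /\
     forall g, A g -> g \notin l -> k g h = 0) ->
  l2le A xi r ->
  l2le A (fun g => csum A (fun h => k g h * xi h)) (N%:R * M * r).
Proof.
move=> M0 kM rows cols xr s [us As].
pose row g : seq T := if pselect (A g) is left Ag then projT1 (cid2 (rows g Ag)) else [::].
have rowP g : A g -> [/\ fin_in A (row g), (size (row g) <= N)%N &
    forall h, A h -> h \notin row g -> k g h = 0].
  move=> Ag; rewrite /row; case: pselect => [Ag'|nAg]; last by case: (nAg Ag).
  by case: cid2 => l Al [].
(* Only finitely many columns meet the rows of [s], so the double sum is finite and can be
   exchanged. *)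
pose U := undup (flatten [seq row g | g <- s]).
have AU : fin_in A U.
  split; first exact: undup_uniq.
  move=> h; rewrite mem_undup => /flatten_mapP[g /As/rowP[[_ Ar] _ _]]; exact: Ar.
apply: le_trans (_ : \sum_(g <- s) N%:R * \sum_(h <- U) (cnorm (k g h) ^+ 2 * cnorm (xi h) ^+ 2) <= _).
  rewrite big_seq [leRHS]big_seq; apply: ler_sum => g gs.
  have [Ar rN r0] := rowP g (As g gs).
  rewrite (csum_fin Ar); last by move=> h Ah hr; rewrite r0// mul0r.
  apply: le_trans (_ : (\sum_(h <- row g) cnorm (k g h * xi h)) ^+ 2 <= _).
    by rewrite ler_sqr ?nnegrE ?cnorm_ge0 ?sumr_ge0 ?cnorm_sum// => *; exact: cnorm_ge0.
  apply: le_trans (sqr_sum_le _ _) _.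
  apply: ler_pM; rewrite ?ler0n ?ler_nat ?sumr_ge0//; first by move=> *; exact: sqr_ge0.
  under eq_bigr do rewrite cnormM exprMn.
  apply: sum_sub_le; first by case: Ar.
    by move=> h hr; rewrite mem_undup; apply/flatten_mapP; exists g.
  by move=> h; rewrite mulr_ge0 ?sqr_ge0.
rewrite -mulr_sumr exchange_big /=.
apply: le_trans (_ : N%:R * \sum_(h <- U) (N%:R * M ^+ 2 * cnorm (xi h) ^+ 2) <= _); last first.
  rewrite -mulr_sumr mulrA; have -> : (N%:R * M * r) ^+ 2 = N%:R * (N%:R * M ^+ 2) * r ^+ 2.
    by ring.
  by apply: ler_wpM2l (xr U AU); rewrite !mulr_ge0 ?sqr_ge0.
apply: ler_wpM2l => //; rewrite big_seq [leRHS]big_seq; apply: ler_sum => h hU.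
rewrite -mulr_suml; apply: ler_wpM2r; first exact: sqr_ge0.
have [l _ [lN l0]] := cols h (AU.2 h hU).
apply: le_trans (_ : \sum_(x <- l) M ^+ 2 <= _); last first.
  rewrite big_const_seq count_predT iter_addr_0 -[_ *+ size l]mulr_natl ler_wpM2r ?sqr_ge0//.
  by rewrite ler_nat.
apply: le_trans (_ : \sum_(g <- [seq g <- s | g \in l]) cnorm (k g h) ^+ 2 <= _).
  rewrite (bigID (mem l))/= [X in _ + X]big1_seq ?addr0 ?big_filter//.
  by move=> x /andP[xnl /As Ax]; rewrite l0// cnorm0 expr0n.
apply: le_trans (_ : \sum_(x <- [seq x <- s | x \in l]) M ^+ 2 <= _).
  by apply: ler_sum => x _; rewrite ler_sqr ?nnegrE ?cnorm_ge0.
apply: sum_sub_le; first exact: filter_uniq.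
  by move=> x; rewrite mem_filter => /andP[].
by move=> _; exact: sqr_ge0.
Qed.

End FiniteKernels.

Section RegularRepresentation.
Context {R : realType} {G : etale_groupoid}.
Local Notation C := (cplx R).
Local Notation X := (units G).
Local Notation B := (beta R G).
Local Notation SD := (semidirect R G).
Implicit Types (z : B) (x : X) (g h k : G) (p : SD) (f : SD -> C) (Phi Psi : B -> G -> C).

Lemma sd_inv p : sd_pt (ginv p) = beta_act (ginv (sd_arr p)) (sd_pt p) /\
  sd_arr (ginv p) = ginv (sd_arr p).
Proof.
rewrite /sd_pt /sd_arr /= set_valE insubdK//; apply: mem_set.
by rewrite /sd_arrows /= act_q' ?srcV//; exact/esym/sdP.
Qed.

Lemma sd_inv_mul f p p' : sd_pt p = sd_pt p' ->
  f (gmul (ginv p) p') =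
  ev f (beta_act (ginv (sd_arr p)) (sd_pt p)) (gmul (ginv (sd_arr p)) (sd_arr p')).
Proof.
move=> pp'; have [e1 e2] := sd_inv p.
have rr : grng (sd_arr p) = grng (sd_arr p') by rewrite -!sdP pp'.
have e : beta_q (beta_act (ginv (sd_arr p)) (sd_pt p)) =
    grng (gmul (ginv (sd_arr p)) (sd_arr p')).
  by rewrite act_q' ?srcV ?sdP// rngM ?srcV.
rewrite (ev_mk _ e); congr f; apply: val_inj => /=.
rewrite -[X in insubd _ (X, _)]/(sd_pt (ginv p)) -[X in gmul X _]/(sd_arr (ginv p)).
by rewrite e1 e2 insubdK//; apply: mem_set.
Qed.

Lemma sd_fibre_bij z : set_bij (@fibre SD z) (@fibre G (beta_q z)) sd_arr.
Proof.
split=> [p /= pz|p p' /set_mem pz /set_mem pz' e|g /= gz].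
- by rewrite /fibre /= -sdP; congr beta_q.
- apply: val_inj; move: pz pz' e; rewrite /fibre /= /sd_arr.
  by case: p => -[a b] ?; case: p' => -[a' b'] ? /= -> -> ->.
- by exists (mk_sd (esym gz)).
Qed.

Lemma ev_fibre f z p : sd_pt p = z -> ev f z (sd_arr p) = f p.
Proof. by move=> <-; exact: ev_val. Qed.

Lemma sd_fibre_csum f z : csum (@fibre SD z) f = csum (@fibre G (beta_q z)) (ev f z).
Proof.
by rewrite (csum_reindex _ (sd_fibre_bij z)); apply: csum_eq => p pz /=; rewrite ev_fibre.
Qed.

Lemma sd_fibre_l2le f z (r : R) :
  l2le (@fibre SD z) f r <-> l2le (@fibre G (beta_q z)) (ev f z) r.
Proof.
rewrite (l2le_reindex _ _ (sd_fibre_bij z)).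
by split; apply: l2le_eq => p pz /=; rewrite ev_fibre.
Qed.

Lemma hbd_sd f (r : R) :
  hbd f r <-> 0 <= r /\ forall z, l2le (@fibre G (beta_q z)) (ev f z) r.
Proof. by split=> -[r0 h]; split=> // z; apply/sd_fibre_l2le. Qed.

(** The matrix of the regular representation on the fibre over [z], see [LambdaE]. *)
Definition kern Phi z g h : C := Phi (beta_act (ginv g) z) (gmul (ginv g) h).

Lemma LambdaE f xi z g : hmod xi -> beta_q z = grng g ->
  ev (Lambda f xi) z g =
  csum (@fibre G (beta_q z)) (fun h => kern (ev f) z g h * ev xi z h).
Proof.
move=> hx e; rewrite (ev_mk _ e) /Lambda /on_hmod mem_set// /fibre_int sd_fibre_csum.
apply: csum_eq => h hz; have e' : beta_q z = grng h by rewrite -hz.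
rewrite (ev_mk xi e') (ev_mk _ e').
rewrite -[LHS]/(f (gmul (ginv (mk_sd e)) (mk_sd e')) * xi (mk_sd e')).
by rewrite sd_inv_mul.
Qed.

(** The pair form of [Cc]: by properness of [beta_q], compactness needs to be imposed on the arrow
    only. *)
Definition ccp Phi : Prop := sd_cont Phi /\ exists2 K : set G, compact K &
  forall z g, beta_q z = grng g -> ~ K g -> Phi z g = 0.

Definition sd_of Phi : SD -> C := fun p => Phi (sd_pt p) (sd_arr p).

Lemma ccp_Cc Phi : ccp Phi -> Cc (sd_of Phi).
Proof. by move=> [cP [K cK PK]]; exact: (Cc_sd cK cP PK). Qed.

Lemma Cc_ccp f : Cc f -> ccp (ev f).
Proof.
move=> Cf; split; first exact: continuous_sd_cont Cf.1.
by have [K cK fK] := Cc_sd_supp Cf; exists K => // z g _; exact: fK.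
Qed.

Lemma ev_sd_of Phi z g : beta_q z = grng g -> ev (sd_of Phi) z g = Phi z g.
Proof. exact: ev_fun. Qed.

(** [Phi] composed with the inversion of the semidirect product. *)
Definition check Phi z g : C := Phi (beta_act (ginv g) z) (ginv g).

Lemma check_ccp Phi : ccp Phi -> ccp (check Phi).
Proof.
move=> [cP [K cK PK]]; split.
  move=> I F FF u v z g zg uz vg uv; apply: cP.
  - by rewrite act_q' ?srcV.
  - apply: cvg_act => //; first by rewrite srcV.
      exact: cvg_inv.
    by apply: filterS uv => i e; rewrite srcV.
  - exact: cvg_inv.
  - by apply: filterS uv => i e; rewrite act_q' ?srcV.
exists (@ginv G @` K); first exact: compact_inv.
move=> z g zg nK; apply: PK; first by rewrite act_q' ?srcV.
by move=> Kg; apply: nK; exists (ginv g) => //; exact: ainvK.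
Qed.

Lemma conj_ccp Phi : ccp Phi -> ccp (fun z g => Num.conj (Phi z g)).
Proof.
move=> [cP [K cK PK]]; split.
  move=> I F FF u v z g zg uz vg uv.
  by apply: cvg_comp (cP _ _ _ _ _ _ _ zg uz vg uv) _; exact: conj_continuous.
by exists K => // z g zg nK; rewrite PK// conjC0.
Qed.

Definition conv Phi Psi z g : C :=
  csum (@fibre G (beta_q z)) (fun h => Phi z h * Psi (beta_act (ginv h) z) (gmul (ginv h) g)).

(** Near [z] the convolution is a finite sum over the sections through the points of [K] above
    [beta_q z], and each term is continuous. *)
Lemma conv_ccp Phi Psi : ccp Phi -> ccp Psi -> ccp (conv Phi Psi).
Proof.
move=> [cP [K cK PK]] [cQ [L cL QL]]; split; last first.
  exists [set gmul p.1 p.2 | p in K `*` L `&` composable G]; first exact: compact_mul.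
  move=> z g zg nKL; rewrite /conv -[RHS](csum0 (@fibre G (beta_q z))).
  apply: csum_eq => h hz; have [Kh|nKh] := pselect (K h); last first.
    by rewrite PK ?mul0r.
  rewrite QL ?mulr0//.
    by rewrite act_q' ?srcV// rngM// srcV hz.
  move=> Lhg; apply: nKL; exists (h, gmul (ginv h) g).
    by split=> //; rewrite /composable /= rngM ?srcV ?rngV// hz.
  by rewrite /= amulKVg// hz.
move=> I F FF u v z g zg uz vg uv.
have [l lx lK] := compact_fibre (beta_q z) cK.
have qu : (fun i => beta_q (u i)) @ F --> beta_q z by exact: cvg_beta_q uz.
pose term w k h := Phi w h * Psi (beta_act (ginv h) w) (gmul (ginv h) k).
have near_sum := fibre_sum_near R cK lx lK.
have sumE : \forall y \near beta_q z, (forall h, h \in l -> sec_dom h y) /\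
    forall w k, beta_q w = y -> conv Phi Psi w k = \sum_(h <- l) term w k (sec h y).
  apply: filterS near_sum => y [D S]; split=> // w k wy.
  rewrite /conv wy (S (term w k))// => h hy nK; rewrite /term PK ?mul0r//.
  by rewrite wy hy.
have [_ /(_ z g erefl) ->] := nbhs_singleton sumE.
have n1 : \forall i \near F, (forall h, h \in l -> sec_dom h (beta_q (u i))) /\
    forall w k, beta_q w = beta_q (u i) ->
    conv Phi Psi w k = \sum_(h <- l) term w k (sec h (beta_q (u i))) := qu _ sumE.
apply: (@cvg_congr _ _ _ _ _ (fun i => \sum_(h <- l) term (u i) (v i) (sec h (beta_q (u i))))).
  by apply: filterS n1 => i [_ ->].
have n2 : \forall i \near F, forall h, h \in l -> sec_dom h (beta_q (u i)).
  by apply: filterS n1 => i [].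
have D0 := (nbhs_singleton sumE).1.
apply: (@cvg_bigsum C I _ F _ l (fun h i => term (u i) (v i) (sec h (beta_q (u i))))).
move=> h hl.
have Dh := D0 h hl.
have cs : (fun i => sec h (beta_q (u i))) @ F --> sec h (beta_q z).
  by apply: cvg_comp qu _; exact: sec_cvg.
have rs : \forall i \near F, grng (sec h (beta_q (u i))) = beta_q (u i).
  by apply: filterS n2 => i /(_ h hl) Di; exact: sec_range.
have rs0 : grng (sec h (beta_q z)) = beta_q z by exact: sec_range.
apply: cvgM.
  by apply: (cP I F FF u _ z _ (esym rs0) uz cs); apply: filterS rs => i ->.
have mulc : (fun i => gmul (ginv (sec h (beta_q (u i)))) (v i)) @ F -->
    gmul (ginv (sec h (beta_q z))) g.
  apply: cvg_mul (cvg_inv cs) vg _; first by rewrite srcV rs0.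
  by apply: filterS2 rs uv => i e1 e2; rewrite srcV e1.
have actc : (fun i => beta_act (ginv (sec h (beta_q (u i)))) (u i)) @ F -->
    beta_act (ginv (sec h (beta_q z))) z.
  apply: cvg_act (cvg_inv cs) uz _; first by rewrite srcV.
  by apply: filterS rs => i e1; rewrite srcV.
apply: (cQ I F FF _ _ _ _ _ actc mulc).
  by rewrite act_q' ?srcV// rngM// srcV rs0.
by apply: filterS2 rs uv => i e1 e2; rewrite act_q' ?srcV// rngM// srcV e1.
Qed.

Lemma act_inv_mul g h z : grng g = beta_q z -> grng h = beta_q z ->
  beta_act (gmul (ginv g) h) (beta_act (ginv h) z) = beta_act (ginv g) z.
Proof.
move=> gz hz; rewrite -act_mul' ?srcV// ?srcM ?srcV ?rngV ?gz//.
by rewrite -amulA ?srcV ?rngV ?gz// amulgV hz amulr1// srcV.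
Qed.

(** The regular representation is right convolution by the inverted function, so that its stability
    on [Cc] reduces to [conv_ccp]. *)
Lemma kern_conv Phi Xi z g : beta_q z = grng g ->
  csum (@fibre G (beta_q z)) (fun h => kern Phi z g h * Xi z h) =
  conv Xi (check Phi) z g.
Proof.
move=> zg; apply: csum_eq => h hz.
have e : ginv (gmul (ginv h) g) = gmul (ginv g) h.
  by rewrite ainvM ?srcV ?hz// ainvK.
by rewrite mulrC /check /kern e act_inv_mul.
Qed.

End RegularRepresentation.

Lemma csum_bigsum (R : realType) (T : choiceType) (J : eqType) (A : set T) (s : seq J)
    (F : J -> T -> cplx R) : (forall j, j \in s -> csummable A (F j)) ->
  csummable A (fun x => \sum_(j <- s) F j x) /\
  csum A (fun x => \sum_(j <- s) F j x) = \sum_(j <- s) csum A (F j).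
Proof.
elim: s => [|j s ih] h.
  under eq_fun do rewrite big_nil; rewrite big_nil csum0; split=> //.
  by exists 0 => l _; rewrite big1// => i _; exact: cnorm0.
have [|s1 s2] := ih; first by move=> k ks; apply: h; rewrite inE ks orbT.
have hj : csummable A (F j) by apply: h; rewrite inE eqxx.
under eq_fun do rewrite big_cons.
by rewrite big_cons; split; [exact: csummableD|rewrite csumD// s2].
Qed.

Lemma Cc_fibre_bounded (R : realType) (G : etale_groupoid) (xi : G -> cplx R) :
  Cc xi -> exists r, hbd xi r.
Proof.
move=> Cx; have [M M0 xM] := Cc_bound Cx; have [N hN] := fibre_count Cx.2.
exists (N%:R * M); split; first exact: mulr_ge0.
move=> x; have [l _ [lN lK]] := hN x.
apply: (l2le_finite M0 lN) => // g gx gl; apply: contrapT => /eqP ne.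
by move/negP: gl; apply; apply: lK => //; exact: subset_closure.
Qed.

(** * The operators of the regular representation form a *-algebra *)

Section RegularAlgebra.
Context {R : realType} {G : etale_groupoid}.
Local Notation C := (cplx R).
Local Notation X := (units G).
Local Notation B := (beta R G).
Local Notation SD := (semidirect R G).
Implicit Types (z : B) (x : X) (g h k : G) (p : SD) (f xi eta : SD -> C)
  (Phi Psi : B -> G -> C).

Lemma sd_ext f f' : (forall z g, beta_q z = grng g -> ev f z g = ev f' z g) -> f = f'.
Proof. by move=> e; apply/funext => p; rewrite -!ev_val e//; exact: sdP. Qed.

Lemma evD f f' z g : ev (f + f') z g = ev f z g + ev f' z g.
Proof.
have [e|ne] := pselect (beta_q z = grng g); first by rewrite !(ev_mk _ e).
by rewrite !ev_out// addr0.
Qed.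

Lemma evZ (c : C) f z g : ev (fun p => c * f p) z g = c * ev f z g.
Proof.
have [e|ne] := pselect (beta_q z = grng g); first by rewrite !(ev_mk _ e).
by rewrite !ev_out// mulr0.
Qed.

Lemma fin_in_translate g (l : seq G) : fin_in (@fibre G (gsrc g)) l ->
  fin_in (@fibre G (grng g)) [seq gmul g h | h <- l].
Proof.
have [hf hi _] := left_translation_bij g.
move=> [ul lA]; split.
  rewrite map_inj_in_uniq// => h k hl kl; apply: hi; apply/mem_set; exact: lA.
by move=> _ /mapP[h hl ->]; apply: hf; exact: lA.
Qed.

Lemma kern_finite f : Cc f -> exists N : nat, exists M : R,
  [/\ 0 <= M, forall z g h, cnorm (kern (ev f) z g h) <= M,
      forall z g, beta_q z = grng g -> exists2 l, fin_in (@fibre G (beta_q z)) l &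
        (size l <= N)%N /\
        forall h, grng h = beta_q z -> h \notin l -> kern (ev f) z g h = 0 &
      forall z h, beta_q z = grng h -> exists2 l, fin_in (@fibre G (beta_q z)) l &
        (size l <= N)%N /\
        forall g, grng g = beta_q z -> g \notin l -> kern (ev f) z g h = 0].
Proof.
move=> Cf; have [M M0 fM] := Cc_bound Cf; have [K cK fK] := Cc_sd_supp Cf.
have [N1 h1] := fibre_count cK; have [N2 h2] := fibre_count (compact_inv cK).
exists (maxn N1 N2), M; split=> //.
- by move=> z g h; exact: ev_bound.
- move=> z g zg; have [l lA [lN lK]] := h1 (gsrc g).
  exists [seq gmul g h | h <- l]; first by rewrite zg; exact: fin_in_translate.
  split; first by rewrite size_map (leq_trans lN)// leq_maxl.
  move=> h hz hl; apply: fK => Kgh; move/negP: hl; apply.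
  apply/mapP; exists (gmul (ginv g) h); last by rewrite amulKVg// hz.
  by apply: lK => //; rewrite rngM ?rngV// srcV hz.
- move=> z h zh; have [l lA [lN lK]] := h2 (gsrc h).
  exists [seq gmul h g | g <- l]; first by rewrite zh; exact: fin_in_translate.
  split; first by rewrite size_map (leq_trans lN)// leq_maxr.
  move=> g gz gl; apply: fK => Kgh; move/negP: gl; apply.
  apply/mapP; exists (gmul (ginv h) g); last by rewrite amulKVg// gz.
  apply: lK; last by rewrite rngM ?rngV// srcV gz.
  exists (gmul (ginv g) h) => //.
  by rewrite ainvM ?ainvK// srcV gz.
Qed.

Lemma kern_summable f z g (v : G -> C) : Cc f -> beta_q z = grng g ->
  csummable (@fibre G (beta_q z)) (fun h => kern (ev f) z g h * v h).
Proof.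
move=> /kern_finite[N [M [_ _ rows _]]] zg; have [l [ul _] [_ l0]] := rows z g zg.
exists (\sum_(h <- l) cnorm (kern (ev f) z g h * v h)); apply: fin_supp_bound => //.
by move=> h hz hl; rewrite l0// mul0r.
Qed.

Lemma sd_Cc_bounded xi : Cc xi -> exists r, hbd xi r.
Proof.
move=> Cx; have [M M0 xM] := Cc_bound Cx; have [K cK xK] := Cc_sd_supp Cx.
have [N hN] := fibre_count cK; exists (N%:R * M); apply/hbd_sd.
split; first exact: mulr_ge0.
move=> z; have [l _ [lN lK]] := hN (beta_q z).
apply: (l2le_finite M0 lN); last exact: ev_bound.
move=> g gx gl; apply: xK => Kg.
by move/negP: gl; apply; exact: lK.
Qed.

Lemma Lambda_opbd f : Cc f -> exists M, opbd (Lambda f) M.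
Proof.
move=> /kern_finite[N [M [M0 kM rows cols]]].
exists (N%:R * M); split; first exact: mulr_ge0.
move=> xi r hx /hbd_sd[r0 xr]; apply/hbd_sd; split.
  by rewrite mulr_ge0// mulr_ge0.
move=> z.
apply: (@l2le_eq _ _ _ (fun g => csum (@fibre G (beta_q z))
  (fun h => kern (ev f) z g h * ev xi z h))).
  by move=> g gz; rewrite LambdaE.
apply: (@schur_test _ _ (@fibre G (beta_q z)) (kern (ev f) z)) => //.
  by move=> g gz; exact: rows.
by move=> h hz; exact: cols.
Qed.

Lemma Lambda_out f xi : ~ hmod xi -> Lambda f xi = 0.
Proof. by move=> nx; rewrite /Lambda /on_hmod memNset. Qed.

Lemma Lambda_oplin f : Cc f -> oplin (Lambda f).
Proof.
move=> Cf; split=> [xi eta hx he|c xi hx]; apply: sd_ext => z g zg.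
  rewrite evD !LambdaE//; last exact: hmodD.
  rewrite -csumD; try exact: kern_summable.
  by apply: csum_eq => h _; rewrite evD mulrDr.
rewrite evZ !LambdaE//; last exact: hmodZ.
rewrite -csumZ; last exact: kern_summable.
by apply: csum_eq => h _; rewrite evZ mulrCA.
Qed.

Lemma Lambda_Cc f xi : Cc f -> Cc xi -> Cc (Lambda f xi).
Proof.
move=> Cf Cx; have -> : Lambda f xi = sd_of (conv (ev xi) (check (ev f))).
  apply: sd_ext => z g zg; rewrite LambdaE//; last exact: Cc_hmod.
  by rewrite kern_conv// ev_sd_of.
by apply: ccp_Cc; apply: conv_ccp; [exact: Cc_ccp|apply: check_ccp; exact: Cc_ccp].
Qed.

Lemma Lambda_is_op f : Cc f -> is_op (Lambda f).
Proof.
move=> Cf; split; last exact: Lambda_out.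
move=> xi hx; apply: hmod_closed => e e0; have [M [M0 hM]] := Lambda_opbd Cf.
have M1 : 0 < M + 1 by rewrite ltr_wpDl.
have [eta Ce he] := (hmodP xi).1 hx _ (divr_gt0 e0 M1).
exists (Lambda f eta); first by apply: Cc_hmod; exact: Lambda_Cc.
have me := Cc_hmod Ce; rewrite -(oplinB (Lambda_oplin Cf) hx me).
apply: hbdW (hM _ _ (hmodB hx me) he).
rewrite -[leRHS](divfK (lt0r_neq0 M1)) [leRHS]mulrC ler_wpM2r ?lerDl//.
by rewrite divr_ge0 ?ltW.
Qed.

Lemma Lambda_bounded f : Cc f -> bounded_op (Lambda f).
Proof.
move=> Cf; split; [exact: Lambda_is_op|exact: Lambda_oplin|exact: Lambda_opbd].
Qed.

Lemma inner_sd xi eta z : inner xi eta z =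
  csum (@fibre G (beta_q z)) (fun g => Num.conj (ev xi z g) * ev eta z g).
Proof.
rewrite /inner /fibre_int sd_fibre_csum; apply: csum_eq => g gz.
by have e : beta_q z = grng g by []; rewrite !(ev_mk _ e).
Qed.

Definition star f : SD -> C := sd_of (fun z g => Num.conj (check (ev f) z g)).

Lemma star_Cc f : Cc f -> Cc (star f).
Proof. by move=> Cf; apply/ccp_Cc/conj_ccp/check_ccp/Cc_ccp. Qed.

Lemma kern_star f z g h : grng g = beta_q z -> grng h = beta_q z ->
  kern (ev (star f)) z h g = Num.conj (kern (ev f) z g h).
Proof.
move=> gz hz; rewrite /kern ev_sd_of; last first.
  by rewrite act_q' ?srcV// rngM// srcV gz.
rewrite /check; have e : ginv (gmul (ginv h) g) = gmul (ginv g) h.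
  by rewrite ainvM ?srcV ?hz// ainvK.
by rewrite e act_inv_mul.
Qed.

Lemma sd_fibre_supp xi z : Cc xi -> exists2 l, fin_in (@fibre G (beta_q z)) l &
  forall g, grng g = beta_q z -> g \notin l -> ev xi z g = 0.
Proof.
move=> /Cc_sd_supp[K cK xK]; have [l lA lK] := compact_fibre (beta_q z) cK.
by exists l => // g gz gl; apply: xK => Kg; move/negP: gl; apply; exact: lK.
Qed.

(** On compactly supported vectors every sum is finite and the claim is an exchange of summations;
    boundedness extends it to the module. *)
Lemma Lambda_adjoint f : Cc f -> adjoint_of (Lambda f) (Lambda (star f)).
Proof.
move=> Cf; apply: (adjoint_dense sd_Cc_bounded); [exact: Lambda_bounded| |].
  exact/Lambda_bounded/star_Cc.
move=> xi eta z Cx Ce; have [s sA s0] := sd_fibre_supp z Cx.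
have [t tA t0] := sd_fibre_supp z Ce.
rewrite !inner_sd (csum_fin tA); last by move=> g gz gt; rewrite t0// mulr0.
rewrite (csum_fin sA); last by move=> h hz hs; rewrite s0// conjC0 mul0r.
transitivity (\sum_(g <- t) \sum_(h <- s)
    Num.conj (kern (ev f) z g h) * Num.conj (ev xi z h) * ev eta z g).
  apply: eq_big_seq => g gt; have gz := tA.2 _ gt.
  rewrite (LambdaE f (Cc_hmod Cx) (esym gz)) (csum_fin sA); last first.
    by move=> h hz hs; rewrite s0// mulr0.
  by rewrite rmorph_sum mulr_suml; apply: eq_bigr => h _; rewrite rmorphM.
rewrite exchange_big; apply: eq_big_seq => h hs; have hz := sA.2 _ hs.
rewrite (LambdaE (star f) (Cc_hmod Ce) (esym hz)) (csum_fin tA); last first.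
  by move=> g gz gt; rewrite t0// mulr0.
rewrite mulr_sumr; apply: eq_big_seq => g gt.
by rewrite kern_star//; [ring|exact: tA.2].
Qed.

Lemma Lambda_adjointable f : Cc f -> adjointable (Lambda f).
Proof.
move=> Cf; split; first exact: Lambda_is_op.
by exists (Lambda (star f)); [exact/Lambda_is_op/star_Cc|exact: Lambda_adjoint].
Qed.

Lemma Lambda_add f f' : Cc f -> Cc f' -> Lambda (f + f') = Lambda f + Lambda f'.
Proof.
move=> Cf Cf'; apply/funext => xi; have [hx|nx] := pselect (hmod xi); last first.
  by rewrite opD_E !Lambda_out// addr0.
apply: sd_ext => z g zg; rewrite opD_E evD !LambdaE// -csumD; try exact: kern_summable.
by apply: csum_eq => h _; rewrite /kern evD mulrDl.
Qed.

Lemma Lambda_scale c f : Cc f -> Lambda (fun p => c * f p) = scale_op c (Lambda f).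
Proof.
move=> Cf; apply/funext => xi; have [hx|nx] := pselect (hmod xi); last first.
  by apply/funext => p; rewrite /scale_op !Lambda_out// mulr0.
apply: sd_ext => z g zg.
rewrite -[RHS]/(ev (fun p => c * Lambda f xi p) z g) evZ !LambdaE// -csumZ; last first.
  exact: kern_summable.
by apply: csum_eq => h _; rewrite /kern evZ mulrA.
Qed.

Lemma kern_comp Phi Psi z g h : beta_q z = grng g -> grng h = beta_q z ->
  kern (ev (sd_of (conv Phi Psi))) z g h =
  csum (@fibre G (beta_q z)) (fun k => kern Phi z g k * kern Psi z k h).
Proof.
move=> zg hz; have gz : gsrc (ginv g) = beta_q z by rewrite srcV.
rewrite /kern ev_sd_of; last by rewrite act_q'// rngM// gz.
(* Translation by [g] carries the fibre over [gsrc g], on which the convolution sums, to the one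
   over [grng g]. *)
rewrite zg (csum_reindex _ (left_translation_bij g)) /conv act_q'// rngV.
apply: csum_eq => k ks /=; have ks' : gsrc g = grng k by rewrite ks.
rewrite amulKg// ainvM// act_mul' ?srcV ?rngV//.
by congr (_ * Psi _ _); rewrite amulA ?srcV ?rngV// -zg.
Qed.

Lemma Lambda_comp f f' : Cc f -> Cc f' ->
  Lambda f \o Lambda f' = Lambda (sd_of (conv (ev f) (ev f'))).
Proof.
move=> Cf Cf'; apply/funext => xi; rewrite /=.
have [hx|nx] := pselect (hmod xi); last first.
  by rewrite [Lambda f' xi]Lambda_out// [RHS]Lambda_out//; exact: oplin0 (Lambda_oplin Cf).
have hx' : hmod (Lambda f' xi) by exact: (Lambda_is_op Cf').1.
have [N [M [_ _ rows _]]] := kern_finite Cf.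
apply: sd_ext => z g zg; rewrite !LambdaE//.
have [l lA [_ l0]] := rows z g zg.
rewrite (csum_fin lA); last by move=> k kz kl; rewrite l0// mul0r.
(* The row of [g] is finite, so the sum over [k] can be moved across the possibly infinite sum over
   [h]. *)
transitivity (csum (@fibre G (beta_q z)) (fun h => \sum_(k <- l)
    kern (ev f) z g k * (kern (ev f') z k h * ev xi z h))); last first.
  apply: csum_eq => h hz; rewrite kern_comp// (csum_fin lA).
    by rewrite mulr_suml; apply: eq_bigr => k _; rewrite mulrA.
  by move=> k kz kl; rewrite l0// mul0r.
have [|_ ->] := @csum_bigsum R _ _ (@fibre G (beta_q z)) l
    (fun k h => kern (ev f) z g k * (kern (ev f') z k h * ev xi z h)).
  by move=> k kl; apply: csummableZ; apply: kern_summable => //; rewrite (lA.2 _ kl).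
apply: eq_big_seq => k kl; have kz : beta_q z = grng k by rewrite (lA.2 _ kl).
by rewrite LambdaE// csumZ//; exact: kern_summable.
Qed.

Lemma Lambda_star_algebra : star_algebra (@Lambda R SD @` Cc).
Proof.
split.
- by move=> _ [f Cf <-]; exact: Lambda_adjointable.
- by move=> _ [f Cf <-]; exact: Lambda_opbd.
- by exists (Lambda 0); exists 0 => //; exact: Cc_zero.
- move=> _ _ [f Cf <-] [f' Cf' <-]; exists (f + f'); first exact: Cc_add.
  exact: Lambda_add.
- move=> c _ [f Cf <-]; exists (fun p => c * f p); first exact: Cc_scale.
  exact: Lambda_scale.
- move=> _ _ [f Cf <-] [f' Cf' <-]; exists (sd_of (conv (ev f) (ev f'))).
    by apply: ccp_Cc; apply: conv_ccp; exact: Cc_ccp.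
  by rewrite Lambda_comp.
- move=> _ A [f Cf <-] [oA _] adj; exists (star f); first exact: star_Cc.
  apply: (adjoint_unique sd_Cc_bounded) (Lambda_is_op Cf) _ oA (Lambda_adjoint Cf) adj.
  exact/Lambda_is_op/star_Cc.
Qed.

End RegularAlgebra.

(** * Restriction to the fibres over the unit space *)

Lemma l2le_eps (R : realType) (T : choiceType) (A : set T) (xi : T -> cplx R) (r : R) :
  0 <= r -> (forall e : R, 0 < e -> l2le A xi (r + e)) -> l2le A xi r.
Proof.
move=> r0 h s As; apply: le_epsilon => e e0.
have K0 : 0 < 2 * r + 1 + 1 by rewrite ltr_wpDl// addr_ge0// mulr_ge0.
pose d := Num.min 1 (e / (2 * r + 1 + 1)).
have d0 : 0 < d by rewrite lt_min ltr01 divr_gt0.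
have d1 : d <= 1 by rewrite ge_min lexx.
have d2 : d * (2 * r + 1 + 1) <= e by rewrite -ler_pdivlMr// ge_min lexx orbT.
apply: le_trans (h d d0 s As) _.
have : 0 <= d * (1 - d) by rewrite mulr_ge0 ?subr_ge0// ltW.
nra.
Qed.

Lemma opbd_eps (R : realType) (H : groupoid_data) (A : op R H) (M : R) : 0 <= M ->
  (forall e : R, 0 < e -> opbd A (M + e)) -> opbd A M.
Proof.
move=> M0 h; split=> // xi r hx hr; have [r0 _] := hr; split; first exact: mulr_ge0.
move=> x; apply: l2le_eps; first exact: mulr_ge0.
move=> e e0; have r1 : 0 < r + 1 by rewrite ltr_wpDl.
have d0 : 0 < e / (r + 1) by rewrite divr_gt0.
have [q0 k] := (h _ d0).2 _ _ hx hr.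
apply: l2leW (k x) => //; rewrite mulrDl lerD2l.
by rewrite -[leRHS](divfK (lt0r_neq0 r1)) ler_wpM2l ?lerDl// ltW.
Qed.

Lemma Cc_compact (R : realType) (T : topologicalType) (f : T -> cplx R) (K : set T) :
  hausdorff_space T -> continuous f -> compact K -> (forall x, ~ K x -> f x = 0) -> Cc f.
Proof.
move=> hT cf cK fK; split=> //.
apply: (subclosed_compact (@closed_closure _ _) cK).
rewrite [X in _ `<=` X](closure_id _).1; last exact: compact_closed.
by apply: closureS => x /=; apply: contra_neqP => /fK.
Qed.

Lemma compact_seq_union (T : topologicalType) (J : eqType) (l : seq J)
    (A : J -> set T) : (forall j, j \in l -> compact (A j)) ->
  compact [set x | exists2 j, j \in l & A j x].
Proof.
elim: l => [|j l ih] h.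
  have -> : [set x | exists2 j, j \in [::] & A j x] = set0; last exact: compact0.
  by apply/seteqP; split=> x // -[].
have -> : [set x | exists2 k, k \in j :: l & A k x] =
    A j `|` [set x | exists2 k, k \in l & A k x].
  apply/seteqP; split=> x /=.
    by move=> [k]; rewrite inE => /orP[/eqP ->|kl] Ax; [left|right; exists k].
  by move=> [Ax|[k kl Ax]]; [exists j|exists k] => //; rewrite inE ?eqxx// kl orbT.
apply: compactU; first by apply: h; rewrite inE eqxx.
by apply: ih => k kl; apply: h; rewrite inE kl orbT.
Qed.

(* Spreading the values of [zeta] along disjoint local sections, cut off by a
   bump function, does not increase the fibre norms: each nearby fibre meets
   every section exactly once. *)
Lemma extend_from_fibre (R : realType) (G : etale_groupoid) (x : units G)
    (zeta : G -> cplx R) (l : seq G) (r : R) : 0 <= r -> fin_in (@fibre G x) l ->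
  (forall g, grng g = x -> g \notin l -> zeta g = 0) -> l2le (@fibre G x) zeta r ->
  exists eta : G -> cplx R, [/\ Cc eta, hbd eta r & forall g, grng g = x -> eta g = zeta g].
Proof.
move=> r0 lA z0 zr; have [ul lx] := lA.
have n1 := sections_distinct ul lx.
have n2 : \forall y \near x, forall g, g \in l -> sec_dom g y.
  by apply: near_all => g gl; rewrite -(lx g gl); exact: near_sec_dom.
have [psi [cpsi p01 p1 [L cL [LV pL]]]] := bump R (filterI n1 n2).
have clL : closed L by exact: compact_closed hausdorff_units cL.
(* Over [L] the sections are disjoint, so at most one term is nonzero: [S g] is the value of [zeta]
   at the point whose section passes through [g]. *)
pose S g : cplx R := \sum_(k <- l) (if g == sec k (grng g) then zeta k else 0).
pose eta g : cplx R := Complex (psi (grng g)) 0 * S g.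
have eta0 g : ~ L (grng g) -> eta g = 0 by move=> nL; rewrite /eta pL// mul0r.
have cr g : (@grng G) @ g --> grng g by exact: (grng_continuous (etale_lc G)).
have Ssec y k : L y -> k \in l -> S (sec k y) = zeta k.
  move=> Ly kl; have [inj D] := LV _ Ly.
  rewrite /S (bigD1_seq k)//= sec_range ?eqxx//; last exact: D.
  rewrite big1_seq ?addr0// => j /andP[jk jl]; case: eqP => // e.
  by case/eqP: jk; apply: inj.
have S0 g : L (grng g) -> g \notin [seq sec k (grng g) | k <- l] -> S g = 0.
  move=> Lg gl; rewrite /S big1_seq// => k /andP[_ kl]; case: eqP => // e.
  by case/negP: gl; apply/mapP; exists k.
have ceta : continuous eta.
  move=> g; have [Lg|nLg] := pselect (L (grng g)); last first.
    have nbL : nbhs (grng g) (~` L).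
      by apply: open_nbhs_nbhs; split=> //; exact: closed_openC.
    have nL : \forall h \near g, ~ L (grng h) := cr g _ nbL.
    apply/cvg_cnormP => e e0; apply: filterS nL => h nLh.
    by rewrite !eta0// subrr cnorm0.
  have [_ D] := LV _ Lg.
  (* Lying on a section is an open condition, and so is not lying on it, by the Hausdorff property;
     hence [S] is locally constant. *)
  have loc : \forall h \near g, forall k, k \in l ->
      (h == sec k (grng h)) = (g == sec k (grng g)).
    apply: near_all => k kl; have Dk := D k kl.
    have cs : (fun h => sec k (grng h)) @ g --> sec k (grng g).
      by apply: cvg_comp (cr g) _; exact: sec_cvg.
    have [gk|gk] := pselect (g = sec k (grng g)).
      have := sec_near Dk; rewrite -gk; apply: filterS => h hk.
      by rewrite -hk eqxx; apply/esym/eqP.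
    have nn : \forall h \near g, h <> sec k (grng h).
      exact: near_neq hausdorff_arrows (@cvg_id _ (nbhs g)) cs gk.
    by apply: filterS nn => h hk; apply/eqP/eqP.
  have cst : \forall h \near g, S h = S g.
    apply: filterS loc => h hl; rewrite /S; apply: eq_big_seq => k kl.
    by rewrite hl.
  apply: (@cvg_congr _ _ (nbhs g) _ eta (fun h => Complex (psi (grng h)) 0 * S g) (eta g)).
    by apply: filterS cst => h hS; rewrite /eta hS.
  apply: cvgM; last exact: cvg_cst.
  by apply: cvg_cplx_real; apply: cvg_comp (cr g) _; exact: cpsi.
exists eta; split.
- apply: (@Cc_compact _ _ _ [set g | exists2 k, k \in l & (sec k @` L) g]) => //.
  + exact: hausdorff_arrows.
  + apply: compact_seq_union => k kl; apply: continuous_compact => //.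
    apply: continuous_in_subspaceT => y /set_mem Ly; apply: sec_cvg.
    by have [_ D] := LV _ Ly; exact: D.
  + move=> g ng; have [Lg|] := pselect (L (grng g)); last exact: eta0.
    rewrite /eta S0 ?mulr0//; apply/negP => /mapP[k kl gk]; apply: ng.
    by exists k => //; exists (grng g).
- split=> // y s [us sy]; have [Ly|nLy] := pselect (L y); last first.
    rewrite big1_seq ?sqr_ge0// => g /andP[_ /sy gy].
    by rewrite eta0 ?cnorm0 ?expr0n// (_ : grng g = y).
  have [inj D] := LV _ Ly.
  pose t := [seq sec k y | k <- l].
  apply: le_trans (_ : \sum_(g <- [seq g <- s | g \in t]) cnorm (eta g) ^+ 2 <= _).
    rewrite (bigID (mem t))/= [X in _ + X]big1_seq ?addr0 ?big_filter//.
    move=> g /andP[gt /sy gy]; rewrite /eta S0 ?mulr0 ?cnorm0 ?expr0n// (_ : grng g = y)//.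
  apply: le_trans (_ : \sum_(g <- t) cnorm (eta g) ^+ 2 <= _).
    apply: sum_sub_le; first exact: filter_uniq.
      by move=> g; rewrite mem_filter => /andP[].
    by move=> g; exact: sqr_ge0.
  rewrite big_map; apply: le_trans (zr l lA).
  rewrite big_seq [leRHS]big_seq; apply: ler_sum => k kl.
  rewrite ler_sqr ?nnegrE ?cnorm_ge0// /eta Ssec// cnormM cnorm_real.
  have /andP[q0 q1] := p01 (grng (sec k y)).
  by rewrite (ger0_norm q0) ler_piMl ?cnorm_ge0.
- move=> g gx; rewrite /eta gx (nbhs_singleton p1) mul1r /S.
  rewrite (eq_big_seq (fun k => if g == k then zeta k else 0)); last first.
    by move=> k kl; rewrite gx -(lx k kl) sec_rng.
  have [gl|gl] := boolP (g \in l).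
    rewrite (bigD1_seq g)//= eqxx big1_seq ?addr0// => k /andP[kg _].
    by rewrite eq_sym (negbTE kg).
  rewrite big1_seq ?z0// => k /andP[_ kl]; case: eqP => // e.
  by move: gl; rewrite e kl.
Qed.

Section RestrictionToUnits.
Context {R : realType} {G : etale_groupoid}.
Local Notation C := (cplx R).
Local Notation X := (units G).
Local Notation B := (beta R G).
Local Notation SD := (semidirect R G).
Implicit Types (z : B) (x : X) (g h k : G) (xi eta : G -> C) (f : SD -> C)
  (A : op R SD).

Definition unit_pt x : B := beta_emb R (gunit x).

Lemma unit_ptq x : beta_q (unit_pt x) = x.
Proof. by rewrite beta_q_emb rng1. Qed.

Definition restr f : G -> C := fun g => ev f (unit_pt (grng g)) g.

Lemma lift_Cc xi : Cc xi -> Cc (@lift_semidirect R G xi).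
Proof.
move=> Cx; apply: (Cc_sd Cx.2 (Phi := fun _ g => xi g)).
  by move=> I F FF u v z g _ _ vg _; apply: cvg_comp vg _; exact: Cx.1.
move=> z g _ nK; apply: contrapT => /eqP ne; apply: nK; exact: subset_closure.
Qed.

Lemma restr_Cc f : Cc f -> Cc (restr f).
Proof.
move=> Cf; have [K cK fK] := Cc_sd_supp Cf.
apply: (Cc_compact hausdorff_arrows _ cK); last by move=> g; exact: fK.
move=> g; have c1 : (fun h => unit_pt (grng h)) @ g --> unit_pt (grng g).
  by apply: cvg_beta_emb; apply: cvg_unit; exact: (grng_continuous (etale_lc G)).
apply: (continuous_sd_cont Cf.1 _ (unit_ptq (grng g)) c1 (@cvg_id _ (nbhs g))).
by apply: filterE => h; rewrite unit_ptq.
Qed.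

Lemma ev_lift xi z g : beta_q z = grng g -> ev (@lift_semidirect R G xi) z g = xi g.
Proof. by move=> e; rewrite (ev_mk _ e). Qed.

Lemma restr_lift xi : restr (@lift_semidirect R G xi) = xi.
Proof. by apply/funext => g; rewrite /restr ev_lift// unit_ptq. Qed.

Lemma lift_restr_fibre f (p : SD) x : grng p = unit_pt x ->
  lift_semidirect (restr f) p = f p.
Proof.
move=> px; rewrite -[LHS]/(ev f (unit_pt (grng (sd_arr p))) (sd_arr p)) -sdP.
have px' : sd_pt p = unit_pt x by [].
by rewrite px' unit_ptq -px' ev_val.
Qed.

Lemma lift_hbd xi (r : R) : hbd xi r -> hbd (@lift_semidirect R G xi) r.
Proof.
move=> [r0 h]; apply/hbd_sd; split=> // z.
by apply: l2le_eq (h (beta_q z)) => g gz; rewrite ev_lift.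
Qed.

Lemma restr_hbd f (r : R) : hbd f r -> hbd (restr f) r.
Proof.
move=> /hbd_sd[r0 h]; split=> // x; have := h (unit_pt x); rewrite unit_ptq.
by apply: l2le_eq => g <-.
Qed.

Lemma lift_add xi eta : @lift_semidirect R G (xi + eta) =
  @lift_semidirect R G xi + @lift_semidirect R G eta.
Proof. by []. Qed.

Lemma lift_sub xi eta : @lift_semidirect R G (xi - eta) =
  @lift_semidirect R G xi - @lift_semidirect R G eta.
Proof. by []. Qed.

Lemma restr_add f f' : restr (f + f') = restr f + restr f'.
Proof. by apply/funext => g; exact: evD. Qed.

Lemma restr_scale c f : restr (fun p => c * f p) = fun g => c * restr f g.
Proof. by apply/funext => g; exact: evZ. Qed.

Lemma restr_sub f f' : restr (f - f') = restr f - restr f'.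
Proof.
rewrite restr_add; congr (_ + _); apply/funext => g.
have -> : - f' = (fun p => -1 * f' p) by apply/funext => p; rewrite mulN1r.
by rewrite restr_scale mulN1r.
Qed.

Lemma lift_hmod xi : hmod xi -> hmod (@lift_semidirect R G xi).
Proof.
move=> /hmodP hx; apply/hmodP => e /hx[eta Ce he].
by exists (@lift_semidirect R G eta); [exact: lift_Cc|rewrite -lift_sub; exact: lift_hbd].
Qed.

Lemma restr_hmod f : hmod f -> hmod (restr f).
Proof.
move=> /hmodP hx; apply/hmodP => e /hx[eta Ce he].
by exists (restr eta); [exact: restr_Cc|rewrite -restr_sub; exact: restr_hbd].
Qed.

Lemma inner_restr f f' x : inner (restr f) (restr f') x = inner f f' (unit_pt x).
Proof.
by rewrite inner_sd unit_ptq; apply: csum_eq => g gx; rewrite /restr (_ : grng g = x).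
Qed.

(* The fibre of the semidirect product over the point [unit_pt x] of [beta] is
   that of [G] over [x]; [PhiMap] restricts an operator to these fibres. *)
Definition PhiMap A : op R G := on_hmod (fun xi => restr (A (lift_semidirect xi))).

Lemma PhiMapE A xi : hmod xi -> PhiMap A xi = restr (A (lift_semidirect xi)).
Proof. by move=> hx; rewrite /PhiMap /on_hmod mem_set. Qed.

Lemma PhiMap_out A xi : ~ hmod xi -> PhiMap A xi = 0.
Proof. by move=> nx; rewrite /PhiMap /on_hmod memNset. Qed.

Lemma PhiMap_is_op A : is_op A -> is_op (PhiMap A).
Proof.
move=> oA; split; last exact: PhiMap_out.
by move=> xi hx; rewrite PhiMapE//; apply: restr_hmod; apply: oA.1; exact: lift_hmod.
Qed.

Lemma PhiMap_add A A' : PhiMap (A + A') = PhiMap A + PhiMap A'.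
Proof.
apply/funext => xi; rewrite opD_E; have [hx|nx] := pselect (hmod xi).
  by rewrite !PhiMapE// opD_E restr_add.
by rewrite !PhiMap_out// addr0.
Qed.

Lemma PhiMap_scale c A : PhiMap (scale_op c A) = scale_op c (PhiMap A).
Proof.
apply/funext => xi; rewrite /scale_op; have [hx|nx] := pselect (hmod xi).
  by rewrite !PhiMapE// restr_scale.
by apply/funext => g; rewrite !PhiMap_out// mulr0.
Qed.

Lemma PhiMap_sub A A' : PhiMap (A - A') = PhiMap A - PhiMap A'.
Proof. by rewrite PhiMap_add -scale_opN1 PhiMap_scale scale_opN1. Qed.

Lemma PhiMap_opbd A (M : R) : opbd A M -> opbd (PhiMap A) M.
Proof.
move=> [M0 hA]; split=> // xi r hx hr; rewrite PhiMapE//.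
by apply: restr_hbd; apply: hA; [exact: lift_hmod|exact: lift_hbd].
Qed.

Lemma restr_local A f f' : adjointable A -> hmod f -> hmod f' ->
  restr f = restr f' -> restr (A f) = restr (A f').
Proof.
move=> aA hf hf' e; apply/funext => g.
have eg : beta_q (unit_pt (grng g)) = grng g by rewrite unit_ptq.
rewrite /restr !(ev_mk _ eg).
apply: (adjointable_local (@sd_Cc_bounded R G) (x := unit_pt (grng g)) aA hf hf') => // p px.
by rewrite -(lift_restr_fibre f px) -(lift_restr_fibre f' px) e.
Qed.

(** Lifting a restriction does not give back the original vector, but it agrees with it over the
    units, and by [restr_local] the restricted result depends on nothing else. *)
Lemma PhiMap_comp A A' : adjointable A -> adjointable A' ->
  PhiMap (A \o A') = PhiMap A \o PhiMap A'.
Proof.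
move=> aA aA'; apply/funext => xi /=; have [hx|nx] := pselect (hmod xi); last first.
  rewrite !(PhiMap_out _ nx); apply/esym; apply: oplin0.
  have lA := adjointable_oplin (@sd_Cc_bounded R G) aA.
  split=> [a b ha hb|c a ha]; rewrite !PhiMapE//.
  - by rewrite lift_add lA.1 ?restr_add//; exact: lift_hmod.
  - exact: hmodD.
  - by rewrite -restr_scale -lA.2//; exact: lift_hmod.
  - exact: hmodZ.
have h1 := aA'.1.1 _ (lift_hmod hx); have h2 := restr_hmod h1.
rewrite !PhiMapE//=; apply: restr_local => //; first exact: lift_hmod.
by rewrite restr_lift.
Qed.

Lemma PhiMap_adjoint A A' : is_op A -> is_op A' -> adjoint_of A A' ->
  adjoint_of (PhiMap A) (PhiMap A').
Proof.
move=> oA oA' adj xi eta hx he x; rewrite !PhiMapE//.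
rewrite -[X in inner _ X x](restr_lift eta) inner_restr.
rewrite -[X in _ = inner X _ x](restr_lift xi) inner_restr.
by apply: adj; exact: lift_hmod.
Qed.

Lemma PhiMap_adjointable A : adjointable A -> adjointable (PhiMap A).
Proof.
move=> [oA [A' oA' adj]]; split; first exact: PhiMap_is_op.
by exists (PhiMap A'); [exact: PhiMap_is_op|exact: PhiMap_adjoint].
Qed.

Lemma ThetaE f g h : Theta f (g, h) = ev f (beta_emb R (ginv g)) (gmul (ginv g) h).
Proof. by []. Qed.

Lemma PhiMap_Lambda f : PhiMap (Lambda f) = Top (Theta f).
Proof.
apply/funext => xi; have [hx|nx] := pselect (hmod xi); last first.
  by rewrite PhiMap_out// /Top /on_hmod memNset.
rewrite PhiMapE// /Top /on_hmod mem_set//; apply/funext => g.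
have eg : beta_q (unit_pt (grng g)) = grng g by rewrite unit_ptq.
rewrite /restr LambdaE//; last exact: lift_hmod.
rewrite eg /fibre_int; apply: csum_eq => h hg.
rewrite ev_lift; last by rewrite eg.
(* Translating the unit at [grng g] by the inverse of [g] gives the arrow [ginv g], the point at
   which [Theta] evaluates. *)
rewrite /kern /unit_pt act_emb ?rng1 ?srcV// amulr1 ?srcV//.
Qed.

Lemma Top_ext (F F' : G * G -> C) :
  (forall g h, grng g = grng h -> F (g, h) = F' (g, h)) -> Top F = Top F'.
Proof.
move=> e; apply/funext => xi; rewrite /Top /on_hmod; case: ifP => // _.
by apply/funext => g; apply: csum_eq => h hg; rewrite e.
Qed.

Lemma Theta_Ct f : Cc f -> Ct (Theta f).
Proof.
move=> Cf; have [K cK fK] := Cc_sd_supp Cf; have [M M0 fM] := Cc_bound Cf.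
have clK := compact_closed hausdorff_arrows cK.
have cmul (p : G * G) : fibre_product p ->
    (fun q : G * G => gmul (ginv q.1) q.2) @ within (@fibre_product G) (nbhs p) -->
    gmul (ginv p.1) p.2.
  move=> fp; apply: cvg_mul; first by rewrite srcV.
  - by apply: cvg_inv; apply: cvg_within_filter; exact: cvg_fst.
  - by apply: cvg_within_filter; exact: cvg_snd.
  - by rewrite near_withinE; apply: filterE => q; rewrite srcV.
split.
- apply/subspace_continuousP => p fp.
  apply: (continuous_sd_cont Cf.1).
  + by rewrite beta_q_emb rngM ?srcV.
  + by apply: cvg_beta_emb; apply: cvg_inv; apply: cvg_within_filter; exact: cvg_fst.
  + exact: cmul.
  + rewrite near_withinE; apply: filterE => q fq.
    by rewrite beta_q_emb rngM ?srcV.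
- by exists M => p _; exact: ev_bound.
- exists (@fibre_product G `&` [set p | K (gmul (ginv p.1) p.2)]).
    split; first by move=> p [].
    by exists K => //; move=> _ [p [_ Kp] <-].
  move=> p [fp cp]; split=> //=; apply: contrapT => nK.
  have n1 : within (@fibre_product G) (nbhs p) [set q | ~ K (gmul (ginv q.1) q.2)].
    by apply: (cmul p fp (~` K)); apply: open_nbhs_nbhs; split=> //; exact: closed_openC.
  have [q [[fq fq0] nq]] := cp _ n1.
  by case/eqP: fq0; apply: fK; exact: nq.
Qed.

Lemma Theta_surj (F : G * G -> C) : Ct F -> exists2 f : SD -> C, Cc f &
  forall g h, grng g = grng h -> Theta f (g, h) = F (g, h).
Proof.
move=> [cF [M FM] [D [Dfp [K DK [cK clK]]] FD]].
(* The change of variables inverse to that of [Theta]. Its second variable is the product that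
   defines tubes, so the tube condition becomes compactness of the support in [h]. *)
pose P g h := F (ginv g, gmul (ginv g) h).
have PK g h : grng g = grng h -> ~ K h -> P g h = 0.
  move=> gh nK; apply: contrapT => /eqP ne; apply: nK.
  have fp : fibre_product (ginv g, gmul (ginv g) h).
    by rewrite /fibre_product /= rngM ?srcV.
  have := DK _ (imageP (fun p : G * G => gmul (ginv p.1) p.2)
    (FD _ (conj fp (subset_closure (conj fp ne))))).
  by rewrite /= amulKg// srcV.
have [|||Phi [cPhi PhiE _]] := @beta_extension R G P `|M|.
- by [].
- move=> I FF FFF u v g h gh ug vh uv.
  have c1 : (fun i => gmul (ginv (u i)) (v i)) @ FF --> gmul (ginv g) h.
    apply: cvg_mul (cvg_inv ug) vh _; first by rewrite srcV.
    by apply: filterS uv => i e; rewrite srcV.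
  apply: (@within_cvg _ _ _ F _ FF _ (fun i => (ginv (u i), gmul (ginv (u i)) (v i))) _ cF).
  + by rewrite /fibre_product /= rngM ?srcV.
  + exact: (cvg_pair (cvg_inv ug) c1).
  + by apply: filterS uv => i e; rewrite /fibre_product /= rngM ?srcV.
- move=> g h gh; apply: le_trans (ler_norm M); apply: FM.
  by rewrite /fibre_product /= rngM ?srcV.
(* The extension inherits the vanishing off [K] by density of the arrows, since [K] is closed. *)
have PhiK z h : beta_q z = grng h -> ~ K h -> Phi z h = 0.
  move=> zh nK; have [c1 c2 n1 n2] := sd_dense zh.
  have nbK : nbhs h (~` K) by apply: open_nbhs_nbhs; split=> //; exact: closed_openC.
  have n3 : \forall k \near beta_filter z, ~ K (sec h (grng k)) := c2 _ nbK.
  apply: (cvg_near_eq (@cplx_hausdorff R) (cPhi _ _ _ _ _ _ _ zh c1 c2 n2) (cvg_cst 0)).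
  by apply: filterS2 n2 n3 => k; rewrite beta_q_emb => e nKk; rewrite PhiE// PK.
exists (sd_of Phi); first by apply: ccp_Cc; split=> //; exists K.
move=> g h gh; rewrite ThetaE ev_sd_of; last by rewrite beta_q_emb rngM ?srcV.
by rewrite PhiE ?rngM ?srcV// /P ainvK amulKVg.
Qed.

Lemma PhiMap_isometric f (M : R) : Cc f -> opbd (PhiMap (Lambda f)) M -> opbd (Lambda f) M.
Proof.
move=> Cf; rewrite PhiMap_Lambda => -[M0 hM].
apply: opbd_dense => //.
- exact: Lambda_is_op.
- exact: Lambda_oplin.
- exact: Lambda_opbd.
move=> xi r Cx hr; have [r0 xr] := (hbd_sd xi r).1 hr.
have Mr0 : 0 <= M * r by exact: mulr_ge0.
set eta := Lambda f xi; have Ce : Cc eta by exact: Lambda_Cc.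
have claim k : l2le (@fibre G (grng k)) (ev eta (beta_emb R k)) (M * r).
  have bij := left_translation_bij k; have [hf _ _] := bij.
  apply/(l2le_reindex _ _ bij).
  (* The vector over the point [k], read on the fibre over [gsrc k]. Its support there is finite, so
     [extend_from_fibre] applies and [hM] can be used. *)
  pose zeta h := ev xi (beta_emb R k) (gmul k h).
  have zr : l2le (@fibre G (gsrc k)) zeta r.
    by apply/(l2le_reindex _ _ bij); have := xr (beta_emb R k); rewrite beta_q_emb.
  have [K cK xK] := Cc_sd_supp Cx.
  have [l lA lK] := compact_fibre (grng k) cK.
  have l'A : fin_in (@fibre G (gsrc k)) [seq gmul (ginv k) h | h <- l].
    by rewrite -(rngV k); apply: fin_in_translate; rewrite srcV.
  have z0 h : grng h = gsrc k -> h \notin [seq gmul (ginv k) h | h <- l] -> zeta h = 0.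
    move=> hk hl; apply: xK => Kh; case/negP: hl; apply/mapP.
    exists (gmul k h); last by rewrite amulKg.
    by apply: lK => //; rewrite rngM.
  have [zt [Cz hz zE]] := extend_from_fibre r0 l'A z0 zr.
  have := (hM _ _ (Cc_hmod Cz) hz).2 (gsrc k); apply: l2le_eq => g gk /=.
  have kg : gsrc k = grng g by rewrite gk.
  rewrite /Top /on_hmod mem_set; last exact: Cc_hmod.
  rewrite /eta LambdaE; [|exact: Cc_hmod|by rewrite beta_q_emb rngM].
  rewrite beta_q_emb (csum_reindex _ bij) /fibre_int gk.
  apply: csum_eq => h hk /=; rewrite zE// /kern ThetaE.
  have kh : gsrc k = grng h by rewrite hk.
  (* Both factors [k] cancel: the entry at (k g, k h) over [k] is the value of [f] at the point g^-1
     and the arrow g^-1 h, that is [Theta f (g, h)]. *)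
  rewrite act_emb ?srcV ?rngM// inv_mulM//; last by rewrite -kg.
  by rewrite ainvM// -amulA ?srcV ?rngV ?kg// amulVg amulr1// srcV.
apply/hbd_sd; split=> // z s sA; have [us sz] := sA.
have cr := @cvg_rng_beta_filter R G z.
have n1 : \forall k \near beta_filter z, {in s &, injective (fun g => sec g (grng k))}.
  exact: (cr _ (sections_distinct us sz)).
have n2 : \forall k \near beta_filter z, forall g, g \in s -> sec_dom g (grng k).
  apply: near_all => g gs; apply: (cr (sec_dom g)).
  by rewrite -(sz g gs); exact: near_sec_dom.
(* A partial sum over the fibre at [z] is a limit of sums along sections over arrows [k]. Eventually
   these sections are distinct, so [claim] bounds the sums. *)
have cs : (fun k => \sum_(g <- s) cnorm (ev eta (beta_emb R k) (sec g (grng k))) ^+ 2)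
    @ beta_filter z --> \sum_(g <- s) cnorm (ev eta z g) ^+ 2.
  apply: (@cvg_bigsum R G _ (beta_filter z) _ s
    (fun g k => cnorm (ev eta (beta_emb R k) (sec g (grng k))) ^+ 2)).
  move=> g gs; have zg : beta_q z = grng g by rewrite (sz g gs).
  have [c1 c2 _ n3] := sd_dense zg.
  have c3 := continuous_sd_cont Ce.1 _ zg c1 c2 n3.
  by rewrite expr2; apply: cvgM; apply: cvg_cnorm; exact: c3.
rewrite leNgt; apply/negP => lt.
have n4 : \forall k \near beta_filter z, (M * r) ^+ 2 <
    \sum_(g <- s) cnorm (ev eta (beta_emb R k) (sec g (grng k))) ^+ 2.
  exact: (cvgr_gt _ cs _ lt).
have [k [inj [D ltk]]] := filter_ex (filterI n1 (filterI n2 n4)).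
move: ltk; rewrite /= ltNge -(big_map (fun g => sec g (grng k)) xpredT
  (fun g => cnorm (ev eta (beta_emb R k) g) ^+ 2)) => /negP; apply; apply: claim.
split; first by rewrite map_inj_in_uniq.
by move=> _ /mapP[g gs ->]; rewrite /fibre /= sec_range//; exact: D.
Qed.

End RestrictionToUnits.

(** * The isomorphism *)

Lemma opnorm_le (R : realType) (H K : groupoid_data) (A : op R H) (B : op R K) :
  oplin A -> oplin B -> (forall M, opbd B M -> opbd A M) -> (opnorm A <= opnorm B)%E.
Proof.
move=> lA lB h; have := opnorm_ge0 B; case e : (opnorm B) => [M| |] //; last first.
  by move=> _; exact: leey.
rewrite lee_fin => M0; apply/opnormP => //; apply: h; apply/opnormP => //.
by rewrite e.
Qed.

Lemma opbd_zero (R : realType) (H : groupoid_data)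
    (Hb : forall xi : H -> cplx R, Cc xi -> exists r, hbd xi r) (A B : op R H) :
  is_op A -> is_op B -> opbd (A - B) 0 -> A = B.
Proof.
move=> oA oB [_ h]; apply: op_ext => // xi hx; have [r hr] := hmod_hbd Hb hx.
by have := h _ _ hx hr; rewrite mul0r => /hbd_zero/eqP; rewrite opB_E subr_eq0 => /eqP.
Qed.

Lemma opclosureS (R : realType) (H : groupoid_data) (S T : set (op R H)) :
  S `<=` T -> opclosure S `<=` opclosure T.
Proof.
by move=> ST A [aA h]; split=> // e /h[B SB hB]; exists B => //; exact: ST.
Qed.

Section UniformAlgebra.
Context {R : realType} {G : etale_groupoid}.
Local Notation C := (cplx R).
Local Notation SD := (semidirect R G).
Local Notation PhiMap := (@PhiMap R G).
Implicit Types (A : op R SD) (B : op R G).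

Let DS : set (op R SD) := @Lambda R SD @` Cc.
Let DT : set (op R G) := @Top R G @` @Ct R G.

Let SDb := @sd_Cc_bounded R G.
Let Gb := @Cc_fibre_bounded R G.

Let DSa : DS `<=` adjointable := sa_adjointable Lambda_star_algebra.

Let DT_image : DT = PhiMap @` DS.
Proof.
apply/seteqP; split=> [_ [F CF <-]|_ [_ [f Cf <-] <-]].
  have [f Cf fF] := Theta_surj CF; exists (Lambda f); first by exists f.
  by rewrite PhiMap_Lambda; exact: Top_ext.
by exists (Theta f); [exact: Theta_Ct|rewrite PhiMap_Lambda].
Qed.

Let DTa : DT `<=` adjointable.
Proof. by rewrite DT_image => _ [A DA <-]; apply: PhiMap_adjointable; exact: DSa. Qed.

(** The structure is carried over from the operators [Lambda f] by [PhiMap], which avoids a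
    convolution calculus for functions supported in tubes. *)
Lemma Top_star_algebra : star_algebra (@Top R G @` @Ct R G).
Proof.
have sS := @Lambda_star_algebra R G; rewrite -/DT DT_image; split.
- by rewrite -DT_image.
- move=> _ [A DA <-]; have [M hM] := sa_bounded sS DA.
  by exists M; exact: PhiMap_opbd.
- by have [A DA] := sa_nonempty sS; exists (PhiMap A), A.
- move=> _ _ [A DA <-] [A' DA' <-]; exists (A + A'); last exact: PhiMap_add.
  exact: sa_add.
- move=> c _ [A DA <-]; exists (scale_op c A); last exact: PhiMap_scale.
  exact: sa_scale.
- move=> _ _ [A DA <-] [A' DA' <-]; exists (A \o A'); first exact: sa_comp.
  by apply: PhiMap_comp; exact: DSa.
- move=> _ B [A DA <-] aB adj; have [oA [A' oA' adj']] := DSa DA.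
  have aA' := adjointable_adjoint SDb oA oA' adj'.
  exists A'; first exact: (sa_star sS DA aA' adj').
  have adj2 := PhiMap_adjoint oA oA' adj'.
  exact: (adjoint_unique Gb (PhiMap_is_op oA) (PhiMap_is_op oA') aB.1 adj2 adj).
Qed.

(** The generators already form a *-algebra, so the closure is the smallest C*-subalgebra containing
    them. *)
Lemma Cstar_uE : Cstar_u R G = opclosure (@Top R G @` @Ct R G).
Proof.
have sT := Top_star_algebra; apply/seteqP; split=> A.
  move=> [aA h]; apply: h; first exact: (opclosure_cstar Gb).
  exact: (sub_opclosure Gb).
move=> cA; split; first by case: cA.
by move=> S cS DS'; apply: (cstar_sub_closed cS); exact: opclosureS cA.
Qed.

Let cs : is_cstar_subalgebra (opclosure DS).
Proof. by apply: (opclosure_cstar SDb); exact: Lambda_star_algebra. Qed.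

Let aS A : opclosure DS A -> adjointable A. Proof. by case. Qed.

Let subS A A' : opclosure DS A -> opclosure DS A' -> opclosure DS (A - A').
Proof.
move=> h k; apply: (cstar_subD cs) => //; rewrite -scale_opN1.
exact: (cstar_subZ cs).
Qed.

(** Approximating within e/2 costs e/2 once before and once after [PhiMap_isometric], and [e] is
    arbitrary. *)
Let isometric A (M : R) : opclosure DS A -> opbd (PhiMap A) M -> opbd A M.
Proof.
move=> /(opclosureP SDb _ DSa)[aA hA] hM; apply: opbd_eps; first by case: hM.
move=> e e0; have e2 : 0 < e / 2 by rewrite divr_gt0.
have [_ [f Cf <-] hf] := hA _ e2.
have h1 : opbd (PhiMap (Lambda f)) (e / 2 + M).
  have := PhiMap_opbd (opbd_subC hf); rewrite PhiMap_sub => h2.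
  by have := opbd_add h2 hM; rewrite subrK.
have := opbd_add hf (PhiMap_isometric Cf h1); rewrite subrK.
by congr opbd; rewrite addrA -splitr addrC.
Qed.

Let injective A A' : opclosure DS A -> opclosure DS A' -> PhiMap A = PhiMap A' -> A = A'.
Proof.
move=> cA cA' e; apply: (opbd_zero SDb (aS cA).1 (aS cA').1).
apply: isometric; first exact: subS.
rewrite PhiMap_sub e subrr; split=> // xi r _ [r0 _].
by rewrite mul0r; exact: hbd0.
Qed.

Let PhiMap_closure A : opclosure DS A -> opclosure DT (PhiMap A).
Proof.
move=> /(opclosureP SDb _ DSa)[aA hA]; apply/(opclosureP Gb _ DTa).
split; first exact: PhiMap_adjointable.
move=> e /hA[A' DA' h]; exists (PhiMap A'); first by rewrite DT_image; exists A'.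
by rewrite -PhiMap_sub; exact: PhiMap_opbd.
Qed.

(** By [isometric], preimages of operators converging to [B] form a Cauchy sequence; its limit is
    adjointable and maps to [B]. *)
Let surjective B : opclosure DT B -> exists2 A, opclosure DS A & PhiMap A = B.
Proof.
move=> /(opclosureP Gb _ DTa)[aB hB].
have ex n : exists A, DS A /\ opbd (B - PhiMap A) n.+1%:R^-1.
  have [|T] := hB n.+1%:R^-1; first by rewrite invr_gt0 ltr0n.
  by rewrite DT_image => -[A DA <-] h; exists A.
pose A n := projT1 (cid (ex n)).
have AP n : DS (A n) /\ opbd (B - PhiMap (A n)) n.+1%:R^-1 := projT2 (cid (ex n)).
have cA n : opclosure DS (A n) by apply: (sub_opclosure SDb) => //; exact: (AP n).1.
pose As n := projT1 (cid2 (aS (cA n)).2).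
have AsP n : is_op (As n) /\ adjoint_of (A n) (As n).
  by rewrite /As; case: cid2.
have [n|n|n m|L [aL hL]] := adjointable_limit SDb (A := A) (B := As).
- by split; [exact: (aS (cA n)).1|exact: (AsP n).1].
- exact: (AsP n).2.
- apply: isometric; first exact: subS.
  rewrite PhiMap_sub; apply: opbd_triangle (opbd_subC (AP n).2) (AP m).2.
have small (e K : R) : 0 < e -> 0 < K -> exists n, K * n.+1%:R^-1 <= e.
  move=> e0 K0; have /= [n _ /(_ n (leqnn n)) hn] := near_infty_natSinv_lt (PosNum (divr_gt0 e0 K0)).
  by exists n; rewrite mulrC -ler_pdivlMr// ltW.
have cL : opclosure DS L.
  apply/(opclosureP SDb _ DSa); split=> // e e0; have [n hn] := small e 2 e0 (ltr0Sn _ _).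
  by exists (A n); [exact: (AP n).1|exact: opbdW hn (opbd_subC (hL n))].
exists L => //; apply: (opbd_zero Gb).
- exact: (PhiMap_adjointable aL).1.
- exact: aB.1.
- apply: opbd_eps => // e e0; rewrite add0r.
  (* The constant is 2 + 1: the rate 2/(n+1) of [adjointable_limit] plus the distance 1/(n+1) to
     [B]. *)
  have [n hn] := small e 3 e0 (ltr0Sn _ _).
  apply: (opbdW hn); rewrite (_ : 3 * n.+1%:R^-1 = 2 * n.+1%:R^-1 + n.+1%:R^-1); last by ring.
  apply: opbd_triangle (opbd_subC (AP n).2).
  by rewrite -PhiMap_sub; apply: PhiMap_opbd; exact: opbd_subC.
Qed.

Lemma PhiMap_iso : cstar_iso (Cstar_r R SD) (Cstar_u R G) PhiMap.
Proof.
rewrite Cstar_uE; split; split.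
- exact: PhiMap_closure.
- by move=> A A' _ _; exact: PhiMap_add.
- by move=> c A _; exact: PhiMap_scale.
- by move=> A A' cA cA'; apply: PhiMap_comp; exact: aS.
- by move=> A A' cA cA'; apply: PhiMap_adjoint; [exact: (aS cA).1|exact: (aS cA').1].
- exact: PhiMap_closure.
- by move=> A A' /set_mem cA /set_mem cA'; exact: injective.
- by move=> B /surjective[A cA <-]; exists A.
Qed.

Lemma PhiMap_opnorm A : Cstar_r R SD A -> opnorm (PhiMap A) = opnorm A.
Proof.
move=> cA; have lA := adjointable_oplin SDb (aS cA).
have lB := adjointable_oplin Gb (PhiMap_adjointable (aS cA)).
apply/eqP; rewrite eq_le; apply/andP; split; apply: opnorm_le => // M.
  exact: PhiMap_opbd.
exact: isometric.
Qed.

Lemma Lambda_lift (f : G -> C) :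
  PhiMap (Lambda (lift_semidirect f)) = Lambda f /\ Top (lift_uniform f) = Lambda f.
Proof.
split=> //; rewrite PhiMap_Lambda -[RHS]/(Top (lift_uniform f)); apply: Top_ext => g h gh.
by rewrite ThetaE ev_lift// beta_q_emb rngM ?srcV.
Qed.

Lemma Cstar_r_sub_u : Cstar_r R G `<=` Cstar_u R G.
Proof.
rewrite Cstar_uE; apply: opclosureS => _ [f Cf <-]; rewrite -/DT DT_image.
exists (Lambda (lift_semidirect f)); last exact: (Lambda_lift f).1.
by exists (lift_semidirect f) => //; exact: lift_Cc.
Qed.

(** The map is the inverse of [PhiMap] over [Cstar_r R G]; its algebraic properties are verified
    after applying [PhiMap], by injectivity. *)
Lemma Cstar_r_embedding : exists iota : op R G -> op R SD,
  cstar_embedding (Cstar_r R G) (Cstar_r R SD) iota /\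
  forall B, Cstar_r R G B -> PhiMap (iota B) = B.
Proof.
pose iota B := xget 0 [set A | opclosure DS A /\ PhiMap A = B].
have iotaP B : Cstar_r R G B -> opclosure DS (iota B) /\ PhiMap (iota B) = B.
  move=> /Cstar_r_sub_u; rewrite Cstar_uE => /surjective[A cA AB].
  by rewrite /iota; case: xgetP => [A' _ //|/(_ A) []].
have out B A : opclosure DS A -> PhiMap A = B -> iota B = A.
  move=> cA e; rewrite /iota; case: xgetP => [A' _ [c' e']|/(_ A) []//].
  by apply: injective => //; rewrite e'.
exists iota; split; last by move=> B /iotaP[].
split; last first.
  by move=> B /iotaP[c e]; rewrite -[in RHS]e PhiMap_opnorm.
split.
- by move=> B /iotaP[].
- move=> B B' /iotaP[c e] /iotaP[c' e']; apply: out; first exact: (cstar_subD cs).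
  by rewrite PhiMap_add e e'.
- move=> k B /iotaP[c e]; apply: out; first exact: (cstar_subZ cs).
  by rewrite PhiMap_scale e.
- move=> B B' /iotaP[c e] /iotaP[c' e']; apply: out; first exact: (cstar_subM cs).
  by rewrite PhiMap_comp ?e ?e'//; exact: aS.
- move=> B B' cB cB' adj; have [c e] := iotaP B cB; have [c' e'] := iotaP B' cB'.
  have [oA [A' oA' adj']] := aS c.
  have aA' := adjointable_adjoint SDb oA oA' adj'.
  have cA' := cstar_sub_star cs c aA' adj'.
  (* The image of the adjoint [A'] is an adjoint of [B], hence equals [B'] by uniqueness. *)
  suff -> : iota B' = A' by [].
  apply: injective => //; rewrite e'.
  have adj2 := PhiMap_adjoint oA oA' adj'; rewrite e in adj2.
  exact: (adjoint_unique Gb cB.1.1 cB'.1.1 (PhiMap_is_op oA') adj adj2).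
Qed.

End UniformAlgebra.

Theorem theorem7p6 (R : realType) (G : etale_groupoid) :
  exists Phi : op R (semidirect R G) -> op R G,
    [/\ cstar_iso (Cstar_r R (semidirect R G)) (Cstar_u R G) Phi,
        forall f : semidirect R G -> cplx R, Cc f ->
          Cstar_r R (semidirect R G) (Lambda f) /\
          Phi (Lambda f) = Top (Theta f) &
        exists iota_r : op R G -> op R (semidirect R G),
        exists iota_u : op R G -> op R G,
          [/\ cstar_embedding (Cstar_r R G) (Cstar_r R (semidirect R G)) iota_r,
              forall f : G -> cplx R, Cc f ->
                iota_r (Lambda f) = Lambda (lift_semidirect f),
              cstar_embedding (Cstar_r R G) (Cstar_u R G) iota_u,
              forall f : G -> cplx R, Cc f ->
                iota_u (Lambda f) = Top (lift_uniform f) &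
              forall A, Cstar_r R G A -> Phi (iota_r A) = iota_u A]].
Proof.
have clS (f : semidirect R G -> cplx R) : Cc f -> Cstar_r R (semidirect R G) (Lambda f).
  move=> Cf; apply: (sub_opclosure (@sd_Cc_bounded R G)); last by exists f.
  exact: (sa_adjointable Lambda_star_algebra).
have [iota [emb iotaK]] := @Cstar_r_embedding R G.
have [[iota_in _ _ _ _] _] := emb.
have LG (f : G -> cplx R) : Cc f -> Cstar_r R G (Lambda f).
  move=> Cf; have [e _] := Lambda_lift f.
  have DGa : @Lambda R G @` Cc `<=` adjointable.
    move=> _ [k Ck <-]; rewrite -(Lambda_lift k).1; apply: PhiMap_adjointable.
    by apply: Lambda_adjointable; exact: lift_Cc.
  by apply: (sub_opclosure (@Cc_fibre_bounded R G)) => //; exists f.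
exists (@PhiMap R G); split.
- exact: PhiMap_iso.
- by move=> f Cf; split; [exact: clS|exact: PhiMap_Lambda].
(* The embedding into the uniform algebra is the identity map, because [Top (lift_uniform f)] and
   [Lambda f] are the same operator by definition. *)
- exists iota, id; split=> //.
  + move=> f Cf; have [[_ _ _ _ _] [_ inj _]] := @PhiMap_iso R G.
    have cf : Cstar_r R (semidirect R G) (Lambda (lift_semidirect f)).
      by apply: clS; exact: lift_Cc.
    apply: inj; [exact/mem_set/iota_in/LG|exact: mem_set|].
    by rewrite iotaK ?(Lambda_lift f).1//; exact: LG.
  + by split=> //; split=> //; exact: Cstar_r_sub_u.
Qed.
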